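(* Let $(Q,\mathfrak n,k)$ be a local Noetherian ring, $\varphi:Q\to R$ a surjective ring map onto a cyclic $Q$-algebra $R$, and $M$ a finitely generated $R$-module. Assume that $c=\max\{\operatorname{pd}_QR,\ \operatorname{pd}_QM-1\}$ is finite. If the coefficientwise inequality $$P^R_M(t)\preccurlyeq\frac{P^Q_M(t)}{1-t(P^Q_R(t)-1)}$$ is an equality up to the coefficient of $t^{c+1}$, then $M$ is $\varphi$-Golod.
   Context: For a local ring $S$ with residue field $k$ and a finitely generated $S$-module $M$, the Poincaré series is $P^S_M(t)=\sum_{n\ge0}\dim_k\operatorname{Tor}^S_n(M,k)\,t^n$. The displayed inequality (the Golod bound) always holds. $M$ is $\varphi$-Golod if it is an equality of power series. *)

(* Defs.v *)
From HB Require Import structures.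
From mathcomp Require Import all_boot all_order all_algebra.
From mathcomp Require Import boolp classical_sets.

Set Implicit Arguments.
Unset Strict Implicit.
Unset Printing Implicit Defensive.

Import Order.TTheory GRing.Theory Num.Theory.
Local Open Scope ring_scope.
Local Open Scope classical_set_scope.

Definition is_ideal (S : comNzRingType) (I : set S) : Prop :=
  [/\ I 0, forall x y, I x -> I y -> I (x + y) & forall a x, I x -> I (a * x)].

Definition maximal_ideal (S : comNzRingType) (m : set S) : Prop :=
  [/\ is_ideal m, ~ m 1
    & forall J : set S, is_ideal J -> m `<=` J -> ~ J 1 -> J = m].

Definition local_ring (S : comNzRingType) (m : set S) : Prop :=
  maximal_ideal m /\ forall J : set S, maximal_ideal J -> J = m.

Definition noetherian (S : comNzRingType) : Prop :=
  forall I : set S, is_ideal I ->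
  exists (n : nat) (g : 'I_n -> S),
    forall x, I x <-> exists a : 'I_n -> S, x = \sum_(i < n) a i * g i.

(* [pi] exhibits the field [k] as the quotient [S / m]. *)
Definition residue_map (S : comNzRingType) (m : set S) (k : fieldType)
    (pi : {rmorphism S -> k}) : Prop :=
  (forall y, exists x, pi x = y) /\ (forall x, pi x = 0 <-> m x).

Definition fin_gen (S : comNzRingType) (M : lmodType S) : Prop :=
  exists (n : nat) (g : 'I_n -> M),
    forall x, exists a : 'I_n -> S, x = \sum_(i < n) a i *: g i.

(* The [R]-module [M] viewed as a [Q]-module along [phi]. *)
Definition restrict (Q R : comNzRingType) (phi : {rmorphism Q -> R})
  (M : lmodType R) : Type := M.

Section Restrict.
Context (Q R : comNzRingType) (phi : {rmorphism Q -> R}) (M : lmodType R).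

HB.instance Definition _ := GRing.Zmodule.on (restrict phi M).

Let scale (a : Q) (x : restrict phi M) : restrict phi M := phi a *: (x : M).

Fact restrict_scaleA a b x : scale a (scale b x) = scale (a * b) x.
Proof. by rewrite /scale scalerA rmorphM. Qed.

Fact restrict_scale1 : left_id 1 scale.
Proof. by move=> x; rewrite /scale rmorph1 scale1r. Qed.

Fact restrict_scaleDr : right_distributive scale +%R.
Proof. by move=> a x y; rewrite /scale scalerDr. Qed.

Fact restrict_scaleDl x : {morph scale^~ x : a b / a + b}.
Proof. by move=> a b; rewrite /scale rmorphD scalerDl. Qed.

HB.instance Definition _ :=
  GRing.Zmodule_isLmodule.Build Q (restrict phi M)
    restrict_scaleA restrict_scale1 restrict_scaleDr restrict_scaleDl.

End Restrict.

Definition projective (S : comNzRingType) (P : lmodType S) : Prop :=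
  forall (A B : lmodType S) (g : {linear A -> B}) (f : {linear P -> B}),
    (forall y, exists x, g x = y) ->
    exists h : {linear P -> A}, forall x, g (h x) = f x.

Record resolution (S : comNzRingType) (M : lmodType S) := Resolution {
  res_mod :> nat -> lmodType S;
  res_proj : forall n, projective (res_mod n);
  res_d : forall n, {linear res_mod n.+1 -> res_mod n};
  res_aug : {linear res_mod 0 -> M};
  res_aug_surj : forall y, exists x, res_aug x = y;
  res_aug_exact : forall x, res_aug x = 0 <-> exists y, res_d 0 y = x;
  res_exact : forall n x, res_d n x = 0 <-> exists y, res_d n.+1 y = x }.

Definition projdim_le (S : comNzRingType) (M : lmodType S) (n : nat) : Prop :=
  exists F : resolution M, forall i, (n < i)%N -> forall x : F i, x = 0.

(* [pd_S M = n].  The zero module gets [n = 0]. *)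
Definition projdim (S : comNzRingType) (M : lmodType S) (n : nat) : Prop :=
  projdim_le M n /\ forall m, projdim_le M m -> (n <= m)%N.

(* [u] exhibits [V] as the tensor product of [P] and [k] over [S], with its
   structure of [k]-vector space: it is the universal [pi]-semilinear map out
   of [P]. *)
Definition is_tensor (S : comNzRingType) (k : fieldType)
    (pi : {rmorphism S -> k}) (P : lmodType S) (V : lmodType k)
    (u : {linear P -> V | pi \; *:%R}) : Prop :=
  forall (W : lmodType k) (f : {linear P -> W | pi \; *:%R}),
    (exists g : {linear V -> W}, forall x, g (u x) = f x) /\
    (forall g g' : {linear V -> W},
      (forall x, g (u x) = f x) -> (forall x, g' (u x) = f x) -> g =1 g').

Definition cycle_at (k : fieldType) (V : nat -> lmodType k)
    (D : forall n, {linear V n.+1 -> V n}) (n : nat) : V n -> Prop :=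
  match n return V n -> Prop with
  | 0 => fun _ => True
  | m.+1 => fun x => D m x = 0
  end.

(* [dim_k H_n(V, D) = b]: some [b] cycles induce a basis of cycles modulo
   boundaries. *)
Definition homology_dim (k : fieldType) (V : nat -> lmodType k)
    (D : forall n, {linear V n.+1 -> V n}) (n b : nat) : Prop :=
  exists z : 'I_b -> V n,
    (forall i, cycle_at D (z i)) /\
    (forall x, cycle_at D x ->
      exists! a : 'rV[k]_b,
        exists y, x = \sum_(i < b) a ord0 i *: z i + D n y).

(* [dim_k Tor^S_n(M, k) = b], where [k] is an [S]-algebra via [pi]. *)
Definition tor_dim (S : comNzRingType) (k : fieldType)
    (pi : {rmorphism S -> k}) (M : lmodType S) (n b : nat) : Prop :=
  exists (F : resolution M) (V : nat -> lmodType k)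
    (u : forall i, {linear F i -> V i | pi \; *:%R})
    (D : forall i, {linear V i.+1 -> V i}),
    [/\ forall i, is_tensor (u i),
        forall i x, D i (u i.+1 x) = u i (res_d F i x)
      & homology_dim D n b].

(* The default value 0 is never used for a finitely generated module over a
   Noetherian ring. *)
Definition betti (S : comNzRingType) (k : fieldType)
    (pi : {rmorphism S -> k}) (M : lmodType S) (n : nat) : nat :=
  xget 0%N [set b | tor_dim pi M n b].

(* A formal power series over the integers is its sequence of coefficients. *)
Definition fps := nat -> int.

Definition fps_one : fps := fun n => (n == 0%N)%:R.

Definition fps_mul (f g : fps) : fps :=
  fun n => \sum_(i < n.+1) f i * g (n - i)%N.

Definition fps_sub (f g : fps) : fps := fun n => f n - g n.

Definition fps_mulX (f : fps) : fps :=
  fun n => if n is m.+1 then f m else 0.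

Definition fps_exp (f : fps) (j : nat) : fps := iter j (fps_mul^~ f) fps_one.

(* [1 / (1 - f)] for [f] without constant term, as the sum of all the powers
   of [f]; those of exponent [> n] do not contribute in degree [n].  See
   [fps_geomK]. *)
Definition fps_geom (f : fps) : fps := fun n => \sum_(j < n.+1) fps_exp f j n.

Lemma fps_exp_low (f : fps) j i : f 0%N = 0 -> (i < j)%N -> fps_exp f j i = 0.
Proof.
move=> f0; elim: j i => // j IHj i; rewrite ltnS => le_ij.
rewrite /= /fps_mul big1 // => l _.
have [/IHj-> | le_jl] := ltnP l j; first by rewrite mul0r.
have -> : (i - l = 0)%N by apply/eqP; rewrite subn_eq0 (leq_trans le_ij).
by rewrite f0 mulr0.
Qed.

Lemma fps_geomK (f : fps) : f 0%N = 0 ->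
  fps_mul (fps_geom f) (fps_sub fps_one f) =1 fps_one.
Proof.
move=> f0 n.
have geomE i : (i <= n)%N -> fps_geom f i = \sum_(j < n.+1) fps_exp f j i.
  move=> le_in; rewrite /fps_geom (big_ord_widen n.+1 (fps_exp f ^~ i)) //.
  rewrite big_mkcond; apply: eq_bigr => j _ /=.
  by case: ltnP => // ?; rewrite fps_exp_low.
have -> : fps_mul (fps_geom f) (fps_sub fps_one f) n =
    fps_geom f n - \sum_(i < n.+1) fps_geom f i * f (n - i)%N.
  rewrite /fps_mul /fps_sub.
  under eq_bigr do rewrite mulrBr.
  rewrite sumrB; congr (_ - _).
  rewrite big_ord_recr /= subnn /fps_one eqxx mulr1 big1 ?add0r // => i _.
  by rewrite subn_eq0 leqNgt ltn_ord mulr0.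
rewrite (geomE n) //.
under [X in _ - X]eq_bigr => i _ do rewrite geomE -1?ltnS // mulr_suml.
rewrite exchange_big /= -sumrB.
have -> : fps_one n = fps_exp f 0 n - fps_exp f n.+1 n.
  by rewrite (@fps_exp_low f n.+1) // subr0.
rewrite -opprB -(telescope_sumr (fun j => fps_exp f j n)) // big_mkord -sumrN.
by apply: eq_bigr => j _; rewrite opprB.
Qed.

Definition poincare (S : comNzRingType) (k : fieldType)
    (pi : {rmorphism S -> k}) (M : lmodType S) : fps :=
  fun n => (betti pi M n)%:Z.

(* P^Q_M(t) / (1 - t (P^Q_R(t) - 1)) *)
Definition golod_bound (Q R : comNzRingType) (k : fieldType)
    (phi : {rmorphism Q -> R}) (piQ : {rmorphism Q -> k})
    (M : lmodType R) : fps :=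
  fps_mul (poincare piQ (restrict phi M))
    (fps_geom (fps_mulX (fps_sub (poincare piQ (restrict phi R^o)) fps_one))).

Definition golod_module (Q R : comNzRingType) (k : fieldType)
    (phi : {rmorphism Q -> R}) (piQ : {rmorphism Q -> k})
    (piR : {rmorphism R -> k}) (M : lmodType R) : Prop :=
  forall n, poincare piR M n = golod_bound phi piQ M n.

(* Main.v *)
(** Let [A] and [G] be the minimal [Q]-free resolutions of [R] and [M].  As [A] is
    acyclic, it carries a strictly unital A-infinity algebra structure, and [G] one of
    A-infinity module over [A].  The words [a_1 | ... | a_r | g], with [a_i] basis
    elements of [A] of positive degree and [g] one of [G], span the bar construction,
    whose differential gives, after tensoring with [R], an [R]-free resolution of [M]
    (Burke).  The number of words of weight [n] is the coefficient of [t^n] in the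
    Golod bound, so the bound is attained exactly when this resolution is minimal.

    Equality in degrees up to [c + 1] makes the differential minimal on the words of
    weight at most [c + 2].  A coefficient of a higher operation is an entry of the
    differential from a word [a | u | g] to a word of a single letter, or without
    letter.  That target lies in degree at most [pd R + 1] or [pd M], so that all these
    coefficients are covered, are in the maximal ideal, and the resolution is minimal. *)

From HB Require Import structures.
Require Import Defs.
From mathcomp Require Import all_boot all_order all_algebra.
From mathcomp Require Import boolp classical_sets.
From mathcomp Require Import zify ring.

Set Implicit Arguments.
Unset Strict Implicit.
Unset Printing Implicit Defensive.

Import Order.TTheory GRing.Theory Num.Theory.
Local Open Scope ring_scope.

(** * Words and bar differentials *)

(** The obstacle is that [A] is not augmented over [Q]: its differential maps [A_1] onto the kernel
    of [Q -> R] inside [A_0 = Q]. Over [Q] the differential on words therefore squares to a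
    curvature, and is a differential only modulo that kernel. Strict unitality controls the
    curvature: a unit that arises between two neighbours is absorbed by either of them, with
    opposite signs, so that only the ends of a word contribute. On [A (x) words] the curvature
    cancels altogether; this is a true complex over [Q], filtered by copies of [A], and cycles on
    words are killed by passing through it. Everything is written in transposed form: an operation
    is a matrix with its first argument as row index and its value as column index, and
    differentials act on functions of words, which allows recursion on the first letter. The gain of
    one weight, from [c + 1] to [c + 2], has this reason: if the rank in degree [n] is the dimension
    of [Tor_n], the differential leaving degree [n + 1] vanishes modulo the maximal ideal too. *)

Section Splits.
Variable L : Type.

Fixpoint splits (u : seq L) : seq (seq L * seq L) :=
  ([::], u) :: (if u is a :: v then [seq (a :: s.1, s.2) | s <- splits v] else [::]).

Lemma big_splits0 (V : nmodType) (F : seq L * seq L -> V) :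
  \sum_(s <- splits [::]) F s = F ([::], [::]).
Proof. by rewrite big_seq1. Qed.

Lemma big_splits_cons (V : nmodType) a u (F : seq L * seq L -> V) :
  \sum_(s <- splits (a :: u)) F s =
  F ([::], a :: u) + \sum_(s <- splits u) F (a :: s.1, s.2).
Proof. by rewrite [splits _]/= big_cons big_map. Qed.

(** Both sides run over the ways to cut [u] into three words: deconcatenation is coassociative. *)
Lemma big_splitsA (V : nmodType) u (F : seq L -> seq L -> seq L -> V) :
  \sum_(s <- splits u) \sum_(t <- splits s.1) F t.1 t.2 s.2 =
  \sum_(s <- splits u) \sum_(t <- splits s.2) F s.1 t.1 t.2.
Proof.
elim: u F => [|a u IHu] F; first by rewrite !big_splits0.
rewrite !big_splits_cons !big_splits0 /= -(IHu (fun x => F (a :: x))) -addrA.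
by congr (_ + _); rewrite -big_split; apply: eq_bigr => s _; rewrite big_splits_cons.
Qed.

Lemma big_splits_top (V : nmodType) u (F : seq L * seq L -> V) :
  (forall s, (size s.1 < size u)%N -> s.1 ++ s.2 = u -> F s = 0) ->
  \sum_(s <- splits u) F s = F (u, [::]).
Proof.
elim: u F => [|a u IHu] F F0; first by rewrite big_splits0.
rewrite big_splits_cons F0 // add0r (IHu (fun s => F (a :: s.1, s.2))) //= => s lt_su Es.
by apply: F0 => //=; rewrite Es.
Qed.

(** The equation [s.1 ++ s.2 = u] is handed to the summands because it bounds the weights of the two
    halves. *)
Lemma eq_big_splits (V : nmodType) u (F G : seq L * seq L -> V) :
  (forall s, s.1 ++ s.2 = u -> F s = G s) ->
  \sum_(s <- splits u) F s = \sum_(s <- splits u) G s.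
Proof.
elim: u F G => [|a u IHu] F G FG; first by rewrite !big_splits0 FG.
rewrite !big_splits_cons FG //; congr (_ + _).
by apply: IHu => s Es; apply: FG => /=; rewrite Es.
Qed.
Lemma big_splits_bot (V : nmodType) u (F : seq L * seq L -> V) :
  (forall s, (0 < size s.1)%N -> s.1 ++ s.2 = u -> F s = 0) ->
  \sum_(s <- splits u) F s = F ([::], u).
Proof.
case: u => [|a u] F0; first by rewrite big_splits0.
rewrite big_splits_cons (@eq_big_splits _ u _ (fun=> 0)) => [|s Es].
  by rewrite big1_eq addr0.
by apply: F0 => //=; rewrite Es.
Qed.
End Splits.

(* The basis ['I_N] of [A] has the unit [i0] as its only element of degree 0;
   letters span the augmentation ideal, suspended: hence the [.+1] in [word_wt]. *)
Definition letter (N : nat) (i0 : 'I_N) := {i : 'I_N | i != i0}.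

Definition word_wt (N : nat) (i0 : 'I_N) (dg : 'I_N -> nat) (u : seq (letter i0)) : nat :=
  (\sum_(a <- u) (dg (val a)).+1)%N.

(** A product of letters may have a component on the unit, which is not a letter. The bar
    construction discards it; this is the source of the curvature. *)
Definition consf (N : nat) (i0 : 'I_N) (Q : pzRingType) (V : lmodType Q)
    (f : seq (letter i0) -> V) (v : seq (letter i0)) (i : 'I_N) : V :=
  if insub i is Some c then f (c :: v) else 0.

Definition grade_sign (Q : pzRingType) (N : nat) (dg : 'I_N -> nat) : 'M[Q]_N :=
  diag_mx (\row_i (-1) ^+ dg i).

Section Bar.
Variables (Q : comNzRingType) (N : nat) (i0 : 'I_N) (dg : 'I_N -> nat).
Local Notation L := (letter i0).
Local Notation wt := (@word_wt N i0 dg).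

Lemma wt_cons a u : wt (a :: u) = ((dg (val a)).+1 + wt u)%N.
Proof. by rewrite /word_wt big_cons. Qed.
Lemma wt_nil : wt [::] = 0%N. Proof. by rewrite /word_wt big_nil. Qed.
Lemma wt_cat u v : wt (u ++ v) = (wt u + wt v)%N.
Proof. by rewrite /word_wt big_cat. Qed.

Section Differential.
Variables (rho : seq L -> 'M[Q]_N).
Variables (J : nat) (dgG : 'I_J -> nat) (dG : 'M[Q]_J).
Variable (lam : seq L -> 'I_J -> 'M[Q]_(N, J)).

(* [f] composed with the differential of the bar construction, on the word [u]
   ending in the basis element [g] of [G].  [rho u i j] is the coefficient of [j]
   in the higher product of [i] and the letters of [u], [lam u g i h] that of [h] in
   the higher action of [i] and [u] on [g]; their signs are those of the suspended
   operations, so that no other sign than [(-1) ^+ dg a] appears. *)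
Fixpoint bd (V : lmodType Q) (f : seq L -> 'I_J -> V) (u : seq L) (g : 'I_J) : V :=
  match u with
  | [::] => - \sum_h dG g h *: f [::] h
  | a :: v =>
    - (\sum_(s <- splits v) \sum_i rho s.1 (val a) i *: consf (f^~ g) s.2 i
       + (-1) ^+ dg (val a) *: bd (fun w => f (a :: w)) v g
       + \sum_h lam v g (val a) h *: f [::] h)
  end.

Lemma eq_bd (V : lmodType Q) (f f' : seq L -> 'I_J -> V) u g :
  (forall v h, f v h = f' v h) -> bd f u g = bd f' u g.
Proof. by move=> ff'; congr bd; apply/funext => v; apply/funext => h. Qed.

Lemma bd_linear (V W : lmodType Q) (phi : {linear V -> W}) (f : seq L -> 'I_J -> V) u g :
  phi (bd f u g) = bd (fun v h => phi (f v h)) u g.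
Proof.
elim: u f => [|a u IHu] f /=.
  by rewrite linearN linear_sum; congr (- _); apply: eq_bigr => h _; rewrite linearZ.
rewrite linearN; congr (- _); rewrite !(linearD phi) !(linear_sum phi) (linearZZ phi) IHu.
congr (_ + _ + _); last by apply: eq_bigr => h _; rewrite (linearZZ phi).
apply: eq_bigr => s _; rewrite (linear_sum phi); apply: eq_bigr => i _; rewrite (linearZZ phi).
by rewrite /consf; case: insub => [c|] //; rewrite linear0.
Qed.

Lemma bdD (V : lmodType Q) (f f' : seq L -> 'I_J -> V) u g :
  bd (fun v h => f v h + f' v h) u g = bd f u g + bd f' u g.
Proof.
elim: u f f' => [|a u IHu] f f' /=.
  by rewrite -opprD -big_split; congr (- _); apply: eq_bigr => h _; rewrite scalerDr.
rewrite IHu scalerDr -opprD; congr (- _); rewrite addrACA; congr (_ + _); last first.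
  by rewrite -big_split; apply: eq_bigr => h _; rewrite scalerDr.
rewrite addrACA; congr (_ + _); rewrite -big_split; apply: eq_bigr => s _.
rewrite -big_split; apply: eq_bigr => i _; rewrite /= -scalerDr /consf.
by case: insub => [c|] //; rewrite addr0.
Qed.

Lemma bdZ (V : lmodType Q) c (f : seq L -> 'I_J -> V) u g :
  bd (fun v h => c *: f v h) u g = c *: bd f u g.
Proof. by have /= <- := @bd_linear V V (c \*: idfun) f u g. Qed.

Lemma bdN (V : lmodType Q) (f : seq L -> 'I_J -> V) u g :
  bd (fun v h => - f v h) u g = - bd f u g.
Proof.
by rewrite -[RHS]scaleN1r -bdZ; apply: eq_bd => v h; rewrite scaleN1r.
Qed.

Lemma bd0 (V : lmodType Q) u g : bd (fun _ _ => 0 : V) u g = 0.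
Proof. by have := bdN (fun _ _ => 0 : V) u g; have := bdD (fun _ _ => 0 : V) (fun _ _ => 0) u g;
rewrite addr0 => /eqP; rewrite -subr_eq subrr => /eqP <-. Qed.

Lemma bd_sum (V : lmodType Q) (I : Type) (r : seq I) (f : I -> seq L -> 'I_J -> V) u g :
  bd (fun v h => \sum_(i <- r) f i v h) u g = \sum_(i <- r) bd (f i) u g.
Proof.
elim: r => [|i r IHr].
  by rewrite big_nil -[RHS](bd0 V u g); apply: eq_bd => v h; rewrite big_nil.
by rewrite big_cons -IHr -bdD; apply: eq_bd => v h; rewrite big_cons.
Qed.

Definition homog_bar :=
  forall u i j, rho u i j != 0 -> ((dg j).+1 = dg i + wt u)%N.
Definition homog_dG := forall g h, dG g h != 0 -> dgG g = (dgG h).+1.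
Definition homog_lam :=
  forall u g i h, lam u g i h != 0 -> (dgG h = dg i + wt u + dgG g)%N.

Hypothesis hrho : homog_bar.
Hypothesis hdG : homog_dG.
Hypothesis hlam : homog_lam.

(** The differential lowers the weight by exactly one, so a submodule [P] need only contain the
    values of [f] in that weight. With [P] zero this is locality, with [P] a graded piece it is
    homogeneity. *)
Lemma bd_closed (V : lmodType Q) (P : V -> Prop) (f : seq L -> 'I_J -> V) u g :
  P 0 -> (forall x y, P x -> P y -> P (x + y)) -> (forall a x, P x -> P (a *: x)) ->
  (forall v h, (wt v + dgG h).+1 = (wt u + dgG g)%N -> P (f v h)) ->
  P (bd f u g).
Proof.
move=> P0 PD PZ; have PN x : P x -> P (- x) by rewrite -scaleN1r; apply: PZ.
have Psum I (r : seq I) (F : I -> V) : (forall i, P (F i)) -> P (\sum_(i <- r) F i).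
  by move=> PF; elim/big_ind: _.
have PZ' a x : (a != 0 -> P x) -> P (a *: x).
  by have [->|a0] := eqVneq a 0; rewrite ?scale0r // => /(_ isT)/PZ.
elim: u f => [|a u IHu] f Pf /=.
  apply/PN/Psum => h; apply: PZ' => /hdG Eg; apply: Pf; lia.
apply/PN/PD; [apply: PD|].
- suff: forall s, s.1 ++ s.2 = u ->
     P (\sum_i rho s.1 (val a) i *: consf (f^~ g) s.2 i).
    (* [Psum] asks for [P] at every pair, so the terms are replaced by zero at pairs that do not
       split [u]. *)
    move=> Ps; rewrite (@eq_big_splits _ _ u _ (fun s => if `[< s.1 ++ s.2 = u >] then
     \sum_i rho s.1 (val a) i *: consf (f^~ g) s.2 i else 0)); last first.
      by move=> s Es; case: asboolP.
    by apply: Psum => s; case: asboolP => // /Ps.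
  move=> s Es; apply: Psum => i; apply: PZ' => /hrho Ei; rewrite /consf.
  case: insubP => [c _ ci|//]; apply: Pf.
  by rewrite !wt_cons -Es wt_cat ci Ei !addSn !addnA.
- by apply: PZ; apply: IHu => v h Ev; apply: Pf; rewrite !wt_cons -addnA -addnS Ev addnA.
- by apply: Psum => h; apply: PZ' => /hlam Eh; apply: Pf; rewrite wt_cons wt_nil Eh !addSn add0n.
Qed.

Lemma bd_local (V : lmodType Q) (f f' : seq L -> 'I_J -> V) u g :
  (forall v h, (wt v + dgG h).+1 = (wt u + dgG g)%N -> f v h = f' v h) ->
  bd f u g = bd f' u g.
Proof.
move=> ff'; apply/eqP; rewrite -subr_eq0 -bdN -bdD; apply/eqP.
apply: (@bd_closed _ (fun x => x = 0)) => //.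
- by move=> x y -> ->; rewrite addr0.
- by move=> a x ->; rewrite scaler0.
- by move=> v h /ff' ->; rewrite subrr.
Qed.
End Differential.

(** The convolution product, dual to cutting a word in two; the final basis element [g] stays with
    the second half. *)
Definition conv m r p J (X : seq L -> 'M[Q]_(m, r)) (F : seq L -> 'I_J -> 'M[Q]_(r, p))
    (u : seq L) (g : 'I_J) : 'M[Q]_(m, p) :=
  \sum_(s <- splits u) X s.1 *m F s.2 g.

(* Functions on words in the letters alone are functions on words whose last
   entry ranges over ['I_1]. *)
Definition bd1 (rho : seq L -> 'M[Q]_N) (V : lmodType Q) (f : seq L -> V) (u : seq L) : V :=
  bd rho (0 : 'M_1) (fun _ _ => 0) (fun v _ => f v) u ord0.

Lemma bd1_nil rho (V : lmodType Q) (f : seq L -> V) : bd1 rho f [::] = 0.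
Proof. by rewrite /bd1 /= big1 ?oppr0 // => h _; rewrite mxE scale0r. Qed.

Lemma bd1_cons rho (V : lmodType Q) (f : seq L -> V) a u :
  bd1 rho f (a :: u) =
  - (\sum_(s <- splits u) \sum_i rho s.1 (val a) i *: consf f s.2 i
     + (-1) ^+ dg (val a) *: bd1 rho (fun w => f (a :: w)) u).
Proof.
by rewrite /bd1 /= [X in _ + X]big1 ?addr0 // => h _; rewrite mxE scale0r.
Qed.

Section Leibniz.
Variables (rho : seq L -> 'M[Q]_N) (J : nat) (dG : 'M[Q]_J).
Variable (lam : seq L -> 'I_J -> 'M[Q]_(N, J)).
Local Notation bdW := (bd rho dG lam).

Lemma conv_cons m r p (X : seq L -> 'M[Q]_(m, r)) (F : seq L -> 'I_J -> 'M[Q]_(r, p)) a u g :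
  conv X F (a :: u) g = X [::] *m F (a :: u) g + conv (fun v => X (a :: v)) F u g.
Proof. by rewrite /conv big_splits_cons. Qed.

Lemma conv_nil m r p (X : seq L -> 'M[Q]_(m, r)) (F : seq L -> 'I_J -> 'M[Q]_(r, p)) g :
  conv X F [::] g = X [::] *m F [::] g.
Proof. by rewrite /conv big_splits0. Qed.

Lemma consf_conv m r p (X : seq L -> 'M[Q]_(m, r)) (F : seq L -> 'I_J -> 'M[Q]_(r, p)) v g i :
  consf ((conv X F)^~ g) v i =
  X [::] *m consf (F^~ g) v i + conv (fun w => consf X w i) F v g.
Proof.
rewrite /consf; case: insub => [c|]; first by rewrite conv_cons.
by rewrite mulmx0 add0r /conv big1 // => s _; rewrite mul0mx.
Qed.

(** Leibniz rule: a cut never falls inside the letter that replaces a block, so the block lies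
    wholly on one side of the cut. The sign comes from passing the differential over the first
    half. *)
Lemma bd_conv m r p (X : seq L -> 'M[Q]_(m, r)) (F : seq L -> 'I_J -> 'M[Q]_(r, p)) u g :
  bdW (conv X F) u g =
  conv (bd1 rho X) F u g + conv (fun v => (-1) ^+ wt v *: X v) (bdW F) u g.
Proof.
elim: u X => [|a u IHu] X.
  rewrite !conv_nil bd1_nil mul0mx add0r wt_nil scale1r /= mulmxN mulmx_sumr.
  by congr (- _); apply: eq_bigr => h _; rewrite conv_nil scalemxAr.
rewrite !conv_cons bd1_nil mul0mx add0r wt_nil scale1r [bdW _ (_ :: _) _]/=.
have -> : bdW (fun w => conv X F (a :: w)) u g =
    X [::] *m bdW (fun w => F (a :: w)) u g +
    bdW (conv (fun v => X (a :: v)) F) u g.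
  have -> := @bd_linear rho J dG lam _ _ (mulmx (X [::])) (fun w => F (a :: w)) u g.
  by rewrite -bdD; apply: eq_bd => v h; rewrite conv_cons.
rewrite IHu.
under eq_bigr => s _.
  under eq_bigr => i _ do rewrite consf_conv scalerDr.
  rewrite big_split /=; over.
rewrite big_split /=.
have -> : \sum_(h < J) lam u g (val a) h *: conv X F [::] h =
   X [::] *m \sum_(h < J) lam u g (val a) h *: F [::] h.
  by rewrite mulmx_sumr; apply: eq_bigr => h _; rewrite conv_nil scalemxAr.
have -> : \sum_(s <- splits u) \sum_(i < N)
       rho s.1 (val a) i *: (X [::] *m consf (F^~ g) s.2 i) =
   X [::] *m \sum_(s <- splits u) \sum_(i < N) rho s.1 (val a) i *: consf (F^~ g) s.2 i.
  rewrite mulmx_sumr; apply: eq_bigr => s _; rewrite mulmx_sumr.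
  by apply: eq_bigr => i _; rewrite scalemxAr.
have -> : \sum_(s <- splits u) \sum_(i < N)
       rho s.1 (val a) i *: conv (fun w => consf X w i) F s.2 g =
   conv (fun v => \sum_(s <- splits v) \sum_(i < N) rho s.1 (val a) i *: consf X s.2 i) F u g.
  rewrite /conv.
  under [RHS]eq_bigr => s _ do rewrite mulmx_suml.
  rewrite (big_splitsA u (fun x y z => (\sum_(i < N) rho x (val a) i *: consf X y i) *m F z g)).
  apply: eq_bigr => s _; under eq_bigr => i _ do rewrite scaler_sumr.
  rewrite exchange_big; apply: eq_bigr => t _ /=.
  by rewrite mulmx_suml; apply: eq_bigr => i _; rewrite scalemxAl.
have -> : conv (fun v => bd1 rho X (a :: v)) F u g =
  - (conv (fun v => \sum_(s <- splits v) \sum_(i < N) rho s.1 (val a) i *: consf X s.2 i) F u g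
     + (-1) ^+ dg (val a) *: conv (fun v => bd1 rho (fun w => X (a :: w)) v) F u g).
  rewrite /conv scaler_sumr -big_split -sumrN; apply: eq_bigr => s _.
  by rewrite bd1_cons mulNmx mulmxDl scalemxAl.
have -> : conv (fun v => (-1) ^+ wt (a :: v) *: X (a :: v)) (bdW F) u g =
  - ((-1) ^+ dg (val a) *: conv (fun v => (-1) ^+ wt v *: X (a :: v)) (bdW F) u g).
  rewrite /conv scaler_sumr -sumrN; apply: eq_bigr => s _.
  by rewrite wt_cons addSn exprS exprD mulN1r scaleNr mulNmx -scalerA scalemxAl.
rewrite mulmxN !mulmxDr !scalerDr scalemxAr.
set A1 := _ *m _; set A2 := conv _ _ _ _; set A3 := _ *m _; set A4 := _ *: _; set A5 := _ *: _.
set A6 := _ *m _.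
rewrite -[RHS]opprK; congr (- _); rewrite !opprD !opprK.
rewrite -!addrA [A4 + (A1 + _)]addrCA [A2 + (A1 + _)]addrCA [A4 + (A3 + _)]addrCA.
by rewrite [A6 + A5]addrC.
Qed.
End Leibniz.
End Bar.

(** * Curvature and the square of the differential *)

Section Curvature.
Variables (Q : comNzRingType) (N : nat) (i0 : 'I_N) (dg : 'I_N -> nat).
Local Notation L := (letter i0).
Local Notation wt := (@word_wt N i0 dg).
Local Notation eps := (grade_sign Q dg).

Lemma epsK : eps *m eps = 1%:M.
Proof.
rewrite mul_diag_mx; apply/matrixP => i j; rewrite !mxE.
by rewrite mulrnAr -expr2 sqrr_sign.
Qed.

(** The Koszul sign for moving the grading past an operator of parity [t]. *)
Lemma eps_homog m (X : 'M[Q]_(N, m)) (be : 'I_m -> nat) t :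
  (forall i j, X i j != 0 -> odd (dg i + t) = odd (be j)) ->
  eps *m X = (-1) ^+ t *: (X *m grade_sign Q be).
Proof.
move=> hX; apply/matrixP => i j; rewrite mul_diag_mx mul_mx_diag !mxE.
have [->|/hX/esym E] := eqVneq (X i j) 0; first by rewrite mul0r !mulr0.
rewrite -[in RHS]signr_odd -[(-1) ^+ be j]signr_odd -[LHS]mulr1 E oddD.
rewrite -[(-1) ^+ dg i]signr_odd.
by case: (odd (dg i)); case: (odd t); rewrite ?expr0 ?expr1 ?mul1r ?mulr1 ?mulN1r ?mulrN1 ?opprK.
Qed.

Lemma row_eps m (X : 'M[Q]_(N, m)) i : row i (eps *m X) = (-1) ^+ dg i *: row i X.
Proof. by apply/rowP => j; rewrite mul_diag_mx !mxE. Qed.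

Section Delta.
Variables (rho : seq L -> 'M[Q]_N) (J : nat) (dG : 'M[Q]_J).
Variable (lam : seq L -> 'I_J -> 'M[Q]_(N, J)).
Local Notation bdW := (bd dg rho dG lam).

(* The dual of the differential of the twisted tensor product of [A] with the words. *)
Definition Delta m (F : seq L -> 'I_J -> 'M[Q]_(N, m)) u g : 'M[Q]_(N, m) :=
  conv rho F u g + eps *m bdW F u g.

(* Stasheff's identities say that this is the curvature [curv] below, which comes
   from the component [A_1 -> Q] of the differential of [A]. *)
Definition mc u : 'M[Q]_N :=
  conv rho (fun v (_ : 'I_1) => rho v) u ord0 + eps *m bd1 dg rho rho u.

Lemma eq_Delta m (F F' : seq L -> 'I_J -> 'M[Q]_(N, m)) u g :
  (forall v h, F v h = F' v h) -> Delta F u g = Delta F' u g.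
Proof. by move=> FF'; congr Delta; apply/funext => v; apply/funext => h. Qed.

Lemma convDr m r p (X : seq L -> 'M[Q]_(m, r)) (F F' : seq L -> 'I_J -> 'M[Q]_(r, p)) u g :
  conv X (fun v h => F v h + F' v h) u g = conv X F u g + conv X F' u g.
Proof. by rewrite /conv -big_split; apply: eq_bigr => s _; rewrite mulmxDr. Qed.

Lemma DeltaD m (F F' : seq L -> 'I_J -> 'M[Q]_(N, m)) u g :
  Delta (fun v h => F v h + F' v h) u g = Delta F u g + Delta F' u g.
Proof. by rewrite /Delta convDr bdD mulmxDr addrACA. Qed.

Lemma bd_mulmxr m p r (Y : 'M[Q]_(p, r)) (F : seq L -> 'I_J -> 'M[Q]_(m, p)) u g :
  bdW (fun v h => F v h *m Y) u g = bdW F u g *m Y.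
Proof. by have /= -> := bd_linear dg rho dG lam (mulmxr Y) F u g. Qed.

Lemma bd_mulmx m p r (Y : 'M[Q]_(p, r)) (F : seq L -> 'I_J -> 'M[Q]_(r, m)) u g :
  bdW (fun v h => Y *m F v h) u g = Y *m bdW F u g.
Proof. by have /= -> := bd_linear dg rho dG lam (mulmx Y) F u g. Qed.

Lemma Delta_mulmxr m p (Y : 'M[Q]_(p, m)) (F : seq L -> 'I_J -> 'M[Q]_(N, p)) u g :
  Delta (fun v h => F v h *m Y) u g = Delta F u g *m Y.
Proof.
rewrite /Delta bd_mulmxr mulmxDl mulmxA; congr (_ + _).
by rewrite /conv mulmx_suml; apply: eq_bigr => s _; rewrite mulmxA.
Qed.

Lemma DeltaN m (F : seq L -> 'I_J -> 'M[Q]_(N, m)) u g :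
  Delta (fun v h => - F v h) u g = - Delta F u g.
Proof.
rewrite -[RHS]mulmx1 mulNmx -mulmxN -Delta_mulmxr.
by apply: eq_Delta => v h; rewrite mulmxN mulmx1.
Qed.

Lemma convA m r p q (X : seq L -> 'M[Q]_(m, r)) (Y : seq L -> 'M[Q]_(r, p))
    (F : seq L -> 'I_J -> 'M[Q]_(p, q)) u g :
  conv X (conv Y F) u g = conv (fun v => conv X (fun w (_ : 'I_1) => Y w) v ord0) F u g.
Proof.
rewrite /conv; under eq_bigr => s _ do rewrite mulmx_sumr.
under [RHS]eq_bigr => s _ do rewrite mulmx_suml.
rewrite (big_splitsA u (fun x y z => X x *m Y y *m F z g)).
by apply: eq_bigr => s _; apply: eq_bigr => t _; rewrite mulmxA.
Qed.

Hypothesis hrho : homog_bar dg rho.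

(** The mixed terms of the Leibniz rule cancel: [rho v] has parity [wt v + 1], so moving [eps] past
    it gives the sign opposite to [(-1) ^+ wt v]. *)
Lemma Delta2 m (F : seq L -> 'I_J -> 'M[Q]_(N, m)) u g :
  Delta (Delta F) u g = conv mc F u g + bdW (bdW F) u g.
Proof.
rewrite DeltaD {1 2}/Delta bd_conv bd_mulmx mulmxA epsK mul1mx convA mulmxDr.
have -> : eps *m conv (fun v => (-1) ^+ wt v *: rho v) (bdW F) u g =
    - conv rho (fun v h => eps *m bdW F v h) u g.
  rewrite /conv mulmx_sumr -sumrN; apply: eq_bigr => s _.
  rewrite -scalemxAl -scalemxAr mulmxA.
  rewrite (@eps_homog _ _ dg (wt s.1).+1) => [|i j /hrho E]; last first.
    by rewrite addnS -E /= negbK.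
  by rewrite -scalemxAl scalerA -exprD -signr_odd oddD /= addbN addbb /= expr1 scaleN1r mulmxA.
rewrite addrA -[X in X + _]addrA subrK; congr (_ + _).
rewrite /conv mulmx_sumr -big_split; apply: eq_bigr => s _.
by rewrite /mc mulmxDl mulmxA.
Qed.

End Delta.
End Curvature.

Section Square.
Variables (Q : comNzRingType) (N : nat) (i0 : 'I_N) (dg : 'I_N -> nat).
Local Notation L := (letter i0).
Local Notation wt := (@word_wt N i0 dg).

Variable rho : seq L -> 'M[Q]_N.

(** The projection of [A] onto its unit that kills the letters is not a chain map; this measures its
    failure. *)
Definition curv (u : seq L) : 'M[Q]_N :=
  if u is [:: a] then (rho [::] (val a) i0)%:M else 0.

(** The recursion only serves to reach the last letter: its curvature multiplies [f] at the word
    deprived of it. *)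
Fixpoint last_curv (V : lmodType Q) (f : seq L -> V) (u : seq L) : V :=
  if u is a :: v then
    (if v is [::] then rho [::] (val a) i0 *: f [::] else 0)
    + last_curv (fun w => f (a :: w)) v
  else 0.

Lemma conv_curvr m (X : seq L -> 'M[Q]_(m, N)) u :
  conv X (fun v (_ : 'I_1) => curv v) u ord0 = last_curv X u.
Proof.
elim: u X => [|a u IHu] X; first by rewrite conv_nil /= mulmx0.
rewrite conv_cons IHu /=; congr (_ + _).
by case: u {IHu} => [|b u]; rewrite ?mulmx0 // mul_mx_scalar.
Qed.

Lemma conv_curvl J m (F : seq L -> 'I_J -> 'M[Q]_(N, m)) u g :
  conv curv F u g = if u is a :: v then rho [::] (val a) i0 *: F v g else 0.
Proof.
case: u => [|a u]; first by rewrite conv_nil mul0mx.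
rewrite conv_cons mul0mx add0r /conv big_splits_bot ?mul_scalar_mx // => -[[|b v] w] //= _ _.
by rewrite mul0mx.
Qed.

Lemma last_curv_linear (V W : lmodType Q) (phi : {linear V -> W}) (f : seq L -> V) u :
  phi (last_curv f u) = last_curv (fun v => phi (f v)) u.
Proof.
elim: u f => [|a u IHu] f /=; first by rewrite linear0.
by rewrite (linearD phi) IHu; case: u {IHu} => [|b u]; rewrite ?(linearZZ phi) ?linear0.
Qed.

Hypothesis dg0 : forall i, (dg i == 0%N) = (i == i0).
Hypothesis hrho : homog_bar dg rho.
Hypothesis rho_unit : forall u,
  row i0 (rho u) = if u is [:: a] then delta_mx 0 (val a) else 0.

Lemma letter_dg (a : L) : (0 < dg (val a))%N.
Proof. by rewrite lt0n dg0; apply: (valP a). Qed.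

Lemma wt_eq0 u : (wt u == 0%N) = (u == [::]).
Proof. by case: u => [|a u]; rewrite ?wt_nil // wt_cons. Qed.

Section Tail.
Variables (J : nat) (dgG : 'I_J -> nat) (dG : 'M[Q]_J).
Variable (lam : seq L -> 'I_J -> 'M[Q]_(N, J)).
(* [kap] is 1 for a unital action, and 0 for the zero action on which [bd1] rests. *)
Variable kap : Q.
Local Notation bdW := (bd dg rho dG lam).
Local Notation DeltaW := (Delta dg rho dG lam).

Hypothesis lam_unit : forall u g,
  row i0 (lam u g) = if u is [::] then kap *: delta_mx 0 g else 0.
Hypothesis dGdG : dG *m dG = 0.

(** Reads the first letter of a word as an element of [A], so that a function on words becomes one
    to which [Delta] applies. *)
Definition pack m (f : seq L -> 'I_J -> 'rV[Q]_m) u g : 'M[Q]_(N, m) :=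
  \matrix_i consf (f^~ g) u i.
Definition ends m (f : seq L -> 'I_J -> 'rV[Q]_m) : 'M[Q]_(J, m) :=
  \matrix_h f [::] h.
Definition packD m (f : seq L -> 'I_J -> 'rV[Q]_m) u g : 'M[Q]_(N, m) :=
  DeltaW (pack f) u g + lam u g *m ends f.

Lemma row_pack m (f : seq L -> 'I_J -> 'rV[Q]_m) u g a :
  row (val a) (pack f u g) = f (a :: u) g.
Proof. by rewrite rowK /consf valK. Qed.

Lemma row_pack_unit m (f : seq L -> 'I_J -> 'rV[Q]_m) u g : row i0 (pack f u g) = 0.
Proof. by rewrite rowK /consf insubF ?eqxx. Qed.

Lemma bd_row m n (F : seq L -> 'I_J -> 'M[Q]_(m, n)) i u g :
  row i (bdW F u g) = bdW (fun v h => row i (F v h)) u g.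
Proof. by have /= -> := bd_linear dg rho dG lam (@row _ _ _ i) F u g. Qed.

Lemma bd_pack m (f : seq L -> 'I_J -> 'rV[Q]_m) a u g :
  bdW f (a :: u) g = - row (val a) (packD f u g).
Proof.
rewrite /= /packD /Delta; congr (- _); rewrite !linearD /= row_eps bd_row.
congr (_ + _ + _).
- rewrite /conv linear_sum; apply: eq_bigr => s _ /=; rewrite row_mul mulmx_sum_row.
  by apply: eq_bigr => i _; rewrite rowK mxE.
- by congr (_ *: _); apply: eq_bd => v h; rewrite row_pack.
- by rewrite row_mul mulmx_sum_row; apply: eq_bigr => h _; rewrite rowK mxE.
Qed.

(** The unit multiplies the first letter of [u], or acts on [g] when there is none, and so gives
    back [f]. Both the formula for the curvature and the exactness of the bar construction rest on
    this. *)
Lemma packD_unit m (f : seq L -> 'I_J -> 'rV[Q]_m) u g :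
  row i0 (packD f u g) = if u is [::] then kap *: f [::] g else f u g.
Proof.
rewrite /packD /Delta !linearD /= row_eps bd_row (@eq_bd _ _ _ _ _ _ _ _ _ _ (fun _ _ => 0));
  last first.
  by move=> v h; rewrite row_pack_unit.
rewrite bd0 scaler0 addr0 row_mul lam_unit; case: u => [|a u].
  rewrite conv_nil row_mul rho_unit mul0mx add0r -scalemxAl -rowE.
  by rewrite rowK.
rewrite mul0mx addr0 conv_cons linearD /= row_mul rho_unit mul0mx add0r.
rewrite /conv linear_sum big_splits_bot => [|[[|b v] w] /= ? ?] //=.
  by rewrite row_mul rho_unit -rowE row_pack.
by rewrite row_mul rho_unit mul0mx.
Qed.

Lemma row_delta_mul m n (j i : 'I_m) (x : 'rV[Q]_n) :
  row i (delta_mx j 0 *m x) = if i == j then x else 0.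
Proof.
apply/rowP => k; rewrite !mxE big_ord1 mxE eqxx andbT.
by case: eqP => _; rewrite ?mul1r ?mul0r ?mxE.
Qed.

Lemma consf_bd m (f : seq L -> 'I_J -> 'rV[Q]_m) u g i :
  consf ((bdW f)^~ g) u i = if i == i0 then 0 else - row i (packD f u g).
Proof.
rewrite /consf; case: insubP => [c ci <-|]; first by rewrite -bd_pack (negbTE (valP c)).
by rewrite negbK => ->.
Qed.

(* Removing the first letter turns [bd] into [- Delta] by [bd_pack], so that the
   square of [bd] is computed on [a :: u] from that of [Delta] and from the square
   of [bd] on the shorter word [u]. *)
Lemma bd2_step m (f : seq L -> 'I_J -> 'rV[Q]_m) a u g :
  bdW (bdW f) (a :: u) g =
  row (val a) (conv (mc dg rho) (pack f) u g) + bdW (bdW (fun v => f (a :: v))) u g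
  + row (val a) (DeltaW lam u g + lam u g *m dG) *m ends f
  - rho [::] (val a) i0 *: row i0 (packD f u g).
Proof.
pose r v h := row i0 (packD f v h).
(* [consf] discards the unit, so [pack (bdW f)] is [- packD f] with its unit row erased; the term in
   [r] does the erasing. *)
have Epack v h : pack (bdW f) v h = - packD f v h + delta_mx i0 0 *m r v h.
  apply/row_matrixP => i; rewrite rowK consf_bd /r; move: (packD f v h) => X.
  rewrite linearD linearN /= row_delta_mul.
  by case: eqP => [->|_]; rewrite ?addNr ?addr0.
have Eends : ends (bdW f) = - (dG *m ends f).
  apply/row_matrixP => h; rewrite rowK linearN /= row_mul mulmx_sum_row.
  by congr (- _); apply: eq_bigr => l _; rewrite rowK mxE.
have Er : row (val a) (DeltaW (fun v h => delta_mx i0 0 *m r v h) u g) =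
    rho [::] (val a) i0 *: r u g.
  rewrite /Delta linearD /= row_eps bd_row (@eq_bd _ _ _ _ _ _ _ _ _ _ (fun _ _ => 0)).
    rewrite bd0 scaler0 addr0 /conv linear_sum big_splits_bot /=.
      by rewrite row_mul mulmxA -colE [col _ _]mx11_scalar mul_scalar_mx !mxE.
    (* A product of [a] and [v] with a component on the unit needs [dg a + wt v = 1], impossible for
       nonempty [v]. *)
    move=> [v w] /= v0 _; rewrite row_mul mulmxA -colE.
    have -> : col i0 (row (val a) (rho v)) = 0; last by rewrite mul0mx.
    apply/matrixP => x y; rewrite !mxE; apply/eqP; apply: contraT => /hrho.
    have /eqP -> : dg i0 == 0%N by rewrite dg0.
    have := letter_dg a; have : (0 < wt v)%N by rewrite lt0n wt_eq0; case: (v) v0.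
    by move: (dg _) (wt v) => [|k] [|l]; rewrite ?addnS ?addSn.
  by move=> v h; rewrite row_delta_mul (negbTE (valP a)).
have -> : bdW (bdW (fun v => f (a :: v))) u g = row (val a) (bdW (bdW (pack f)) u g).
  rewrite bd_row; apply: eq_bd => v h; rewrite bd_row; apply: eq_bd => w l.
  by rewrite row_pack.
rewrite -[row i0 _]/(r u g) -Er bd_pack /packD Eends (eq_Delta _ _ _ _ _ _ Epack).
rewrite DeltaD DeltaN DeltaD Delta2 // Delta_mulmxr mulmxN mulmxA -row_mul [in RHS]mulmxDl.
set D := DeltaW lam u g *m _; set d := DeltaW (fun _ _ => _) _ _.
set l := _ *m _ *m _; move: (conv _ _ _ _) (bdW _ u g) @D @d @l => C B D d l.
by apply/rowP => j; rewrite !mxE; ring.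
Qed.

Lemma bd2_nil (V : lmodType Q) (f : seq L -> 'I_J -> V) g : bdW (bdW f) [::] g = 0.
Proof.
rewrite /=; under eq_bigr => h _ do rewrite scalerN scaler_sumr.
rewrite sumrN opprK exchange_big big1 // => l _ /=.
under eq_bigr => h _ do rewrite scalerA.
have := congr1 (fun X : 'M_J => X g l) dGdG; rewrite !mxE => E.
by rewrite -scaler_suml E scale0r.
Qed.

(** Discarding units loses the terms where a letter of degree one becomes a multiple of the unit,
    which a neighbour then absorbs. Left and right absorption cancel, except at the first letter,
    which has no left neighbour, and at the last one, whose right neighbour is [g], where the unit
    acts by [kap]. The bounds [n] and [p] permit the use of this inside the inductive constructions
    of [rho] and [lam]. *)
Lemma bd2_rV m (f : seq L -> 'I_J -> 'rV[Q]_m) n p a u g :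
  (forall v, (wt v < n)%N -> mc dg rho v = curv v) ->
  (forall v h, (wt v + dgG h < p)%N -> DeltaW lam v h + lam v h *m dG = 0) ->
  (wt u < n)%N -> (wt u + dgG g < p)%N ->
  bdW (bdW f) (a :: u) g =
  - (rho [::] (val a) i0 *: f u g) + (1 - kap) *: last_curv (f^~ g) (a :: u).
Proof.
move=> hmc hlam; elim: u a f => [|b u IHu] a f ltn ltp.
all: rewrite bd2_step packD_unit hlam // linear0 mul0mx addr0.
  rewrite conv_nil hmc // mul0mx linear0 add0r bd2_nil add0r /= addr0.
  by rewrite scalerA mulrC scalerBl scale1r scalerA addKr.
have lt_tail v : (wt v <= wt (b :: u))%N -> (wt v < n)%N by move=> /leq_ltn_trans; apply.
rewrite (_ : conv _ _ _ _ = conv curv (pack f) (b :: u) g); last first.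
  apply: eq_big_splits => s Es; rewrite hmc // lt_tail // -Es wt_cat; exact: leq_addr.
have le_tail : (wt u <= wt (b :: u))%N by rewrite wt_cons leq_addl.
rewrite conv_curvl IHu ?lt_tail //; last first.
  by apply: leq_ltn_trans ltp; rewrite leq_add2r.
rewrite (linearZZ (@row _ _ _ (val a))). rewrite /= row_pack.
rewrite add0r; set x := _ *: f (a :: u) g.
(* The induction hypothesis treats [b] as a first letter; its curvature cancels the one from
   [conv curv], and that of [a] remains. *)
by rewrite addrA subrr add0r addrC.
Qed.

Lemma bd2 r m (f : seq L -> 'I_J -> 'M[Q]_(r, m)) n p a u g :
  (forall v, (wt v < n)%N -> mc dg rho v = curv v) ->
  (forall v h, (wt v + dgG h < p)%N -> DeltaW lam v h + lam v h *m dG = 0) ->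
  (wt u < n)%N -> (wt u + dgG g < p)%N ->
  bdW (bdW f) (a :: u) g =
  - (rho [::] (val a) i0 *: f u g) + (1 - kap) *: last_curv (f^~ g) (a :: u).
Proof.
move=> hmc hlam ltn ltp; apply/row_matrixP => i.
rewrite bd_row (@eq_bd _ _ _ _ _ _ _ _ _ _ _ _ _ (fun v h => bd_row _ _ _ _)).
rewrite (bd2_rV _ _ hmc hlam) //.
rewrite -(last_curv_linear (@row _ _ _ i) (f^~ g)).
by move: (last_curv _ _) => X; rewrite linearD linearN !linearZ.
Qed.
End Tail.
End Square.

(** * Strictly unital A-infinity structures on acyclic complexes *)

Lemma mulmx_neq0 (Q : pzRingType) m n p (A : 'M[Q]_(m, n)) (B : 'M[Q]_(n, p)) i j :
  (A *m B) i j != 0 -> exists l, A i l != 0 /\ B l j != 0.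
Proof.
move=> AB; apply: contrapT => nAB; case/eqP: AB; rewrite mxE big1 // => l _.
have [->|Al] := eqVneq (A i l) 0; first by rewrite mul0r.
have [->|Bl] := eqVneq (B l j) 0; first by rewrite mulr0.
by case: nAB; exists l.
Qed.

Lemma sum_neq0 (V : nmodType) (I : eqType) (r : seq I) (F : I -> V) :
  \sum_(i <- r) F i != 0 -> exists2 i, i \in r & F i != 0.
Proof.
move=> S; apply: contrapT => nF; case/eqP: S; apply: big1_seq => i /andP[_ ir].
by apply: contrapT => /eqP Fi; case: nF; exists i.
Qed.

Definition homog_rV (Q : pzRingType) J (dgG : 'I_J -> nat) n (v : 'rV[Q]_J) :=
  forall j, v 0 j != 0 -> dgG j = n.

Definition acyclic (Q : pzRingType) J (dgG : 'I_J -> nat) (dG : 'M[Q]_J) :=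
  forall n v, (0 < n)%N -> homog_rV dgG n v -> v *m dG = 0 ->
  exists2 w, homog_rV dgG n.+1 w & w *m dG = v.

Lemma homog_rVD (Q : pzRingType) J (dgG : 'I_J -> nat) n (v w : 'rV[Q]_J) :
  homog_rV dgG n v -> homog_rV dgG n w -> homog_rV dgG n (v + w).
Proof.
move=> hv hw j; rewrite mxE; have [->|/hv //] := eqVneq (v 0 j) 0.
by rewrite add0r => /hw.
Qed.

Lemma homog_rVN (Q : pzRingType) J (dgG : 'I_J -> nat) n (v : 'rV[Q]_J) :
  homog_rV dgG n v -> homog_rV dgG n (- v).
Proof. by move=> hv j; rewrite mxE oppr_eq0 => /hv. Qed.

Section Solve.
Variables (Q : comNzRingType) (N : nat) (i0 : 'I_N) (dg : 'I_N -> nat) (dA : 'M[Q]_N).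
Hypothesis dg0 : forall i, (dg i == 0%N) = (i == i0).
Hypothesis hdA : forall i j, dA i j != 0 -> dg i = (dg j).+1.
Hypothesis dAdA : dA *m dA = 0.
Variables (J : nat) (dgG : 'I_J -> nat) (dG : 'M[Q]_J).
Hypothesis exG : acyclic dgG dG.

(* [s] is the degree by which [Y] raises; [H_0] intervenes only for [s = 0]. *)
Lemma solve_homotopy s (Z : 'M[Q]_(N, J)) :
  (forall i j, Z i j != 0 -> (dgG j).+1 = (dg i + s)%N) ->
  row i0 Z = 0 -> dA *m Z = Z *m dG ->
  (s = 0%N -> forall i, dg i = 1%N -> exists2 w, homog_rV dgG 1 w & w *m dG = row i Z) ->
  exists Y : 'M[Q]_(N, J),
    [/\ forall i j, Y i j != 0 -> dgG j = (dg i + s)%N, row i0 Y = 0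
      & dA *m Y + Y *m dG = Z].
Proof.
move=> hZ Z0 dZ H1.
have dgi0 : dg i0 = 0%N by apply/eqP; rewrite dg0.
(* The rows are found degree by degree; degree 0 contains only the unit, where [Z] vanishes. *)
suff [Y [hY Y0 EY]] : exists Y : 'M[Q]_(N, J),
    [/\ forall i j, Y i j != 0 -> dgG j = (dg i + s)%N, row i0 Y = 0
      & forall i, (dg i <= \max_j dg j)%N -> row i (dA *m Y + Y *m dG) = row i Z].
  exists Y; split => //; apply/row_matrixP => i; apply: EY.
  exact: (@leq_bigmax _ (fun j => dg j)).
elim: (\max_j dg j)%N => [|k [Y [hY Y0 EY]]].
  exists 0; split; [by move=> i j; rewrite mxE eqxx | exact: linear0 |] => i.
  by rewrite leqn0 dg0 => /eqP->; rewrite Z0 mulmx0 mul0mx addr0 linear0.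
(* A row of [dA] involves rows of one degree less only, so changing [Y] in degree [k.+1] does not
   disturb the equations already solved. *)
have dAY i (Y1 Y2 : 'M[Q]_(N, J)) : (forall l, (dg l).+1 = dg i -> row l Y1 = row l Y2) ->
    row i dA *m Y1 = row i dA *m Y2.
  move=> EY12; rewrite !mulmx_sum_row; apply: eq_bigr => l _; rewrite mxE.
  by have [->|/hdA/esym/EY12 ->] := eqVneq (dA i l) 0; rewrite ?scale0r.
have /choice[y Hy] : forall i, exists y : 'rV[Q]_J, dg i = k.+1 ->
    homog_rV dgG (dg i + s) y /\ y *m dG = row i Z - row i dA *m Y.
  move=> i; have [Ei|] := pselect (dg i = k.+1); last by exists 0.
  have hv : homog_rV dgG (k + s) (row i Z - row i dA *m Y).
    apply: homog_rVD; [|apply: homog_rVN] => j.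
      by rewrite mxE => /hZ; rewrite Ei addSn => -[].
    rewrite -row_mul mxE => /mulmx_neq0[l [/hdA El /hY ->]].
    by move: El; rewrite Ei => -[->].
  have [ks|] := posnP (k + s); last first.
    move=> ks; have [|w hw Ew] := exG ks hv.
      rewrite mulmxBl -[row i Z *m dG]row_mul -dZ row_mul -mulmxA -mulmxBr.
      rewrite (@dAY i _ (dA *m Y)) => [|l El].
        by rewrite mulmxA -row_mul dAdA linear0 mul0mx.
      rewrite -[in LHS]/(row l (Z - Y *m dG)) linearB /= -EY; first by rewrite linearD /= addrK.
      by move: El; rewrite Ei => -[->].
    by exists w => _; split; rewrite // Ei addSn.
  (* The row to be written as a boundary lies in degree 0, out of reach of [exG]; [H1] replaces
     it. *)
  have [/eqP k0 /eqP s0] : k == 0%N /\ s == 0%N by apply/andP; rewrite -addn_eq0 ks.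
  have [||w hw Ew] := H1 _ i; rewrite // ?Ei ?k0 //.
  exists w => _; split; first by rewrite s0.
  rewrite Ew (@dAY i _ 0) ?mulmx0 ?subr0 // => l.
  rewrite Ei k0 => -[/eqP]; rewrite dg0 => /eqP ->.
  by rewrite Y0 linear0.
exists (\matrix_i if dg i == k.+1 then y i else row i Y); split.
- move=> i j; rewrite mxE; case: (dg _ =P k.+1) => [Ei|_]; last by rewrite mxE => /hY.
  by have [hy _] := Hy i Ei; apply: hy.
- by rewrite rowK dgi0.
- move=> i le_ik; rewrite linearD /= !row_mul rowK (@dAY i _ Y) => [|l El]; last first.
    by rewrite rowK; case: (dg _ =P k.+1) => // El'; move: le_ik; rewrite -El El' ltnn.
  case: (dg _ =P k.+1) => [Ei|Ei]; first by have [_ ->] := Hy i Ei; rewrite addrC subrK.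
  have := EY i; rewrite linearD /= !row_mul => -> //.
  by move: le_ik; rewrite leq_eqVlt ltnS => /orP[/eqP|].
Qed.
End Solve.

Section Ext.
Variables (Q : comNzRingType) (N : nat) (i0 : 'I_N) (dg : 'I_N -> nat).
Local Notation L := (letter i0).
Local Notation wt := (@word_wt N i0 dg).

(** The first argument of an operation is a letter of [u] outside the word it is indexed by, so that
    word weighs less than [u]. Hence the values of highest weight enter Stasheff's identities only
    against [dA]. *)
Lemma bd_ext (V : lmodType Q) J (rho rho' : seq L -> 'M[Q]_N) (dG : 'M[Q]_J) lam lam'
    (f : seq L -> 'I_J -> V) u g :
  (forall v, (wt v < wt u)%N -> rho v = rho' v) ->
  (forall v, (wt v < wt u)%N -> lam v g = lam' v g) ->
  bd dg rho dG lam f u g = bd dg rho' dG lam' f u g.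
Proof.
elim: u f => [|a u IHu] f Hr Hl //=.
have lt_au v : (wt v <= wt u)%N -> (wt v < wt (a :: u))%N.
  by rewrite wt_cons addSn ltnS => /leq_trans; apply; rewrite leq_addl.
congr (- (_ + _ *: _ + _)).
- apply: eq_big_splits => s Es; apply: eq_bigr => i _; rewrite Hr //.
  by apply: lt_au; rewrite -Es wt_cat leq_addr.
- by apply: IHu => v /ltnW/lt_au; [apply: Hr | apply: Hl].
- by apply: eq_bigr => h _; rewrite Hl // lt_au.
Qed.

Lemma bd1_delta rho (V : lmodType Q) (x : V) u :
  bd1 dg rho (fun v : seq L => if v is [::] then x else 0) u = 0.
Proof.
case: u => [|a u]; first by rewrite bd1_nil.
rewrite bd1_cons big1 => [|s _].
  by rewrite add0r /bd1 bd0 scaler0 oppr0.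
by rewrite big1 // => i _; rewrite /consf; case: insub => [c|]; rewrite scaler0.
Qed.
End Ext.

Section Algebra.
Variables (Q : comNzRingType) (N : nat) (i0 : 'I_N) (dg : 'I_N -> nat) (dA : 'M[Q]_N).
Local Notation L := (letter i0).
Local Notation wt := (@word_wt N i0 dg).
Local Notation eps := (grade_sign Q dg).
Hypothesis dg0 : forall i, (dg i == 0%N) = (i == i0).
Hypothesis hdA : forall i j, dA i j != 0 -> dg i = (dg j).+1.
Hypothesis dAdA : dA *m dA = 0.

(** Strict unitality. As letters exclude the unit, it can only occur as first argument. *)
Definition bar_unit (rho : seq L -> 'M[Q]_N) := forall u,
  row i0 (rho u) = if u is [:: a] then delta_mx 0 (val a) else 0.

Let dgi0 : dg i0 = 0%N. Proof. by apply/eqP; rewrite dg0. Qed.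

Let lt_wt (v u : seq L) : (size v < size u)%N -> forall w, v ++ w = u -> (wt v < wt u)%N.
Proof.
move=> lt_vu w Ew; rewrite -Ew wt_cat -{1}[wt v]addn0 ltn_add2l lt0n wt_eq0.
by apply: contraTneq lt_vu => w0; rewrite -Ew w0 cats0 ltnn.
Qed.

Section Given.
Variable rho : seq L -> 'M[Q]_N.
Hypothesis hrho : homog_bar dg rho.
Hypothesis rho_unit : bar_unit rho.
Hypothesis rho0 : rho [::] = dA.

Lemma curv_homog u i j : curv rho u i j != 0 -> ((dg j).+2 = dg i + wt u)%N.
Proof.
case: u => [|a [|b u]]; rewrite /= ?mxE ?eqxx //.
have [<-|] := eqVneq i j; last by rewrite eqxx.
rewrite mulr1n rho0 => /hdA; rewrite dgi0 => E.
by rewrite wt_cons wt_nil E addn0 addnC.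
Qed.

Lemma mc_homog u i j : mc dg rho u i j != 0 -> ((dg j).+2 = dg i + wt u)%N.
Proof.
rewrite mxE; have [->|] := eqVneq (conv rho (fun v _ => rho v) u (@ord0 0) i j) 0.
  rewrite add0r mul_diag_mx mxE; have [->|] := eqVneq (bd1 dg rho rho u i j) 0.
    by rewrite mulr0 eqxx.
  move=> H _; move: H.
  pose P (X : 'M[Q]_N) := forall i j, X i j != 0 -> ((dg j).+2 = dg i + wt u)%N.
  suff: P (bd1 dg rho rho u) by apply.
  apply: (@bd_closed _ _ _ dg rho 1 (fun=> 0%N) 0 (fun _ _ => 0)) => //.
  - by move=> ? ?; rewrite mxE eqxx.
  - by move=> ? ? ? ?; rewrite mxE eqxx.
  - by move=> ? ?; rewrite mxE eqxx.
  - move=> X Y PX PY k l; rewrite mxE; have [->|/PX //] := eqVneq (X k l) 0.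
    by rewrite add0r => /PY.
  - move=> a X PX k l; rewrite mxE; have [->|/PX //] := eqVneq (X k l) 0.
    by rewrite mulr0 eqxx.
  - by move=> v _; rewrite !addn0 => Ew k l /hrho ->; rewrite -Ew addnS.
move=> H _; move: H; rewrite /conv (@eq_big_splits _ _ u _ (fun s =>
  if `[< s.1 ++ s.2 = u >] then rho s.1 *m rho s.2 else 0)); last first.
  by move=> s Es; rewrite asboolT.
rewrite summxE => /sum_neq0[s _]; case: asboolP => [Es|]; last by rewrite mxE eqxx.
move=> /mulmx_neq0[l [/hrho E1 /hrho ->]].
by rewrite -addSn E1 -addnA -wt_cat Es.
Qed.

(** Strict unitality implies Stasheff's identities with the unit as first argument, so the
    homotopies that correct [rho] can be chosen to vanish on the unit. *)
Lemma row_mc u : row i0 (mc dg rho u) = row i0 (curv rho u).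
Proof.
pose f v := row i0 (rho v).
have Ebd : row i0 (eps *m bd1 dg rho rho u) = bd1 dg rho f u.
  by rewrite row_eps dgi0 scale1r [LHS]bd_row.
rewrite linearD /= Ebd; case: u {Ebd} => [|a u].
  by rewrite conv_nil row_mul rho_unit mul0mx bd1_nil addr0 linear0.
rewrite conv_cons linearD /= row_mul rho_unit mul0mx add0r.
have -> : row i0 (conv (fun v => rho (a :: v)) (fun v _ => rho v) u (@ord0 0)) =
    row (val a) (rho u).
  rewrite /conv linear_sum big_splits_bot => [|[[|b v] w] /= ? ?] //=.
    by rewrite row_mul rho_unit -rowE.
  by rewrite row_mul rho_unit mul0mx.
rewrite bd1_cons big_splits_top; last first.
  move=> [v [|b w]] /=; first by move=> lt_vu Ev; rewrite -Ev cats0 ltnn in lt_vu.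
  move=> _ _; apply: big1 => i _; rewrite /consf; case: insub => [c|]; last by rewrite scaler0.
  by rewrite /f rho_unit scaler0.
rewrite (_ : bd1 dg rho (fun w => f (a :: w)) u =
   bd1 dg rho (fun v => if v is [::] then delta_mx 0 (val a) else 0) u); last first.
  by congr bd1; apply/funext => -[|b v]; rewrite /f rho_unit.
rewrite bd1_delta scaler0 addr0 /=.
have -> : \sum_(i < N) rho u (val a) i *: consf f [::] i =
   row (val a) (rho u) - rho u (val a) i0 *: delta_mx 0 i0.
  rewrite [row _ (rho u)]row_sum_delta (bigD1 i0) //= [in RHS](bigD1 i0) //= {1}/consf insubF
    ?eqxx //.
  rewrite scaler0 add0r mxE addrAC subrr add0r; apply: eq_bigr => i i_neq; rewrite mxE /consf.
  by rewrite insubT /f rho_unit.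
rewrite opprB addrC subrK; case: u => [|b u].
  by apply/rowP => j; rewrite !mxE eqxx /=; case: eqP => [->|];
    rewrite ?eqxx ?mulr1 ?mulr0 // => /eqP; rewrite eq_sym => /negbTE ->.
rewrite linear0; have [->|/hrho] := eqVneq (rho (b :: u) (val a) i0) 0; first by rewrite scale0r.
have := letter_dg dg0 a; rewrite dgi0 wt_cons.
by case: (dg (val a)) => // k _; rewrite addSn addnS.
Qed.

(** Bianchi identity. On one letter it is [dA *m dA = 0]; on more letters the degrees leave no
    room. *)
Lemma bd1_curv u : bd1 dg rho (curv rho) u = 0.
Proof.
case: u => [|a u]; first by rewrite bd1_nil.
rewrite bd1_cons.
rewrite (_ : bd1 dg rho (fun w => curv rho (a :: w)) u =
   bd1 dg rho (fun v => if v is [::] then (rho [::] (val a) i0)%:M else 0) u); last first.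
  by congr bd1; apply/funext => -[|b v].
rewrite bd1_delta scaler0 addr0 big_splits_top; last first.
  move=> [v [|b w]] /=; first by move=> lt_vu Ev; rewrite -Ev cats0 ltnn in lt_vu.
  move=> _ _; apply: big1 => i _; rewrite /consf; case: insub => [c|]; last by rewrite scaler0.
  by rewrite /= scaler0.
rewrite /=; have -> : \sum_(i < N) rho u (val a) i *: consf (curv rho) [::] i =
   ((rho u *m dA) (val a) i0)%:M.
  rewrite mxE rmorph_sum; apply: eq_bigr => i _; rewrite /consf.
  case: insubP => [c _ <-|]; first by rewrite /= rho0 scale_scalar_mx.
  rewrite negbK => /eqP ->.
  have [->|/hdA] := eqVneq (dA i0 i0) 0; last by rewrite dgi0.
  by rewrite mulr0 scaler0 raddf0.
case: u => [|b u]; first by rewrite rho0 dAdA mxE raddf0 oppr0.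
have [->|] := eqVneq ((rho (b :: u) *m dA) (val a) i0) 0; first by rewrite raddf0 oppr0.
move=> /mulmx_neq0[l [/hrho + /hdA E]]; rewrite E dgi0 wt_cons.
have := letter_dg dg0 a; have := letter_dg dg0 b.
by case: (dg (val a)) (dg (val b)) => [|k] [|m] // _ _; rewrite addSn !addnS.
Qed.

(** [mc] is [Delta] applied to [rho], so [Delta] of it can be computed directly and by [Delta2]. In
    lower weights [mc] is the curvature, whose contributions to the two results agree; what remains
    is the commutation with [dA]. *)
Lemma mc_commute n u : wt u = n.+1 ->
  (forall v, (wt v <= n)%N -> mc dg rho v = curv rho v) ->
  dA *m mc dg rho u = mc dg rho u *m dA.
Proof.
case: u => [|a u]; first by rewrite wt_nil.
move=> wn hmc; have wun : (wt u <= n)%N.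
  by rewrite -ltnS -wn wt_cons -{1}[wt u]add0n ltn_add2r.
pose e v (_ : 'I_1) := mc dg rho v.
have := @Delta2 _ _ _ dg rho 1 0 (fun _ _ => 0) hrho _ (fun v _ => rho v) (a :: u) ord0.
rewrite (eq_Delta _ _ _ _ _ _ (_ : forall v h, _ = e v h)) => [|v h]; last by rewrite (ord1 h).
rewrite {1}/Delta.
have hdG0 : homog_dG (fun=> 0%N) (0 : 'M[Q]_1) by move=> ? ?; rewrite mxE eqxx.
have hlam0 : homog_lam dg (fun=> 0%N) (fun (_ : seq L) (_ : 'I_1) => 0 : 'M[Q]_(N, 1)).
  by move=> ? ? ? ?; rewrite mxE eqxx.
rewrite (bd_local hrho hdG0 hlam0 (f' := fun v _ => curv rho v)) => [|v h]; last first.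
  by rewrite !addn0 wn => -[E]; apply: hmc; rewrite E.
have -> : bd dg rho (0 : 'M_1) (fun _ _ => 0) (fun v _ => curv rho v) (a :: u) ord0 = 0.
  exact: (bd1_curv (a :: u)).
(* Words in the letters alone carry the zero action, which is not unital: hence [kap := 0]. The
   resulting [last_curv] is matched by the convolution of [rho] with the curvature. *)
rewrite mulmx0 addr0 (bd2 dg0 hrho rho_unit (kap := 0) _ _ _ (n := n.+1) (p := n.+1)
   (dgG := fun=> 0%N)) ?addn0 ?ltnS //; first last.
- move=> v h _; rewrite mulmx0 addr0 /Delta /conv big1 ?add0r ?bd0 ?mulmx0 // => s _.
  by rewrite mulmx0.
- by rewrite mulmx0.
- by move=> [|b v] g; rewrite ?scale0r linear0.
rewrite subr0 scale1r !conv_cons /e rho0.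
have -> : conv (fun v => rho (a :: v)) (fun v _ => mc dg rho v) u (@ord0 0) =
    last_curv rho (fun v => rho (a :: v)) u.
  rewrite -conv_curvr; apply: eq_big_splits => s Es; rewrite hmc //.
  by apply: leq_trans wun; rewrite -Es wt_cat leq_addl.
rewrite (hmc [::]) ?wt_nil // [curv _ [::]]/= mul0mx add0r.
have -> : conv (fun v => mc dg rho (a :: v)) (fun v _ => rho v) u (@ord0 0) =
    (mc dg rho (a :: u) - curv rho (a :: u)) *m dA + rho [::] (val a) i0 *: rho u.
  rewrite -[X in _ *m X]rho0.
  have <- : conv (fun v => curv rho (a :: v)) (fun v _ => rho v) u (@ord0 0) =
     rho [::] (val a) i0 *: rho u.
    by have := conv_curvl rho (fun v (_ : 'I_1) => rho v) (a :: u) ord0;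
       rewrite conv_cons mul0mx add0r.
  rewrite -(@big_splits_top _ _ u (fun s => (mc dg rho (a :: s.1) - curv rho (a :: s.1)) *m rho
    s.2)).
    by rewrite -big_split; apply: eq_bigr => s _ /=; rewrite mulmxBl subrK.
  move=> s lt_su Es; rewrite hmc ?subrr ?mul0mx // -ltnS -wn.
  by apply: (@lt_wt _ (a :: u) _ s.2) => //=; rewrite Es.
rewrite [last_curv _ _ (a :: u)]/= rho0.
set h := dA _ _; set lc := last_curv _ _ _.
have -> : (if u is [::] then h *: dA else 0) = curv rho (a :: u) *m dA.
  by case: (u) => [|b v]; rewrite /= ?mul0mx // rho0 mul_scalar_mx.
rewrite mulmxBl; set x := _ *m dA; set y := _ *m dA; set z := h *: _ => E.
apply: (addIr lc); rewrite E !addrA; congr (_ + _).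
by rewrite addrK subrK.
Qed.
End Given.
End Algebra.

Section AlgebraExistence.
Variables (Q : comNzRingType) (N : nat) (i0 : 'I_N) (dg : 'I_N -> nat) (dA : 'M[Q]_N).
Local Notation L := (letter i0).
Local Notation wt := (@word_wt N i0 dg).
Local Notation eps := (grade_sign Q dg).
Hypothesis dg0 : forall i, (dg i == 0%N) = (i == i0).
Hypothesis hdA : forall i j, dA i j != 0 -> dg i = (dg j).+1.
Hypothesis dAdA : dA *m dA = 0.
Hypothesis exA : acyclic dg dA.

Let dgi0 : dg i0 = 0%N. Proof. by apply/eqP; rewrite dg0. Qed.

Lemma bd1_homog0 : homog_dG (fun=> 0%N) (0 : 'M[Q]_1).
Proof. by move=> ? ?; rewrite mxE eqxx. Qed.
Lemma bd1_lam0 : homog_lam dg (fun=> 0%N) (fun (_ : seq L) (_ : 'I_1) => 0 : 'M[Q]_(N, 1)).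
Proof. by move=> ? ? ? ?; rewrite mxE eqxx. Qed.

Lemma mc_ext (rho rho' : seq L -> 'M[Q]_N) u :
  homog_bar dg rho -> (forall v, (wt v <= wt u)%N -> rho v = rho' v) ->
  mc dg rho u = mc dg rho' u.
Proof.
move=> hrho E; rewrite /mc.
have -> : conv rho (fun v _ => rho v) u (@ord0 0) = conv rho' (fun v _ => rho' v) u (@ord0 0).
  by apply: eq_big_splits => s Es; rewrite !E // -Es wt_cat (leq_addl, leq_addr).
congr (_ + mulmx _ _); transitivity (bd1 dg rho rho' u).
  apply: (bd_local hrho bd1_homog0 bd1_lam0) => v h; rewrite !addn0 => Ev; apply: E.
  by rewrite -Ev.
by apply: bd_ext => // v /ltnW/E.
Qed.

(** [Y] is only met where the other half of a cut is empty, that is against [dA]; all other terms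
    use [rho] in weight at most [n]. *)
Lemma mc_add (rho Y : seq L -> 'M[Q]_N) n u :
  homog_bar dg rho -> wt u = n.+1 -> rho [::] = dA ->
  mc dg (fun v => if wt v == n.+1 then rho v + Y v else rho v) u =
  mc dg rho u + (dA *m Y u + Y u *m dA).
Proof.
move=> hrho wu rho0; set rho' := fun v => _.
have Erho v : (wt v <= n)%N -> rho' v = rho v by rewrite /rho'; case: eqP => // ->; rewrite ltnn.
have Erho' : rho' u = rho u + Y u by rewrite /rho' wu eqxx.
case: u wu Erho' => [|a u]; first by rewrite wt_nil.
move=> wu Eu; rewrite /mc !conv_cons Eu Erho ?wt_nil // rho0 mulmxDr.
have -> : bd1 dg rho' rho' (a :: u) = bd1 dg rho rho (a :: u).
  transitivity (bd1 dg rho rho' (a :: u)).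
    by symmetry; apply: bd_ext => // v; rewrite wu ltnS => /Erho.
  apply: (bd_local hrho bd1_homog0 bd1_lam0) => v h; rewrite !addn0 wu => -[Ev].
  by rewrite Erho ?Ev.
have wun : (wt u <= n)%N by rewrite -ltnS -wu wt_cons -{1}[wt u]add0n ltn_add2r.
have -> : conv (fun v => rho' (a :: v)) (fun v _ => rho' v) u (@ord0 0) =
   conv (fun v => rho (a :: v)) (fun v _ => rho v) u (@ord0 0) + Y (a :: u) *m dA.
  have <- : \sum_(s <- splits u) (rho' (a :: s.1) - rho (a :: s.1)) *m rho s.2 =
      Y (a :: u) *m dA.
    rewrite big_splits_top /=; first by rewrite Eu rho0 addrAC subrr add0r.
    move=> s lt_su Es; rewrite Erho ?subrr ?mul0mx // -ltnS -wu -Es !wt_cons wt_cat.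
    rewrite addnA -{1}[(_ + wt s.1)%N]addn0 ltn_add2l lt0n wt_eq0.
    by apply: contraTneq lt_su => s0; rewrite -Es s0 cats0 ltnn.
  rewrite -big_split; apply: eq_big_splits => s Es /=; rewrite mulmxBl addrCA subrr addr0.
  by rewrite (Erho s.2) // (leq_trans _ wun) // -Es wt_cat leq_addl.
move: (dA *m _) (dA *m _) (conv _ _ _ _) (_ *m dA) (eps *m _) => x y z t w.
by apply/matrixP => i j; rewrite !mxE; ring.
Qed.

(* Induction on the weight: the failure of Stasheff's identities in weight [n.+1] is
   a chain map [A -> A], null homotopic since [A] is acyclic, and a homotopy
   corrects [rho] in that weight. *)
Theorem bar_exists : exists rho : seq L -> 'M[Q]_N,
  [/\ homog_bar dg rho, bar_unit rho, rho [::] = dA & forall u, mc dg rho u = curv rho u].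
Proof.
(* In larger weights both sides vanish: they raise degrees by [wt u - 2], beyond the top degree of
   [A]. *)
have [] : exists rho : seq L -> 'M[Q]_N,
  [/\ homog_bar dg rho, bar_unit rho, rho [::] = dA
    & forall u, (wt u <= (\max_i dg i).+2)%N -> mc dg rho u = curv rho u]; last first.
  move=> rho [hrho rho_unit rho0 Erho]; exists rho; split => // u.
  have [/Erho //|lt_u] := leqP (wt u) (\max_i dg i).+2.
  have big_deg i j : (dg j).+2 <> (dg i + wt u)%N.
    move=> E; have := leq_trans lt_u (leq_addl (dg i) (wt u)); rewrite -E !ltnS.
    by rewrite ltnNge (leq_bigmax j).
  apply/matrixP => i j; transitivity (0 : Q).
    by apply/eqP; apply: contraT => /(mc_homog hrho)/big_deg.
  by symmetry; apply/eqP; apply: contraT => /(curv_homog dg0 hdA rho0)/big_deg.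
elim: (\max_i dg i).+2 => [|n [rho [hrho rho_unit rho0 Erho]]].
  (* Besides [dA], only the products by the unit are put in at the start. *)
  exists (fun u => if u is a :: v then if v is [::] then delta_mx i0 (val a) else 0 else dA).
  have rho0h : homog_bar dg (fun u : seq L =>
      if u is a :: v then if v is [::] then delta_mx i0 (val a) else 0 else dA).
    move=> [|a [|b u]] i j; first by move/hdA => ->; rewrite wt_nil addn0.
      rewrite mxE wt_cons wt_nil addn0; case: (i =P i0) => [->|]; last by rewrite eqxx.
      by case: (j =P val a) => [->|]; rewrite ?eqxx // dgi0.
    by rewrite mxE eqxx.
  split=> //.
    move=> [|a [|b u]]; last by rewrite linear0.
      apply/rowP => j; rewrite !mxE; apply/eqP; apply: contraT => /hdA.
      by rewrite dgi0.
    by apply/rowP => j; rewrite !mxE eqxx.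
  move=> u; rewrite leqn0 wt_eq0 => /eqP ->.
  by rewrite /mc conv_nil bd1_nil mulmx0 addr0 dAdA.
have Z u : exists Y : 'M[Q]_N, wt u = n.+1 ->
    [/\ forall i j, Y i j != 0 -> dg j = (dg i + n)%N, row i0 Y = 0
      & dA *m Y + Y *m dA = curv rho u - mc dg rho u].
  have [wu|] := pselect (wt u = n.+1); last by exists 0.
  have hmc := mc_commute dg0 hdA dAdA hrho rho_unit rho0 wu Erho.
  have [||||Y HY] := solve_homotopy dg0 hdA dAdA exA (s := n) (Z := curv rho u - mc dg rho u).
  - move=> i j; rewrite mxE; have [->|/(curv_homog dg0 hdA rho0)] := eqVneq (curv rho u i j) 0.
      rewrite add0r mxE oppr_eq0 => /(mc_homog hrho).
      by rewrite wu addnS => -[].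
    by rewrite wu addnS => -[].
  - by rewrite linearB /= (row_mc dg0 hrho rho_unit) subrr.
  - rewrite mulmxBr mulmxBl hmc; congr (_ - _).
    by case: (u) => [|a [|b v]]; rewrite /= ?mulmx0 ?mul0mx // scalar_mxC.
  (* The condition on [H_0] would concern a word of weight one, but a letter weighs at least two. *)
  - move=> n0; suff : u = [::] by move=> u0; move: wu; rewrite u0 wt_nil.
    case: (u) wu => // a v; rewrite n0 wt_cons => -[/eqP]; rewrite addn_eq0 dg0.
    by rewrite (negbTE (valP a)).
  by exists Y.
have {Z}[Y HY] := choice Z.
exists (fun v => if wt v == n.+1 then rho v + Y v else rho v); split.
- move=> u i j; case: (wt u =P n.+1) => [wu|_]; last exact: hrho.
  rewrite mxE; have [->|/hrho //] := eqVneq (rho u i j) 0.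
  by rewrite add0r; case: (HY u wu) => hY _ _ /hY ->; rewrite wu addnS.
- move=> u; rewrite -rho_unit; case: (wt u =P n.+1) => // wu.
  by case: (HY u wu) => _ Y0 _; rewrite linearD /= Y0 addr0.
- by rewrite wt_nil.
- move=> u le_u; rewrite (_ : curv _ u = curv rho u); last first.
    by case: u {le_u} => [|a [|b u]] //=; rewrite wt_nil.
  move: le_u; rewrite leq_eqVlt => /orP[/eqP wu|lt_u].
    by rewrite mc_add //; case: (HY u wu) => _ _ ->; rewrite addrC subrK.
  rewrite -Erho //; symmetry; apply: mc_ext => // v le_vu.
  by rewrite ltn_eqF // (leq_ltn_trans le_vu).
Qed.
End AlgebraExistence.

(** * Strictly unital A-infinity modules *)

Section Module.
Variables (Q : comNzRingType) (N : nat) (i0 : 'I_N) (dg : 'I_N -> nat) (dA : 'M[Q]_N).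
Local Notation L := (letter i0).
Local Notation wt := (@word_wt N i0 dg).
Local Notation eps := (grade_sign Q dg).
Hypothesis dg0 : forall i, (dg i == 0%N) = (i == i0).
Hypothesis hdA : forall i j, dA i j != 0 -> dg i = (dg j).+1.
Hypothesis dAdA : dA *m dA = 0.
Variables (J : nat) (dgG : 'I_J -> nat) (dG : 'M[Q]_J).
Hypothesis hdG : homog_dG dgG dG.
Hypothesis dGdG : dG *m dG = 0.
Hypothesis exG : acyclic dgG dG.
Hypothesis annG : forall i g, dg i = 1%N -> dgG g = 0%N ->
  exists2 w, homog_rV dgG 1 w & w *m dG = dA i i0 *: delta_mx 0 g.
Variable rho : seq L -> 'M[Q]_N.
Hypothesis hrho : homog_bar dg rho.
Hypothesis rho_unit : bar_unit rho.
Hypothesis rho0 : rho [::] = dA.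
Hypothesis rho_mc : forall u, mc dg rho u = curv rho u.

Let dgi0 : dg i0 = 0%N. Proof. by apply/eqP; rewrite dg0. Qed.

Definition mod_unit (lam : seq L -> 'I_J -> 'M[Q]_(N, J)) := forall u g,
  row i0 (lam u g) = if u is [::] then delta_mx 0 g else 0.

(** Its vanishing is Stasheff's identity for modules. No curvature occurs: a unit between the first
    argument and [g] is an argument of a higher operation, never of a binary one, and strict
    unitality kills the term. *)
Definition mod_mc (lam : seq L -> 'I_J -> 'M[Q]_(N, J)) u g :=
  Delta dg rho dG lam lam u g + lam u g *m dG.

Section Given.
Variable lam : seq L -> 'I_J -> 'M[Q]_(N, J).
Hypothesis hlam : homog_lam dg dgG lam.
Hypothesis lam_unit : mod_unit lam.

Lemma mod_mc_homog u g i j :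
  mod_mc lam u g i j != 0 -> ((dgG j).+1 = dg i + (wt u + dgG g))%N.
Proof.
pose P (X : 'M[Q]_(N, J)) := forall i j, X i j != 0 -> ((dgG j).+1 = dg i + (wt u + dgG g))%N.
suff: P (mod_mc lam u g) by apply.
have P0 : P 0 by move=> ? ?; rewrite mxE eqxx.
have PD X Y : P X -> P Y -> P (X + Y).
  move=> PX PY k l; rewrite mxE; have [->|/PX //] := eqVneq (X k l) 0.
  by rewrite add0r => /PY.
apply: (PD); [apply: (PD)|].
- rewrite /conv (@eq_big_splits _ _ u _ (fun s =>
    if `[< s.1 ++ s.2 = u >] then rho s.1 *m lam s.2 g else 0)); last first.
    by move=> s Es; rewrite asboolT.
  elim/big_ind: _ => // s _; case: asboolP => [Es|//] k l.
  move=> /mulmx_neq0[x [/hrho E1 /hlam ->]].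
  by rewrite -!addSn E1 -Es wt_cat !addnA.
- move=> k l; rewrite mul_diag_mx mxE.
  have [->|H _] := eqVneq (bd dg rho dG lam lam u g k l) 0; first by rewrite mulr0 eqxx.
  suff: P (bd dg rho dG lam lam u g) by apply.
  apply: (bd_closed hrho hdG hlam) => //.
    move=> a X PX x y; rewrite mxE; have [->|/PX //] := eqVneq (X x y) 0.
    by rewrite mulr0 eqxx.
  by move=> v h E x y /hlam ->; rewrite -E addnS addnA.
- move=> k l /mulmx_neq0[h [/hlam E /hdG El]].
  by rewrite -El E addnA.
Qed.

Lemma row_mod_mc u g : row i0 (mod_mc lam u g) = 0.
Proof.
have Ebd : row i0 (eps *m bd dg rho dG lam lam u g) =
    bd dg rho dG lam (fun v h => if v is [::] then delta_mx 0 h else 0) u g.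
  by rewrite row_eps dgi0 scale1r bd_row; apply: eq_bd => v h; rewrite lam_unit.
rewrite !linearD /= Ebd row_mul lam_unit; case: u {Ebd} => [|a u].
  rewrite conv_nil row_mul rho_unit mul0mx add0r /= -rowE [row _ _]row_sum_delta.
  by apply/eqP; rewrite addrC subr_eq0; apply/eqP/eq_bigr => h _; rewrite mxE.
rewrite mul0mx addr0 conv_cons linearD /= row_mul rho_unit mul0mx add0r.
have -> : row i0 (conv (fun v => rho (a :: v)) lam u g) = row (val a) (lam u g).
  rewrite /conv linear_sum big_splits_bot => [|[[|b v] w] /= ? ?] //=.
    by rewrite row_mul rho_unit -rowE.
  by rewrite row_mul rho_unit mul0mx.
rewrite big1 => [|s _]; last first.
  by rewrite big1 // => i _; rewrite /consf; case: insub => [c|]; rewrite scaler0.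
rewrite bd0 scaler0 !add0r [row _ _]row_sum_delta.
by apply/eqP; rewrite subr_eq0; apply/eqP/eq_bigr => h _; rewrite mxE.
Qed.

(** For a unital action the square of [bd] retains the curvature of the first letter only, and this
    cancels the curvature convolved with [lam]. So [Delta] squares to zero on [lam], which yields
    the commutation. *)
Lemma mod_mc_commute n u g : (wt u + dgG g)%N = n ->
  (forall v h, (wt v + dgG h < n)%N -> mod_mc lam v h = 0) ->
  dA *m mod_mc lam u g = mod_mc lam u g *m dG.
Proof.
move=> En Emc.
have DD : Delta dg rho dG lam (Delta dg rho dG lam lam) u g = 0.
  rewrite Delta2 // (_ : conv (mc dg rho) lam u g = conv (curv rho) lam u g); last first.
    by apply: eq_bigr => s _; rewrite rho_mc.
  rewrite conv_curvl; case: u En => [|a u] En; first by rewrite bd2_nil ?add0r.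
  rewrite (bd2 dg0 hrho rho_unit (kap := 1) _ dGdG _ (n := (wt u).+1) (p := n) (dgG := dgG)) //.
  - by rewrite subrr scale0r addr0 subrr.
  - by move=> v h; rewrite lam_unit; case: v => //; rewrite scale1r.
  - by rewrite -En wt_cons -addnA -{1}[(wt u + _)%N]add0n ltn_add2r.
have EDl v h : Delta dg rho dG lam lam v h = mod_mc lam v h - lam v h *m dG.
  by rewrite addrK.
move: DD; rewrite (eq_Delta _ _ _ _ _ _ EDl) DeltaD DeltaN Delta_mulmxr EDl mulmxBl.
rewrite -[lam u g *m dG *m dG]mulmxA dGdG mulmx0 subr0 => /eqP.
rewrite subr_eq0 => /eqP <-.
rewrite /Delta (bd_local hrho hdG hlam (f' := fun _ _ => 0)) => [|v h Ev]; last first.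
  by apply: Emc; rewrite -En -Ev.
rewrite bd0 mulmx0 addr0 /conv big_splits_bot ?rho0 // => s s0 Es.
rewrite Emc ?mulmx0 // -En -Es wt_cat -addnA -{1}[(wt s.2 + _)%N]add0n ltn_add2r.
by rewrite lt0n wt_eq0 -size_eq0 -lt0n.
Qed.

End Given.

Lemma mod_mc_ext lam lam' n u g : homog_lam dg dgG lam -> (wt u + dgG g)%N = n ->
  (forall v h, (wt v + dgG h <= n)%N -> lam v h = lam' v h) ->
  mod_mc lam u g = mod_mc lam' u g.
Proof.
move=> hlam En E; rewrite /mod_mc /Delta.
have -> : conv rho lam u g = conv rho lam' u g.
  by apply: eq_big_splits => s Es; rewrite E // -En -Es wt_cat leq_add2r leq_addl.
rewrite E -?En //; congr (_ + mulmx _ _ + _).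
transitivity (bd dg rho dG lam lam' u g).
  apply: (bd_local hrho hdG hlam) => v h Ev; apply: E.
  by rewrite -En -Ev.
by apply: bd_ext => // v /ltnW le_vu; apply: E; rewrite -En leq_add2r.
Qed.

Lemma mod_mc_add lam Y n u g : homog_lam dg dgG lam -> (wt u + dgG g)%N = n ->
  mod_mc (fun v h => if (wt v + dgG h)%N == n then lam v h + Y v h else lam v h) u g =
  mod_mc lam u g + (dA *m Y u g + Y u g *m dG).
Proof.
move=> hlam En; set lam' := fun v h => _.
have Elam v h : (wt v + dgG h < n)%N -> lam' v h = lam v h.
  by rewrite /lam'; case: (_ =P n) => // ->; rewrite ltnn.
have Eu : lam' u g = lam u g + Y u g by rewrite /lam' En eqxx.
rewrite /mod_mc /Delta Eu mulmxDl.
have -> : bd dg rho dG lam' lam' u g = bd dg rho dG lam lam u g.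
  transitivity (bd dg rho dG lam lam' u g).
    by symmetry; apply: bd_ext => // v lt_vu; rewrite Elam // -En ltn_add2r.
  by apply: (bd_local hrho hdG hlam) => v h Ev; rewrite Elam // -En -Ev.
have -> : conv rho lam' u g = conv rho lam u g + dA *m Y u g.
  have <- : \sum_(s <- splits u) rho s.1 *m (lam' s.2 g - lam s.2 g) = dA *m Y u g.
    rewrite big_splits_bot /=; first by rewrite Eu rho0 addrAC subrr add0r.
    move=> s s0 Es; rewrite Elam ?subrr ?mulmx0 // -En -Es wt_cat -addnA.
    rewrite -{1}[(wt s.2 + _)%N]add0n ltn_add2r.
    by rewrite lt0n wt_eq0 -size_eq0 -lt0n.
  by rewrite -big_split; apply: eq_bigr => s _ /=; rewrite mulmxBr addrCA subrr addr0.
by apply/matrixP => i j; rewrite !mxE; ring.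
Qed.

(** The obstruction is a chain map [A -> G], removed as in [bar_exists]. The induction is on
    [wt u + dgG g], since the differential of [G] lowers [g] and keeps [u]. *)
Theorem mod_exists : exists lam : seq L -> 'I_J -> 'M[Q]_(N, J),
  [/\ homog_lam dg dgG lam, mod_unit lam & forall u g, mod_mc lam u g = 0].
Proof.
have [] : exists lam : seq L -> 'I_J -> 'M[Q]_(N, J),
  [/\ homog_lam dg dgG lam, mod_unit lam
   & forall u g, (wt u + dgG g < (\max_j dgG j).+2)%N -> mod_mc lam u g = 0]; last first.
  move=> lam [hlam lam_unit Elam]; exists lam; split => // u g.
  have [/Elam //|lt_u] := ltnP (wt u + dgG g) (\max_i dgG i).+2.
  apply/matrixP => i j; rewrite [RHS]mxE; apply/eqP; apply: contraT.
  move=> /(mod_mc_homog hlam) E; have := leq_trans lt_u (leq_addl (dg i) _).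
  by rewrite -E ltnS ltnNge (leq_bigmax j).
elim: (\max_j dgG j).+2 => [|n [lam [hlam lam_unit Elam]]].
  exists (fun u g => if u is [::] then delta_mx i0 g else 0); split=> //.
    move=> [|a u] g i h; rewrite mxE ?eqxx //.
    case: (i =P i0) => [->|]; last by rewrite eqxx.
    by case: (h =P g) => [->|]; rewrite ?eqxx // dgi0 wt_nil.
  by move=> [|a u] g; rewrite ?linear0 //; apply/rowP => j; rewrite !mxE eqxx.
have Z (w : seq L * 'I_J) : exists Y : 'M[Q]_(N, J), (wt w.1 + dgG w.2)%N = n ->
    [/\ forall i j, Y i j != 0 -> dgG j = (dg i + n)%N, row i0 Y = 0
      & dA *m Y + Y *m dG = - mod_mc lam w.1 w.2].
  case: w => u g /=.
  have [wu|] := pselect ((wt u + dgG g)%N = n); last by exists 0.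
  have hmc := mod_mc_commute hlam lam_unit wu Elam.
  have [||||Y HY] := solve_homotopy dg0 hdA dAdA exG (s := n) (Z := - mod_mc lam u g).
  - by move=> i j; rewrite mxE oppr_eq0 => /(mod_mc_homog hlam); rewrite wu.
  - by rewrite linearN /= row_mod_mc // oppr0.
  - by rewrite mulmxN mulNmx hmc.
  (* In total weight zero acyclicity is no help. Here [annG] enters: the kernel of [Q -> R] kills
     [H_0(G) = M]. *)
  - move=> n0 i Ei; rewrite n0 in wu; have /eqP := wu.
    rewrite addn_eq0 wt_eq0 => /andP[/eqP u0 /eqP g0]; rewrite u0 /mod_mc /Delta conv_nil.
    have -> : bd dg rho dG lam lam [::] g = 0.
      rewrite /= big1 ?oppr0 // => h _; have [->|] := eqVneq (dG g h) 0; first by rewrite scale0r.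
      by move/hdG; rewrite g0.
    have [w hw Ew] := annG Ei g0.
    exists (- (w + row i (lam [::] g))).
      apply/homog_rVN/homog_rVD => // j; rewrite mxE => /hlam ->.
      by rewrite Ei g0 wt_nil.
    rewrite mulmx0 addr0 rho0 mulNmx mulmxDl Ew [RHS]linearN /=; congr (- _).
    rewrite linearD /= !row_mul; congr (_ + _); rewrite (row_sum_delta (row i dA)) (bigD1 i0) //=
      big1 => [|l l0].
      by rewrite addr0 mxE -scalemxAl -rowE lam_unit.
    rewrite mxE; have [->|/hdA] := eqVneq (dA i l) 0; first by rewrite scale0r.
    rewrite Ei => -[] /esym/eqP; rewrite dg0 => /eqP El; by rewrite El eqxx in l0.
  by exists Y.
have {Z}[Y HY] := choice Z.
exists (fun v h => if (wt v + dgG h)%N == n then lam v h + Y (v, h) else lam v h); split.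
- move=> u g i h; case: (_ =P n) => [wu|_]; last exact: hlam.
  rewrite mxE; have [->|/hlam //] := eqVneq (lam u g i h) 0.
  by rewrite add0r; case: (HY (u, g) wu) => hY _ _ /hY ->; rewrite -wu addnA.
- move=> u g; rewrite -lam_unit; case: (_ =P n) => // wu.
  by case: (HY (u, g) wu) => _ Y0 _; rewrite linearD /= Y0 addr0.
- move=> u g; rewrite ltnS leq_eqVlt => /orP[/eqP wu|lt_u].
    rewrite (mod_mc_add (fun v h => Y (v, h)) hlam wu).
    by case: (HY (u, g) wu) => _ _ ->; rewrite subrr.
  rewrite -(Elam _ _ lt_u); symmetry; apply: (mod_mc_ext hlam) (erefl _) _ => v h le_vu.
  by rewrite ltn_eqF // (leq_ltn_trans le_vu).
Qed.
End Module.

(** * Exactness of the bar construction *)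

Section Exactness.
Variables (Q : comNzRingType) (N : nat) (i0 : 'I_N) (dg : 'I_N -> nat) (dA : 'M[Q]_N).
Local Notation L := (letter i0).
Local Notation wt := (@word_wt N i0 dg).
Hypothesis dg0 : forall i, (dg i == 0%N) = (i == i0).
Hypothesis exA : acyclic dg dA.
Variables (J : nat) (dgG : 'I_J -> nat) (dG : 'M[Q]_J).
Hypothesis hdG : homog_dG dgG dG.
Hypothesis dGdG : dG *m dG = 0.
Hypothesis exG : acyclic dgG dG.
Variable rho : seq L -> 'M[Q]_N.
Hypothesis hrho : homog_bar dg rho.
Hypothesis rho_unit : bar_unit rho.
Hypothesis rho0 : rho [::] = dA.
Hypothesis rho_mc : forall u, mc dg rho u = curv rho u.
Variable lam : seq L -> 'I_J -> 'M[Q]_(N, J).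
Hypothesis hlam : homog_lam dg dgG lam.
Hypothesis lam_unit : mod_unit lam.
Hypothesis lam_mc : forall u g, mod_mc dg dG rho lam u g = 0.

Let dgi0 : dg i0 = 0%N. Proof. by apply/eqP; rewrite dg0. Qed.

Definition gword := (seq L * 'I_J)%type.
Definition gword_wt (w : gword) : nat := (wt w.1 + dgG w.2)%N.
Local Notation bdW := (bd dg rho dG lam).
Local Notation DeltaW := (Delta dg rho dG lam).

(** The matrix entry of the differential from [w] to [w'], obtained by pairing with the indicator
    function of [w']. *)
Definition bar_coef (w w' : gword) : Q :=
  bdW (fun v h => ((v, h) == w')%:R : 'rV[Q]_1) w.1 w.2 0 0.

Lemma kap_unit u g : row i0 (lam u g) = if u is [::] then 1 *: delta_mx 0 g else 0.
Proof. by rewrite lam_unit; case: u => //; rewrite scale1r. Qed.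

Lemma bd2_gword r m (f : seq L -> 'I_J -> 'M[Q]_(r, m)) u g :
  bdW (bdW f) u g = if u is a :: v then - (dA (val a) i0 *: f v g) else 0.
Proof.
case: u => [|a u]; first exact: bd2_nil.
rewrite (bd2 dg0 hrho rho_unit kap_unit dGdG _ (n := (wt u).+1) (p := (wt u + dgG g).+1) (dgG :=
  dgG)) //.
  by rewrite subrr scale0r addr0 rho0.
by move=> v h _; apply: lam_mc.
Qed.

(** The curvatures in [conv mc F] and in the square of [bd] are opposite: unlike the words alone,
    [A (x) words] is a complex over [Q]. *)
Lemma Delta2_gword m (F : seq L -> 'I_J -> 'M[Q]_(N, m)) u g : DeltaW (DeltaW F) u g = 0.
Proof.
rewrite Delta2 // bd2_gword (_ : conv _ _ _ _ = conv (curv rho) F u g); last first.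
  by apply: eq_bigr => s _; rewrite rho_mc.
by rewrite conv_curvl rho0; case: u => [|a u]; rewrite ?addr0 // subrr.
Qed.

Lemma Delta_local m (F F' : seq L -> 'I_J -> 'M[Q]_(N, m)) u g :
  (forall v h, (wt v + dgG h <= wt u + dgG g)%N -> F v h = F' v h) ->
  DeltaW F u g = DeltaW F' u g.
Proof.
move=> FF'; rewrite /Delta.
have -> : conv rho F u g = conv rho F' u g.
  by apply: eq_big_splits => s Es; rewrite FF' // -Es wt_cat leq_add2r leq_addl.
congr (_ + mulmx _ _); apply: (bd_local hrho hdG hlam) => v h Ev.
by apply: FF'; rewrite -Ev.
Qed.

(** The boundary of [1 (x) (a | v)] is [a (x) v] plus the unit tensored with the differential of the
    word. *)
Lemma row_Delta m (F : seq L -> 'I_J -> 'M[Q]_(N, m)) u g :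
  row i0 (DeltaW F u g) =
  (if u is a :: v then row (val a) (F v g) else 0) + bdW (fun v h => row i0 (F v h)) u g.
Proof.
rewrite /Delta linearD /= row_eps dgi0 scale1r bd_row; congr (_ + _).
case: u => [|a u]; first by rewrite conv_nil row_mul rho_unit mul0mx.
rewrite conv_cons linearD /= row_mul rho_unit mul0mx add0r.
rewrite /conv linear_sum big_splits_bot => [|[[|b v] w] /= ? ?] //=.
  by rewrite row_mul rho_unit -rowE.
by rewrite row_mul rho_unit mul0mx.
Qed.

(* The scalar [c] vanishes in [H_0(A)]. *)
Definition in_ann (c : Q) :=
  exists2 v, homog_rV dg 1 v & v *m dA = c *: delta_mx 0 i0.

Variables (M : nat) (S : seq gword).
Hypothesis S_uniq : uniq S.
Hypothesis S_mem : forall w, (w \in S) = (gword_wt w <= M)%N.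

(** The Dirac function at [w']. Truncating the words to the finite list [S] lets functions be
    expanded in these. *)
Definition point m (w' : gword) (v : seq L) (h : 'I_J) : 'M[Q]_m :=
  if (v, h) == w' then 1%:M else 0.

Lemma sum_point m p (F : seq L -> 'I_J -> 'M[Q]_(m, p)) v h : (v, h) \in S ->
  \sum_(w <- S) point m w v h *m F w.1 w.2 = F v h.
Proof.
move=> vS; rewrite (bigD1_seq (v, h)) //= /point eqxx mul1mx big1 ?addr0 // => w.
by rewrite eq_sym => /negbTE ->; rewrite mul0mx.
Qed.

Lemma Delta_sum m I (r : seq I) (F : I -> seq L -> 'I_J -> 'M[Q]_(N, m)) u g :
  DeltaW (fun v h => \sum_(i <- r) F i v h) u g = \sum_(i <- r) DeltaW (F i) u g.
Proof.
rewrite /Delta bd_sum mulmx_sumr /conv -[RHS]/(\sum_(i <- r) (_ + _)) big_split /=.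
congr (_ + _); rewrite exchange_big; apply: eq_bigr => s _.
by rewrite mulmx_sumr.
Qed.

Lemma Delta_expand m (F : seq L -> 'I_J -> 'M[Q]_(N, m)) w : w \in S ->
  DeltaW F w.1 w.2 = \sum_(w' <- S) DeltaW (point N w') w.1 w.2 *m F w'.1 w'.2.
Proof.
rewrite S_mem => le_wM.
rewrite (@Delta_local _ _ (fun v h => \sum_(w' <- S) point N w' v h *m F w'.1 w'.2)).
  by rewrite Delta_sum; apply: eq_bigr => w' _; rewrite Delta_mulmxr.
by move=> v h le_vw; rewrite sum_point // S_mem (leq_trans le_vw).
Qed.

(** The adjoint of [Delta], that is, the differential of [A (x) words] itself; a chain is one
    element of [A] for each word. *)
Definition chainD (y : gword -> 'rV[Q]_N) (w' : gword) : 'rV[Q]_N :=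
  \sum_(w <- S) y w *m DeltaW (point N w') w.1 w.2.

Lemma chainD_pair m (F : seq L -> 'I_J -> 'M[Q]_(N, m)) y :
  \sum_(w <- S) chainD y w *m F w.1 w.2 = \sum_(w <- S) y w *m DeltaW F w.1 w.2.
Proof.
under eq_bigr => w _ do rewrite mulmx_suml.
rewrite exchange_big; apply: eq_big_seq => w wS.
by rewrite Delta_expand // mulmx_sumr; apply: eq_bigr => w' _; rewrite mulmxA.
Qed.

Lemma chainD2 y w' : chainD (chainD y) w' = 0.
Proof.
rewrite {1}/chainD (chainD_pair (fun u g => DeltaW (point N w') u g)) big1 // => w _.
by rewrite Delta2_gword mulmx0.
Qed.

Definition homog_chain n (y : gword -> 'rV[Q]_N) :=
  forall w j, y w 0 j != 0 -> (dg j + gword_wt w)%N = n.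

Lemma Delta_point_homog w w' i j :
  DeltaW (point N w') w.1 w.2 i j != 0 -> ((dg j + gword_wt w').+1 = dg i + gword_wt w)%N.
Proof.
pose P (X : 'M[Q]_N) := forall i j, X i j != 0 -> ((dg j + gword_wt w').+1 = dg i + gword_wt w)%N.
suff: P (DeltaW (point N w') w.1 w.2) by apply.
have P0 : P 0 by move=> ? ?; rewrite mxE eqxx.
have PD X Y : P X -> P Y -> P (X + Y).
  move=> PX PY k l; rewrite mxE; have [->|/PX //] := eqVneq (X k l) 0.
  by rewrite add0r => /PY.
apply: (PD).
  rewrite /conv (@eq_big_splits _ _ w.1 _ (fun s =>
    if `[< s.1 ++ s.2 = w.1 >] then rho s.1 *m point N w' s.2 w.2 else 0)); last first.
    by move=> s Es; rewrite asboolT.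
  elim/big_ind: _ => // s _; case: asboolP => [Es|//]; rewrite /point.
  case: (_ =P w') => [Ew|_]; last by rewrite mulmx0.
  rewrite mulmx1 => k l /hrho E; rewrite -Ew /gword_wt -Es wt_cat /= -addSn E.
  by rewrite !addnA.
move=> k l; rewrite mul_diag_mx mxE.
have [->|H _] := eqVneq (bdW (point N w') w.1 w.2 k l) 0; first by rewrite mulr0 eqxx.
suff: P (bdW (point N w') w.1 w.2) by apply.
apply: (bd_closed hrho hdG hlam) => //.
  move=> a X PX x y; rewrite mxE; have [->|/PX //] := eqVneq (X x y) 0.
  by rewrite mulr0 eqxx.
move=> v h Ev; rewrite /point; case: (_ =P w') => [Ew|_ x y]; last by rewrite mxE eqxx.
move=> x y; rewrite mxE; case: (x =P y) => [->|]; last by rewrite eqxx.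
by rewrite -Ew /gword_wt -Ev -addnS.
Qed.

Lemma chainD_homog n y : homog_chain n.+1 y -> homog_chain n (chainD y).
Proof.
move=> hy w j; rewrite summxE => /sum_neq0[w2 _] /mulmx_neq0[l [/hy E /Delta_point_homog E2]].
by apply: succn_inj; rewrite E2.
Qed.

(** Only the differential of the factor [A] preserves the weight of the word; every other term
    lowers it. *)
Lemma Delta_point_top w w' : (gword_wt w <= gword_wt w')%N ->
  DeltaW (point N w') w.1 w.2 = if w == w' then dA else 0.
Proof.
move=> le_ww'; rewrite /Delta.
rewrite (bd_local hrho hdG hlam (f' := fun _ _ => 0)) => [|v h Ev]; last first.
  rewrite /point; case: (_ =P w') => // Ew; move: le_ww'.
  by rewrite -Ew /gword_wt /= -Ev ltnn.
rewrite bd0 mulmx0 addr0 /conv big_splits_bot.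
  rewrite rho0 /point /= -surjective_pairing.
  by case: (w =P w'); rewrite ?mulmx1 ?mulmx0.
move=> s s0 Es; rewrite /point; case: (_ =P w') => [Ew|_]; last by rewrite mulmx0.
move: le_ww'; rewrite -Ew /gword_wt -Es wt_cat leq_add2r /= -{2}[wt s.2]add0n leq_add2r.
by rewrite leqn0 wt_eq0 -size_eq0 => /eqP E0; rewrite E0 in s0.
Qed.

(* Filter [A (x) words] by the weight of the word: the associated graded complex is a
   sum of copies of [A]. *)
Lemma chain_acyclic m n z : (n <= M)%N -> homog_chain n z ->
  (forall w, (m <= gword_wt w)%N -> z w = 0) -> (forall w, in_ann (z w 0 i0)) ->
  (forall w, chainD z w = 0) ->
  exists y, [/\ homog_chain n.+1 y, forall w, y w 0 i0 = 0
    & forall w, (gword_wt w <= M)%N -> chainD y w = z w].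
Proof.
move=> le_nM; elim: m z => [|m IHm] z hz z0 zI Dz.
  exists (fun=> 0); split=> [w j|w|w _]; rewrite ?mxE ?eqxx //.
  by rewrite z0 // /chainD big1 // => w' _; rewrite mul0mx.
have bP w : exists b : 'rV[Q]_N, gword_wt w = m ->
    [/\ forall j, b 0 j != 0 -> (dg j + m)%N = n.+1, b 0 i0 = 0 & b *m dA = z w].
  have [wm|] := pselect (gword_wt w = m); last by exists 0.
  have [lt_nm|le_mn] := ltnP n m.
    exists 0 => _; split; [by move=> j; rewrite mxE eqxx | by rewrite mxE|].
    rewrite mul0mx; apply/rowP => j; rewrite mxE; apply/eqP; rewrite eq_sym; apply: contraT.
    by move=> /hz; rewrite wm => E; rewrite -E ltnNge leq_addl in lt_nm.
  suff [b hb Eb] : exists2 b, homog_rV dg (n - m).+1 b & b *m dA = z w.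
    exists b => _; split=> //; first by move=> j /hb ->; rewrite addSn subnK.
    by apply/eqP; apply: contraT => /hb; rewrite dgi0.
  have zdA : z w *m dA = 0.
    rewrite -(Dz w) /chainD (bigD1_seq w) //=; last by rewrite S_mem wm (leq_trans le_mn).
    rewrite Delta_point_top // eqxx big1 ?addr0 // => w2 w2w.
    have [le_w2|lt_w2] := leqP (gword_wt w2) m.
      by rewrite Delta_point_top ?wm // (negbTE w2w) mulmx0.
    by rewrite z0 // mul0mx.
  have hzw : homog_rV dg (n - m) (z w).
    by move=> j /hz <-; rewrite wm addnK.
  (* In degree 0 [exA] says nothing, and [zI] takes its place. *)
  have [n_m|n_m] := posnP (n - m); last exact: exA n_m hzw zdA.
  have [b hb Eb] := zI w; exists b; first by rewrite n_m.
  rewrite Eb; apply/rowP => j; rewrite !mxE eqxx /=.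
  have [->|] := eqVneq j i0; first by rewrite mulr1.
  rewrite mulr0 => ji; apply/eqP; rewrite eq_sym; apply: contraT => /hzw/eqP.
  by rewrite n_m dg0 (negbTE ji).
have [b Hb] := choice bP.
pose y0 w := if gword_wt w == m then b w else 0.
have hy0 : homog_chain n.+1 y0.
  move=> w j; rewrite /y0; case: (gword_wt w =P m) => [wm|]; last by rewrite mxE eqxx.
  by case: (Hb w wm) => hb _ _ /hb; rewrite wm.
have y0u w : y0 w 0 i0 = 0.
  by rewrite /y0; case: (gword_wt w =P m) => [/Hb[]|_] //; rewrite mxE.
have Dy0 w : (m <= gword_wt w)%N -> (gword_wt w <= M)%N -> chainD y0 w = z w.
  move=> le_mw le_wM; rewrite /chainD (bigD1_seq w) ?S_mem //= big1 => [|w2 w2w].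
    rewrite addr0 /y0 Delta_point_top // eqxx.
    case: (gword_wt w =P m) => [wm|/eqP]; first by case: (Hb w wm).
    by rewrite eq_sym => mw; rewrite mul0mx z0 // ltn_neqAle mw.
  rewrite /y0; case: (gword_wt w2 =P m) => [w2m|]; last by rewrite mul0mx.
  by rewrite Delta_point_top ?w2m // (negbTE w2w) mulmx0.
pose z' w := z w - chainD y0 w.
have hz' : homog_chain n z'.
  move=> w j; rewrite !mxE; have [->|/hz //] := eqVneq (z w 0 j) 0.
  by rewrite add0r oppr_eq0 => /(chainD_homog hy0).
have z'0 w : (m <= gword_wt w)%N -> z' w = 0.
  move=> le_mw; have [le_wM|lt_Mw] := leqP (gword_wt w) M; first by rewrite /z' Dy0 // subrr.
  apply/rowP => j; rewrite [RHS]mxE; apply/eqP; apply: contraT => /hz' E.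
  by have := leq_trans lt_Mw (leq_addl (dg j) _); rewrite E ltnNge le_nM.
have z'I w : in_ann (z' w 0 i0).
  have [/z'0 ->|lt_wm] := leqP m (gword_wt w).
    exists 0; [by move=> j; rewrite mxE eqxx | by rewrite mul0mx mxE scale0r].
  (* The hypothesis on unit components survives: [y0] has weight [m] and positive degree in [A], so
     its boundary reaches the unit only in weight at least [m]. *)
  rewrite !mxE; suff -> : chainD y0 w 0 i0 = 0 by rewrite subr0.
  apply/eqP; apply: contraT; rewrite summxE => /sum_neq0[w2 _] /mulmx_neq0[l []].
  have [-> |ll] := eqVneq l i0; first by rewrite y0u eqxx.
  rewrite /y0; case: (gword_wt w2 =P m) => [w2m|]; last by rewrite mxE eqxx.
  move=> _ /Delta_point_homog; rewrite dgi0 w2m => E.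
  have : (0 < dg l)%N by rewrite lt0n dg0.
  by move: lt_wm; rewrite E -{2}[m]add0n leq_add2r leqNgt => /negbTE ->.
have Dz' w : chainD z' w = 0.
  rewrite /chainD; under eq_bigr => w2 _ do rewrite mulmxBl.
  by rewrite sumrB -/(chainD z w) -/(chainD (chainD y0) w) Dz chainD2 subr0.
have [y' [hy' y'u Dy']] := IHm z' hz' z'0 z'I Dz'.
exists (fun w => y0 w + y' w); split.
- move=> w j; rewrite mxE; have [->|/hy0 //] := eqVneq (y0 w 0 j) 0.
  by rewrite add0r => /hy'.
- by move=> w; rewrite mxE y0u y'u addr0.
- move=> w le_wM; rewrite /chainD; under eq_bigr => w2 _ do rewrite mulmxDl.
  by rewrite big_split /= -/(chainD y0 w) -/(chainD y' w) Dy' // addrC subrK.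
Qed.

Lemma sum_letter (V : nmodType) (F : 'I_N -> V) :
  \sum_(a : L) F (val a) = \sum_(i | i != i0) F i.
Proof.
rewrite [RHS](reindex_omap (val : L -> _) insub) => [|i ni].
  by apply: eq_bigl => a; rewrite valK eqxx (valP a).
by rewrite insubT.
Qed.

Lemma S_split (V : nmodType) (F : gword -> V) :
  \sum_(w <- S) F w =
  \sum_(g | (dgG g <= M)%N) F ([::], g) +
  \sum_(a : L) \sum_(w <- S | (gword_wt w + (dg (val a)).+1 <= M)%N) F (a :: w.1, w.2).
Proof.
pose r := [seq ([::], g) | g <- enum 'I_J & (dgG g <= M)%N] ++
   [seq (a :: w.1, w.2) | a <- enum {: L}, w <- [seq w <- S | (gword_wt w + (dg (val a)).+1 <=
     M)%N]].
have pr : perm_eq S r.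
  apply: uniq_perm => //.
    rewrite cat_uniq; apply/and3P; split.
    - by rewrite map_inj_uniq => [|g h []//]; apply/filter_uniq/enum_uniq.
    - apply/hasPn => w /allpairsPdep[a [w' [_ _ ->]]].
      by apply/negP => /mapP[g _ ].
    - apply: allpairs_uniq_dep; rewrite ?enum_uniq //.
        by move=> a _; rewrite filter_uniq.
      move=> [a w] [a' w'] _ _ /= [-> ] E1 E2; congr (existT _ _ _).
      by rewrite (surjective_pairing w) E1 E2 -surjective_pairing.
  move=> [u g]; rewrite S_mem mem_cat; apply/idP/orP.
    case: u => [|a u] le_wM; [left|right].
      by apply/mapP; exists g => //; rewrite mem_filter mem_enum andbT; move: le_wM;
        rewrite /gword_wt wt_nil.
    apply/allpairsPdep; exists a, (u, g); split; rewrite ?mem_enum //.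
    rewrite mem_filter S_mem; move: le_wM; rewrite /gword_wt /= wt_cons => le_wM.
    rewrite (leq_trans _ le_wM) ?(leq_trans _ le_wM) //.
      by rewrite -addnA leq_addl.
    by rewrite addnC addnA.
  case=> [/mapP[h]|/allpairsPdep[a [w [_]]]].
    by rewrite mem_filter => /andP[le_hM _] [-> ->]; rewrite /gword_wt wt_nil.
  rewrite mem_filter => /andP[le_wM _] [].
  by move=> Eu Eg; rewrite Eu Eg /gword_wt /= wt_cons -addnA addnC.
rewrite (perm_big _ pr) big_cat big_map big_filter big_enum_cond /=; congr (_ + _).
by rewrite big_allpairs_dep big_enum; apply: eq_bigr => a _; rewrite big_filter.
Qed.

Lemma bd_expand m (f : seq L -> 'I_J -> 'rV[Q]_m) w : w \in S ->
  bdW f w.1 w.2 = \sum_(w' <- S) bar_coef w w' *: f w'.1 w'.2.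
Proof.
rewrite S_mem => le_wM.
rewrite (bd_local hrho hdG hlam (f' := fun v h => \sum_(w' <- S)
   (((v, h) == w')%:R : 'rV[Q]_1) *m f w'.1 w'.2)).
  rewrite bd_sum; apply: eq_bigr => w' _; rewrite bd_mulmxr.
  by rewrite [bdW _ _ _]mx11_scalar mul_scalar_mx.
move=> v h Ev; rewrite (bigD1_seq (v, h)) //=; last by rewrite S_mem (leq_trans _ le_wM) //
  -[gword_wt w]Ev.
rewrite eqxx mul1mx big1 ?addr0 // => w'; rewrite eq_sym => /negbTE ->.
by rewrite mul0mx.
Qed.

Lemma bar_coef_homog w w' : bar_coef w w' != 0 -> gword_wt w = (gword_wt w').+1.
Proof.
apply: contra_neq_eq => ww'; rewrite /bar_coef.
rewrite (bd_local hrho hdG hlam (f' := fun _ _ => 0)) ?bd0 ?mxE // => v h Ev.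
by case: ((v, h) =P w') => // Ew; case/eqP: ww'; rewrite -Ew -[gword_wt w]Ev.
Qed.

Let hdA i j : dA i j != 0 -> dg i = (dg j).+1.
Proof. by rewrite -rho0 => /hrho; rewrite wt_nil addn0. Qed.

(* [bar_coef] is only a differential modulo the annihilator of [H_0(A)], as the
   curvature remains. *)
Lemma bar_square w w'' : (gword_wt w <= M)%N ->
  in_ann (\sum_(w' <- S) bar_coef w w' * bar_coef w' w'').
Proof.
move=> le_wM; pose f v h : 'rV[Q]_1 := ((v, h) == w'')%:R.
have -> : \sum_(w' <- S) bar_coef w w' * bar_coef w' w'' = bdW (bdW f) w.1 w.2 0 0.
  by rewrite bd_expand ?S_mem // summxE; apply: eq_bigr => w' _; rewrite mxE.
rewrite bd2_gword; case: (w.1) => [|a v].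
  by exists 0; [move=> j; rewrite mxE eqxx | rewrite mul0mx mxE scale0r].
have [Ea|/hdA Ea] := eqVneq (dA (val a) i0) 0.
  rewrite Ea scale0r; exists 0; first by move=> j; rewrite mxE eqxx.
  by rewrite mul0mx !mxE oppr0 scale0r.
(* The witness is a multiple of the letter [a], which has degree one and boundary [dA a i0] times
   the unit. *)
exists (- f v w.2 0 0 *: delta_mx 0 (val a)).
  move=> j; rewrite !mxE /=; case: (j =P val a) => [-> _|]; last by rewrite mulr0 eqxx.
  by rewrite Ea dgi0.
rewrite -scalemxAl -rowE.
have -> : row (val a) dA = dA (val a) i0 *: delta_mx 0 i0.
  apply/rowP => j; rewrite !mxE eqxx /=; have [->|ji] := eqVneq j i0; first by rewrite mulr1.
  rewrite mulr0; apply/eqP; apply: contraT => /hdA; rewrite Ea dgi0 => -[/esym/eqP].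
  by rewrite dg0 (negbTE ji).
by rewrite scalerA; congr (_ *: _); rewrite !mxE mulNr mulrC.
Qed.

(* Lift the cycle [x] to [1 (x) x] in [A (x) words]; its boundary is killed by some
   [y'] without component on the unit, and [y'] shifts to a chain on words by
   making the component on the letter [a] a first letter. *)
Theorem bar_exact n (x : gword -> Q) : (0 < n)%N -> (n < M)%N ->
  (forall w, x w != 0 -> gword_wt w = n) ->
  (forall w', in_ann (\sum_(w <- S) x w * bar_coef w w')) ->
  exists2 y : gword -> Q, forall w, y w != 0 -> gword_wt w = n.+1
    & forall w', (gword_wt w' <= M)%N -> \sum_(w <- S) y w * bar_coef w w' = x w'.
Proof.
move=> n0 lt_nM hx xI; pose y0 w : 'rV[Q]_N := x w *: delta_mx 0 i0.
have y0E m (X : gword -> 'M[Q]_(N, m)) :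
    \sum_(w <- S) y0 w *m X w = \sum_(w <- S) x w *: row i0 (X w).
  by apply: eq_bigr => w _; rewrite -scalemxAl -rowE.
have hy0 : homog_chain n y0.
  move=> w j; rewrite !mxE /=; case: (j =P i0) => [->|]; last by rewrite mulr0 eqxx.
  by rewrite mulr1 dgi0 => /hx.
have le_nM : (n.-1 <= M)%N by apply: leq_trans (leq_pred _) (ltnW lt_nM).
have hz : homog_chain n.-1 (chainD y0) by apply: chainD_homog; rewrite prednK.
have [|||y' [hy' y'u Dy']] := @chain_acyclic M.+1 n.-1 (chainD y0) le_nM hz.
- move=> w lt_Mw; apply/rowP => j; rewrite [RHS]mxE; apply/eqP; apply: contraT => /hz E.
  by have := leq_trans lt_Mw (leq_addl (dg j) _); rewrite E ltnNge le_nM.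
(* By [row_Delta] the unit component of the boundary of [1 (x) x] is the boundary of [x], to which
   [xI] applies. *)
- move=> w'; rewrite [chainD _ _](y0E _ (fun w => DeltaW (point N w') w.1 w.2)).
  suff -> : (\sum_(w <- S) x w *: row i0 (DeltaW (point N w') w.1 w.2)) 0 i0 =
     \sum_(w <- S) x w * bar_coef w w' by apply: xI.
  rewrite summxE; apply: eq_bigr => w _; rewrite mxE row_Delta mxE; congr (_ * _).
  have -> : (if w.1 is a :: v then row (val a) (point N w' v w.2) else 0) 0 i0 = 0.
    case: (w.1) => [|a v]; rewrite ?mxE // /point; case: eqP => _; rewrite mxE //.
    by rewrite (negbTE (valP a)).
  rewrite add0r.
  rewrite (@eq_bd _ _ _ _ _ _ _ _ _ _ (fun v h => (((v, h) == w')%:R : 'rV[Q]_1) *m delta_mx 0 i0)).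
    by rewrite bd_mulmxr [bdW _ _ _]mx11_scalar mul_scalar_mx !mxE !eqxx mulr1.
  move=> v h; rewrite /point; case: eqP => _; last by rewrite mul0mx linear0.
  by rewrite mul1mx rowE mulmx1.
- exact: chainD2.
rewrite prednK // in hy'.
pose xG : 'rV[Q]_J := \row_g x ([::], g).
(* The defect on words without letters. It is a cycle of [G] in degree [n > 0], hence a boundary. *)
pose v : 'rV[Q]_J := \sum_(w <- S) y' w *m lam w.1 w.2 - xG.
have hv : homog_rV dgG n v.
  apply: homog_rVD; last first.
    by apply: homog_rVN => j; rewrite mxE => /hx; rewrite /gword_wt wt_nil.
  move=> j; rewrite summxE => /sum_neq0[w _] /mulmx_neq0[l [/hy' <- /hlam ->]].
  by rewrite addnA.
have lamD u g : DeltaW lam u g = - (lam u g *m dG).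
  by apply/eqP; rewrite -addr_eq0; apply/eqP; apply: lam_mc.
have xGE : \sum_(w <- S) x w *: row i0 (lam w.1 w.2) = xG.
  rewrite S_split /= [X in _ + X]big1 ?addr0 => [|a _]; last first.
    by rewrite big1 // => w _; rewrite lam_unit scaler0.
  rewrite [RHS]row_sum_delta big_mkcond /=; apply: eq_bigr => g _; rewrite lam_unit mxE.
  case: leqP => // lt_Mg; have [->|/hx] := eqVneq (x ([::], g)) 0; first by rewrite scale0r.
  by rewrite /gword_wt wt_nil add0n => Eg; move: lt_Mg; rewrite Eg ltnNge ltnW.
have vdG : v *m dG = 0.
  rewrite mulmxBl mulmx_suml.
  have -> : \sum_(w <- S) y' w *m lam w.1 w.2 *m dG =
     - \sum_(w <- S) y' w *m DeltaW lam w.1 w.2.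
    by rewrite -sumrN; apply: eq_bigr => w _; rewrite lamD mulmxN opprK mulmxA.
  rewrite -chainD_pair (eq_big_seq (fun w => chainD y0 w *m lam w.1 w.2)); last first.
    by move=> w; rewrite S_mem => /Dy' ->.
  rewrite chainD_pair (y0E _ (fun w => DeltaW lam w.1 w.2)) -sumrN.
  apply/eqP; rewrite subr_eq0; apply/eqP.
  rewrite -xGE mulmx_suml; apply: eq_bigr => w _.
  by rewrite lamD linearN /= scalerN opprK row_mul scalemxAl.
have [wG hwG EwG] := exG n0 hv vdG.
(* The sign is that of [bd_pack]. *)
pose y (w : gword) := if w.1 is a :: u then - y' (u, w.2) 0 (val a) else wG 0 w.2.
exists y; first move=> [[|a u] g]; rewrite /y /=.
  by move=> /hwG; rewrite /gword_wt wt_nil.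
  by rewrite oppr_eq0 => /hy' <-; rewrite /gword_wt /= wt_cons !addSn addnA.
move=> w' le_w'M; pose f (v : seq L) (h : 'I_J) : 'rV[Q]_1 := ((v, h) == w')%:R.
rewrite -/y.
suff E : \sum_(w <- S) y w *: bdW f w.1 w.2 = \sum_(w <- S) x w *: f w.1 w.2.
  transitivity ((\sum_(w <- S) y w *: bdW f w.1 w.2) 0 0).
    by rewrite summxE; apply: eq_bigr => w _; rewrite mxE.
  rewrite E (bigD1_seq w') ?S_mem //= big1 ?addr0 => [|w /negbTE ww'].
    by rewrite /f -surjective_pairing eqxx !mxE mulr1.
  by rewrite /f -surjective_pairing ww' scaler0.
have -> : \sum_(w <- S) y w *: bdW f w.1 w.2 =
    - (wG *m dG *m ends f) + \sum_(w <- S) y' w *m packD dg rho dG lam f w.1 w.2.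
  rewrite S_split /y /=; congr (_ + _).
    rewrite -mulmxA mulmx_sum_row -sumrN big_mkcond /=; apply: eq_bigr => g _.
    rewrite row_mul mulmx_sum_row scalerN.
    have -> : \sum_h (row g dG) 0 h *: row h (ends f) = \sum_h dG g h *: f [::] h.
      by apply: eq_bigr => h _; rewrite rowK mxE.
    case: leqP => // lt_Mg; have [->|/hwG Eg] := eqVneq (wG 0 g) 0; first by rewrite scale0r oppr0.
    by move: lt_Mg; rewrite Eg ltnNge lt_nM.
  transitivity (\sum_(a : L) \sum_(w <- S) y' w 0 (val a) *: row (val a) (packD dg rho dG lam f
    w.1 w.2)).
    apply: eq_bigr => a _; rewrite big_mkcond /=; apply: eq_bigr => w _.
    rewrite -[LHS]/(if (gword_wt w + (dg (val a)).+1 <= M)%N then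
       - y' (w.1, w.2) 0 (val a) *: bdW f (a :: w.1) w.2 else 0).
    rewrite bd_pack -surjective_pairing scalerN scaleNr opprK.
    case: leqP => // lt_M; have [->|/hy' Eg] := eqVneq (y' w 0 (val a)) 0; first by rewrite scale0r.
    by move: lt_M; rewrite addnS addnC Eg ltnNge lt_nM.
  rewrite exchange_big; apply: eq_bigr => w _ /=; rewrite mulmx_sum_row [RHS](bigD1 i0) //=.
  rewrite y'u scale0r add0r.
  exact: (sum_letter (fun i => y' w 0 i *: row i (packD dg rho dG lam f w.1 w.2))).
rewrite /packD; under eq_bigr => w _ do rewrite mulmxDr mulmxA.
rewrite big_split /= -mulmx_suml addrCA [- _ + _]addrC -mulmxBl.
have -> : \sum_(w <- S) y' w *m lam w.1 w.2 - wG *m dG = xG.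
  by rewrite EwG opprB addrC subrK.
rewrite -(chainD_pair (pack f)) (eq_big_seq (fun w => chainD y0 w *m pack f w.1 w.2)); last first.
  by move=> w; rewrite S_mem => /Dy' ->.
rewrite chainD_pair (y0E _ (fun w => DeltaW (pack f) w.1 w.2)) -xGE mulmx_suml -big_split.
(* [packD_unit] turns the unit component back into [f]. *)
apply: eq_bigr => w _ /=; rewrite -scalemxAl -scalerDr; congr (_ *: _).
rewrite -row_mul; have := packD_unit dg rho_unit dG kap_unit f w.1 w.2.
rewrite /packD linearD /= => ->.
by case: (w.1) => [|a v0]; rewrite ?scale1r.
Qed.
End Exactness.

(** * Tor and free resolutions *)

Section LinearImage.
Variables (S : comNzRingType) (A B : lmodType S) (g : {linear A -> B}).

Definition image_pred : {pred B} := fun y => `[< exists x, g x = y >].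

Fact image_pred_submod : submod_closed image_pred.
Proof.
split; first by apply/asboolP; exists 0; rewrite linear0.
move=> a y z /asboolP[x <-] /asboolP[w <-]; apply/asboolP.
by exists (a *: x + w); rewrite linearP.
Qed.

HB.instance Definition _ := GRing.isSubmodClosed.Build S B image_pred image_pred_submod.

Record linear_image := LinearImage { image_val : B; _ : image_val \in image_pred }.
HB.instance Definition _ := [isSub for image_val].
HB.instance Definition _ := [Choice of linear_image by <:].
HB.instance Definition _ := [SubChoice_isSubLmodule of linear_image by <:].

End LinearImage.

Definition mk_linear (S : pzRingType) (A B : lmodType S) (f : A -> B) (fP : linear f) :
  {linear A -> B} := HB.pack f (GRing.isLinear.Build S A B *:%R f fP).

(** [projective] lifts along surjections only, so [g] is corestricted to its image. *)
Lemma projective_lift (S : comNzRingType) (P A B : lmodType S) (g : {linear A -> B})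
    (f : {linear P -> B}) :
  projective P -> (forall x, exists a, g a = f x) ->
  exists h : {linear P -> A}, forall x, g (h x) = f x.
Proof.
move=> projP gf.
have gP a : g a \in image_pred g by apply/asboolP; exists a.
have fP x : f x \in image_pred g by apply/asboolP.
have g'P : linear (fun a => LinearImage (gP a)).
  by move=> c x y; apply: val_inj; rewrite /= linearP.
have f'P : linear (fun x => LinearImage (fP x)).
  by move=> c x y; apply: val_inj; rewrite /= linearP.
have [|h hE] := projP A (linear_image g) (mk_linear g'P) (mk_linear f'P).
  move=> [y yP]; have /asboolP[a ga] := yP; exists a.
  by apply: val_inj; rewrite /= ga.
by exists h => x; have := congr1 val (hE x).
Qed.

Lemma dependent_choice_nat (T : nat -> Type) (P : forall n, T n -> Prop)
    (E : forall n, T n -> T n.+1 -> Prop) :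
  (exists x, P 0%N x) -> (forall n x, P n x -> exists y, P n.+1 y /\ E n x y) ->
  exists f : forall n, T n, (forall n, P n (f n)) /\ forall n, E n (f n) (f n.+1).
Proof.
move=> P0 PS; pose U n := {x : T n | P n x}.
pose next n (x : U n) : U n.+1 :=
  let y := cid (PS n (sval x) (svalP x)) in exist _ (sval y) (proj1 (svalP y)).
pose g := fix g n : U n := if n is m.+1 then next m (g m) else cid P0.
exists (fun n => sval (g n)); split=> n; first exact: (svalP (g n)).
by rewrite /= /next /=; case: (cid _) => y [].
Qed.

Section Comparison.
Variables (S : comNzRingType) (M : lmodType S).

Definition lifting (F F' : resolution M) (al : forall i, {linear F i -> F' i}) : Prop :=
  (forall x, res_aug F' (al 0%N x) = res_aug F x) /\
  (forall i x, res_d F' i (al i.+1 x) = al i (res_d F i x)).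

Lemma res_dd (F : resolution M) i x : res_d F i (res_d F i.+1 x) = 0.
Proof. by apply/res_exact; exists x. Qed.

Lemma res_aug_d (F : resolution M) x : res_aug F (res_d F 0 x) = 0.
Proof. by apply/res_aug_exact; exists x. Qed.

Lemma comparison (F F' : resolution M) : exists al, lifting (F := F) (F' := F') al.
Proof.
(* The invariant states that the next component can be lifted; compatibility with the augmentations
   is attached to degree 0. *)
pose P i (al : {linear F i -> F' i}) := (forall y, exists y', res_d F' i y' = al (res_d F i y)) /\
  (if i is 0 return {linear F i -> F' i} -> Prop
   then fun al => forall x, res_aug F' (al x) = res_aug F x else fun=> True) al.
pose E i (al : {linear F i -> F' i}) (al' : {linear F i.+1 -> F' i.+1}) :=
  forall x, res_d F' i (al' x) = al (res_d F i x).
have [||al [alP alE]] := @dependent_choice_nat _ P E.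
- have [al Eal] := projective_lift (@res_proj _ _ F 0) (f := res_aug F)
    (fun x => @res_aug_surj _ _ F' (res_aug F x)).
  exists al; split=> // y; apply/res_aug_exact.
  by rewrite Eal res_aug_d.
- move=> i al [alP _].
  have [|al' Eal'] := @projective_lift _ (F i.+1) _ _ (res_d F' i) (al \o res_d F i) (@res_proj _
    _ F i.+1).
    exact: alP.
  exists al'; split; last exact: Eal'.
  split=> // y; apply/res_exact; rewrite Eal' /=.
  by rewrite res_dd linear0.
by exists al; split; [case: (alP 0%N) | exact: alE].
Qed.

Lemma lifting_homotopy (F F' : resolution M) al al' :
  lifting (F := F) (F' := F') al -> lifting (F := F) (F' := F') al' ->
  exists h : forall i, {linear F i -> F' i.+1},
    (forall x, al 0%N x - al' 0%N x = res_d F' 0 (h 0%N x)) /\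
    (forall i x, al i.+1 x - al' i.+1 x = res_d F' i.+1 (h i.+1 x) + h i (res_d F i x)).
Proof.
move=> [al0 alS] [al'0 al'S].
pose P i (h : {linear F i -> F' i.+1}) :=
  (forall x, exists y, res_d F' i.+1 y = al i.+1 x - al' i.+1 x - h (res_d F i x)) /\
  (if i is 0 return {linear F i -> F' i.+1} -> Prop
   then fun h => forall x, al 0%N x - al' 0%N x = res_d F' 0 (h x) else fun=> True) h.
pose E i (h : {linear F i -> F' i.+1}) (h' : {linear F i.+1 -> F' i.+2}) :=
  forall x, al i.+1 x - al' i.+1 x = res_d F' i.+1 (h' x) + h (res_d F i x).
have [||h [hP hE]] := @dependent_choice_nat _ P E.
- have [|h hE] := @projective_lift _ (F 0%N) _ _ (res_d F' 0) (al 0%N \- al' 0%N) (@res_proj _ _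
  F 0).
    by move=> x; apply/res_aug_exact; rewrite linearB /= al0 al'0 subrr.
  exists h; split=> // x; apply/res_exact.
  by rewrite !linearB /= hE /= alS al'S subrr.
- move=> i h [hP _].
  have [|h' hE] := @projective_lift _ (F i.+1) _ _ (res_d F' i.+1)
     (al i.+1 \- al' i.+1 \- (h \o res_d F i)) (@res_proj _ _ F i.+1).
    exact: hP.
  exists h'; split; last by move=> x; rewrite hE /= subrK.
  split=> // x; apply/res_exact.
  by rewrite !linearB /= hE /= alS al'S res_dd linear0 subr0 subrr.
by exists h; split; [case: (hP 0%N) | exact: hE].
Qed.

Lemma lifting_id (F : resolution M) : lifting (F := F) (F' := F) (fun i => idfun).
Proof. by []. Qed.

Lemma lifting_comp (F F' F'' : resolution M) al be :
  lifting (F := F) (F' := F') al -> lifting (F := F') (F' := F'') be ->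
  lifting (F := F) (F' := F'') (fun i => be i \o al i).
Proof.
move=> [al0 alS] [be0 beS]; split=> [x|i x] /=; first by rewrite be0 al0.
by rewrite beS alS.
Qed.
End Comparison.

Section TensorTransport.
Variables (S : comNzRingType) (k : fieldType) (pi : {rmorphism S -> k}).

Definition mk_semilinear (P : lmodType S) (V : lmodType k) (f : P -> V)
  (fP : linear_for (pi \; *:%R) f) : {linear P -> V | pi \; *:%R} :=
  HB.pack f (GRing.isLinear.Build S P V (pi \; *:%R) f fP).

Lemma tensor_ext (P : lmodType S) (V W : lmodType k) (u : {linear P -> V | pi \; *:%R})
    (g g' : {linear V -> W}) :
  is_tensor u -> (forall x, g (u x) = g' (u x)) -> g =1 g'.
Proof.
move=> tu gg'.
have guP : linear_for (pi \; *:%R) (g \o u) by move=> a x y; rewrite /= !linearP.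
have [_ uniq_g] := tu W (mk_semilinear guP).
by apply: uniq_g => x //=; rewrite gg'.
Qed.

Lemma tensor_map (P P' : lmodType S) (V V' : lmodType k) (u : {linear P -> V | pi \; *:%R})
    (u' : {linear P' -> V' | pi \; *:%R}) (f : {linear P -> P'}) :
  is_tensor u -> exists g : {linear V -> V'}, forall x, g (u x) = u' (f x).
Proof.
move=> tu.
have fuP : linear_for (pi \; *:%R) (u' \o f) by move=> a x y; rewrite /= !linearP.
by have [] := tu V' (mk_semilinear fuP).
Qed.

Variable M : lmodType S.

Record tensored (F : resolution M) := Tensored {
  ten_mod :> nat -> lmodType k;
  ten_map : forall i, {linear F i -> ten_mod i | pi \; *:%R};
  ten_d : forall i, {linear ten_mod i.+1 -> ten_mod i};
  ten_tensor : forall i, is_tensor (ten_map i);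
  ten_comm : forall i x, ten_d i (ten_map i.+1 x) = ten_map i (res_d F i x) }.

Lemma tor_dimP n b : tor_dim pi M n b <->
  exists (F : resolution M) (V : tensored F), homology_dim (ten_d V) n b.
Proof.
split=> [[F [V [u [D [tu Du hD]]]]]|[F [V hV]]].
  by exists F, (Tensored tu Du).
by exists F, V, (ten_map V), (ten_d V); split=> //; [exact: ten_tensor | exact: ten_comm].
Qed.

Lemma choice_dep (I : Type) (T : I -> Type) (P : forall i, T i -> Prop) :
  (forall i, exists x, P i x) -> exists f : forall i, T i, forall i, P i (f i).
Proof. by move=> H; exists (fun i => sval (cid (H i))) => i; case: (cid _). Qed.

Lemma tensored_lifting (F F' : resolution M) (V : tensored F) (V' : tensored F') 
    (al : forall i, {linear F i -> F' i}) :
  lifting al ->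
  exists be : forall i, {linear V i -> V' i},
    (forall i (x : F i), be i (ten_map V i x) = ten_map V' i (al i x)) /\
    (forall i (x : V i.+1), ten_d V' i (be i.+1 x) = be i (ten_d V i x)).
Proof.
move=> [_ alS].
have /choice_dep[be beE] : forall i, exists be : {linear V i -> V' i},
    forall x, be (ten_map V i x) = ten_map V' i (al i x).
  by move=> i; apply: tensor_map; apply: ten_tensor.
exists be; split=> // i w.
apply: (tensor_ext (g := ten_d V' i \o be i.+1) (g' := be i \o ten_d V i)
  (@ten_tensor F V i.+1) _ w) => x; rewrite /= beE ten_comm alS ten_comm beE.
by [].
Qed.

Lemma tensored_homotopy (F F' : resolution M) (V : tensored F) (V' : tensored F')
    (al al' : forall i, {linear F i -> F' i}) (be be' : forall i, {linear V i -> V' i}) n x :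
  lifting al -> lifting al' ->
  (forall i (x : F i), be i (ten_map V i x) = ten_map V' i (al i x)) ->
  (forall i (x : F i), be' i (ten_map V i x) = ten_map V' i (al' i x)) ->
  cycle_at (ten_d V) (n := n) x -> exists y, be n x = be' n x + ten_d V' n y.
Proof.
move=> Lal Lal' beE be'E cx.
have [h [h0 hS]] := lifting_homotopy Lal Lal'.
have /choice_dep[th thE] : forall i, exists th : {linear V i -> V' i.+1},
    forall x, th (ten_map V i x) = ten_map V' i.+1 (h i x).
  by move=> i; apply: tensor_map; apply: ten_tensor.
case: n x cx => [|n] x cx.
  exists (th 0%N x).
  apply: (tensor_ext (g := be 0%N) (g' := be' 0%N \+ (ten_d V' 0 \o th 0%N))
    (@ten_tensor F V 0%N) _ x) => y; rewrite /= beE be'E thE ten_comm -linearD -h0 addrC subrK.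
  by [].
exists (th n.+1 x); rewrite -[RHS]addr0 -[X in _ = _ + X](linear0 (th n)) -[X in th n X]cx.
apply: (tensor_ext (g := be n.+1)
  (g' := (be' n.+1 \+ (ten_d V' n.+1 \o th n.+1)) \+ (th n \o ten_d V n))
  (@ten_tensor F V n.+1) _ x) => y; rewrite /= beE be'E thE !ten_comm thE -!linearD -addrA -hS
    addrC subrK.
by [].
Qed.

(** The chain maps between two resolutions are inverse up to homotopy, also after tensoring: [sect]
    transports the existence of the coefficients, [retr] their uniqueness. *)
Lemma homology_transport n b (F F' : resolution M) (V : tensored F) (V' : tensored F') :
  homology_dim (ten_d V) n b -> homology_dim (ten_d V') n b.
Proof.
have [al Lal] := comparison F F'; have [al' Lal'] := comparison F' F.
have [be [beE beS]] := tensored_lifting V V' Lal.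
have [be' [be'E be'S]] := tensored_lifting V' V Lal'.
have cyc (G G' : resolution M) (W : tensored G) (W' : tensored G')
   (ga : forall i, {linear W i -> W' i}) m x :
   (forall i (x : W i.+1), ten_d W' i (ga i.+1 x) = ga i (ten_d W i x)) ->
   cycle_at (ten_d W) (n := m) x -> cycle_at (ten_d W') (n := m) (ga m x).
  by case: m x => // m x gaS /= cx; rewrite gaS cx linear0.
have retr x : cycle_at (ten_d V) (n := n) x -> exists y, be' n (be n x) = x + ten_d V n y.
  apply: (tensored_homotopy (V' := V) (be := fun i => be' i \o be i) (be' := fun i => idfun)
     (lifting_comp Lal Lal') (lifting_id F)) => // i y /=.
  by rewrite beE be'E.
have sect x : cycle_at (ten_d V') (n := n) x -> exists y, x = be n (be' n x) + ten_d V' n y.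
  apply: (tensored_homotopy (V' := V') (be' := fun i => be i \o be' i) (be := fun i => idfun)
     (lifting_id F') (lifting_comp Lal' Lal)) => // i y /=.
  by rewrite be'E beE.
move=> [z [zc zP]]; exists (fun i => be n (z i)); split=> [i|x cx]; first exact: cyc.
have [a [[y Ey] a_uniq]] := zP _ (cyc _ _ _ _ be' _ _ be'S cx).
have [y' Ey'] := sect _ cx.
exists a; split.
  exists (be n.+1 y + y'); rewrite {1}Ey' {1}Ey linearD linear_sum linearD beS addrA.
  by congr (_ + _ + _); apply: eq_bigr => i _; rewrite linearZ.
move=> a' [w Ew].
have [a'' [_ a''_uniq]] := zP _ (cyc _ _ _ _ be' _ _ be'S cx).
rewrite -(a''_uniq a); last by exists y.
apply: a''_uniq.
have /choice[t tE] : forall i : 'I_b, exists t, be' n (be n (z i)) = z i + ten_d V n t.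
  by move=> i; apply: retr.
exists (\sum_i a' ord0 i *: t i + be' n.+1 w).
rewrite Ew linearD linear_sum linearD linear_sum be'S addrA; congr (_ + _).
by rewrite -big_split; apply: eq_bigr => i _ /=; rewrite !linearZ /= tE scalerDr.
Qed.

Lemma tor_dim_homology n b (F : resolution M) (V : tensored F) :
  tor_dim pi M n b -> homology_dim (ten_d V) n b.
Proof. by move=> /tor_dimP[F' [V' hV']]; apply: homology_transport hV'. Qed.

(** Two bases express each other, and uniqueness of coefficients makes the product of the transition
    matrices the identity. *)
Lemma homology_dim_uniq (V : nat -> lmodType k) (D : forall i, {linear V i.+1 -> V i}) n b b' :
  homology_dim D n b -> homology_dim D n b' -> b = b'.
Proof.
have le c c' : homology_dim D n c -> homology_dim D n c' -> (c <= c')%N.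
  move=> [z [zc zP]] [z' [z'c z'P]].
  have /choice[A AE] : forall i, exists a : 'rV[k]_c', exists y,
      z i = \sum_j a ord0 j *: z' j + D n y.
    by move=> i; have [a [Ha _]] := z'P _ (zc i); exists a.
  have /choice[B BE] : forall i, exists a : 'rV[k]_c, exists y,
      z' i = \sum_j a ord0 j *: z j + D n y.
    by move=> i; have [a [Ha _]] := zP _ (z'c i); exists a.
  apply: (@mulmx1_min _ _ _ (\matrix_i A i) (\matrix_i B i)).
  apply/row_matrixP => i; rewrite row_mul rowK row1.
  have [a [_ a_uniq]] := zP _ (zc i); rewrite -(a_uniq (delta_mx 0 i)); last first.
    exists 0; rewrite linear0 addr0 (bigD1 i) //= mxE !eqxx scale1r big1 ?addr0 // => j.
    by rewrite mxE => /negbTE ->; rewrite andbF scale0r.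
  symmetry; apply: a_uniq; have [y ->] := AE i.
  have /choice[w wE] := BE.
  exists (\sum_j A i ord0 j *: w j + y); rewrite linearD linear_sum addrA; congr (_ + _).
  under eq_bigr => j _ do rewrite wE scalerDr scaler_sumr.
  rewrite big_split /=; congr (_ + _); last by apply: eq_bigr => j _; rewrite linearZ.
  rewrite exchange_big; apply: eq_bigr => j _ /=; rewrite mulmx_sum_row summxE scaler_suml.
  by apply: eq_bigr => l _; rewrite rowK mxE scalerA.
by move=> hb hb'; apply/eqP; rewrite eqn_leq !le.
Qed.

(** [betti] selects a value of [tor_dim]; there is at most one, so any resolution computes it. *)
Lemma bettiE n b (F : resolution M) (V : tensored F) :
  homology_dim (ten_d V) n b -> betti pi M n = b.
Proof.
move=> hb; rewrite /betti; apply: xget_unique.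
  by apply/tor_dimP; exists F, V.
by move=> b' /= /(tor_dim_homology V) hb'; apply: homology_dim_uniq hb' hb.
Qed.

End TensorTransport.

Lemma linear_rowE (S : pzRingType) (B : lmodType S) b (f : {linear 'rV[S]_b -> B}) x :
  f x = \sum_i x 0 i *: f (delta_mx 0 i).
Proof.
rewrite {1}[x]row_sum_delta linear_sum; apply: eq_bigr => i _; exact: linearZZ.
Qed.

Lemma row_comb_linear (S : pzRingType) (B : lmodType S) b (a : 'I_b -> B) :
  linear (fun x : 'rV[S]_b => \sum_i x 0 i *: a i).
Proof.
move=> c x y; rewrite scaler_sumr -big_split; apply: eq_bigr => i _.
by rewrite !mxE scalerDl scalerA.
Qed.

Definition row_comb (S : pzRingType) (B : lmodType S) b (a : 'I_b -> B) :
  {linear 'rV[S]_b -> B} := mk_linear (row_comb_linear a).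

Lemma free_projective (S : comNzRingType) b : projective ('rV[S]_b).
Proof.
move=> A B g f g_surj; have [a aE] := choice (fun i => g_surj (f (delta_mx 0 i))).
exists (row_comb a) => x; rewrite (linear_rowE f) /= linear_sum.
by apply: eq_bigr => i _; rewrite linearZZ aE.
Qed.

Section Tensor.
Variables (S : comNzRingType) (k : fieldType) (pi : {rmorphism S -> k}).
Hypothesis pi_surj : forall y, exists x, pi x = y.

Lemma map_mx_semilinear m n : linear_for (pi \; *:%R) (map_mx pi : 'M[S]_(m, n) -> 'M[k]_(m, n)).
Proof. by move=> a x y; rewrite /= map_mxD map_mxZ. Qed.

Definition red_row b : {linear 'rV[S]_b -> 'rV[k]_b | pi \; *:%R} :=
  mk_semilinear (@map_mx_semilinear 1 b).

Lemma map_mx_surj m n (Y : 'M[k]_(m, n)) : exists X, map_mx pi X = Y.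
Proof.
have [s sE] := choice pi_surj; exists (map_mx s Y).
by apply/matrixP => i j; rewrite !mxE sE.
Qed.

Lemma free_tensor b : is_tensor (red_row b).
Proof.
move=> W f; split.
  exists (row_comb (fun i => f (delta_mx 0 i))) => x /=.
  rewrite {2}[x]row_sum_delta linear_sum; apply: eq_bigr => i _.
  by rewrite linearZ_LR mxE.
by move=> g g' gE g'E y; have [x <-] := map_mx_surj y; rewrite (gE x) (g'E x).
Qed.
End Tensor.

(** * Betti numbers of resolutions given by matrices *)

Section MatrixResolution.
Variables (S : comNzRingType) (M : lmodType S) (b : nat -> nat).
Variable d : forall i, 'M[S]_(b i.+1, b i).
Variable aug : {linear 'rV[S]_(b 0) -> M}.
Hypothesis aug_surj : forall y, exists x, aug x = y.
Hypothesis aug_ex : forall x, aug x = 0 <-> exists y, y *m d 0 = x.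
Hypothesis d_ex : forall n (x : 'rV_(b n.+1)), x *m d n = 0 <-> exists y, y *m d n.+1 = x.

Definition mx_resolution : resolution M :=
  @Resolution S M (fun i => 'rV[S]_(b i)) (fun i => @free_projective S (b i))
    (fun i => mulmxr (d i)) aug aug_surj aug_ex d_ex.

Variables (k : fieldType) (pi : {rmorphism S -> k}).
Hypothesis pi_surj : forall y, exists x, pi x = y.

Definition mx_red i := map_mx pi (d i).

Fact mx_tensored_comm i (x : 'rV[S]_(b i.+1)) :
  mulmxr (mx_red i) (red_row pi (b i.+1) x) = red_row pi (b i) (mulmxr (d i) x).
Proof. by rewrite /= map_mxM. Qed.

Definition mx_tensored : tensored pi mx_resolution :=
  @Tensored S k pi M mx_resolution (fun i => 'rV[k]_(b i)) (fun i => red_row pi (b i))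
    (fun i => mulmxr (mx_red i)) (fun i => @free_tensor S k pi pi_surj (b i)) mx_tensored_comm.

Lemma mx_minimal_betti n :
  (forall i, (n <= i.+1)%N -> (i <= n)%N -> mx_red i = 0) -> betti pi M n = b n.
Proof.
move=> red0; apply: (bettiE (V := mx_tensored)).
exists (fun i => delta_mx 0 i); split=> [i|x _].
  case: n i red0 => [|n] i red0 //=.
  by rewrite red0 ?leqnSn ?mulmx0.
exists x; split.
  by exists 0; rewrite /= mul0mx addr0 -row_sum_delta.
by move=> a [y]; rewrite /= red0 // mulmx0 addr0 -row_sum_delta => ->.
Qed.

(** A homology of the full dimension [b n] leaves no room for boundaries, nor for vectors that are
    not cycles. *)
Lemma mx_betti_minimal n : betti pi M n = b n ->
  mx_red n = 0 /\ (forall i, n = i.+1 -> mx_red i = 0).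
Proof.
(* For [b n = 0] the matrices are empty. Otherwise [betti] is nonzero, hence not the default value,
   and [tor_dim] holds for it. *)
move=> bn; have [b0|b_neq0] := eqVneq (b n) 0%N.
  split=> [|i Ei].
    by apply/matrixP => x y; exfalso; move: y; rewrite b0 => -[].
  by apply/matrixP => x; exfalso; move: x; rewrite -Ei b0 => -[].
have : tor_dim pi M n (b n).
  have : betti pi M n != 0%N by rewrite bn.
  by rewrite -bn /betti; case: xgetP => [x -> //|_]; rewrite eqxx.
move/(tor_dim_homology mx_tensored) => [z [zc zP]].
have zmx (a : 'rV[k]_(b n)) : \sum_i a ord0 i *: z i = a *m \matrix_i z i.
  by rewrite mulmx_sum_row; apply: eq_bigr => i _; rewrite rowK.
pose Z : 'M[k]_(b n) := \matrix_i z i.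
have Zinj (a : 'rV[k]_(b n)) y : a *m Z = y *m mx_red n -> a = 0.
  move=> E; have c0 : cycle_at (ten_d mx_tensored) (n := n) (0 : 'rV[k]_(b n)).
    by case: (n) => //= i; rewrite mul0mx.
  have [a0 [_ a0_uniq]] := zP _ c0.
  rewrite -(a0_uniq a); last by exists (- y); rewrite /= zmx -/Z E mulNmx subrr.
  by apply: a0_uniq; exists 0; rewrite /= zmx mul0mx add0r mul0mx.
have Zunit : Z \in unitmx.
  rewrite -row_free_unit -kermx_eq0; apply/eqP/row_matrixP => i; rewrite row0.
  by apply: (@Zinj _ 0); rewrite mul0mx -row_mul mulmx_ker row0.
split=> [|i Ei].
  apply/row_matrixP => i; rewrite row0; have := @Zinj (row i (mx_red n) *m invmx Z) (delta_mx 0 i).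
  by rewrite mulmxKV // -rowE => /(_ erefl) E; rewrite -[LHS](mulmxKV Zunit) E mul0mx.
subst n; have cyc (a : 'rV[k]_(b i.+1)) : a *m mx_red i = 0.
  rewrite -(mulmxKV Zunit a) -[_ *m Z]zmx mulmx_suml big1 // => j _.
  by rewrite -scalemxAl [z j *m _](zc j) scaler0.
by apply/row_matrixP => j; rewrite row0 rowE cyc.
Qed.
End MatrixResolution.

(** * Minimal resolutions over a local ring *)

Section Local.
Local Open Scope classical_set_scope.
Variables (Q : comNzRingType) (n : set Q) (k : fieldType) (pi : {rmorphism Q -> k}).
Hypothesis locQ : local_ring n.
Hypothesis resQ : residue_map n pi.

(** [local_ring] provides the uniqueness of a maximal ideal; one that contains [I] comes from Zorn's
    lemma. *)
Lemma proper_ideal_max (I : set Q) : is_ideal I -> ~ I 1 -> I `<=` n.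
Proof.
move=> idI I1.
pose T := {K : set Q | [/\ is_ideal K, I `<=` K & ~ K 1]}.
pose R (K K' : T) := `[< sval K `<=` sval K' >].
have [||||[K [idK IK K1]] Kmax] := @Zorn T R.
- by move=> K; apply/asboolP.
- by move=> K K' K'' /asboolP KK' /asboolP K'K''; apply/asboolP; apply: subset_trans KK' K'K''.
- move=> [K KP] [K' K'P] /asboolP KK' /asboolP K'K; apply: eq_exist.
  by apply/seteqP; split.
- move=> A Atot; have [[K0 AK0]|A0] := pselect (exists K, A K); last first.
    have IP : [/\ is_ideal I, I `<=` I & ~ I 1] by split.
    by exists (exist _ I IP) => K AK; case: A0; exists K.
  pose U : set Q := fun x => exists2 K, A K & sval K x.
  have UP : [/\ is_ideal U, I `<=` U & ~ U 1].
    split.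
    - split.
      + by exists K0 => //; case: (svalP K0) => -[].
      + move=> x y [K AK Kx] [K' AK' K'y].
        have [/asboolP KK'|/asboolP K'K] := Atot _ _ AK AK'.
          by exists K' => //; case: (svalP K') => -[_ D _] _ _; apply: D => //; apply: KK'.
        by exists K => //; case: (svalP K) => -[_ D _] _ _; apply: D => //; apply: K'K.
      + move=> a x [K AK Kx]; exists K => //.
        by case: (svalP K) => -[_ _ Z] _ _; apply: Z.
    - by move=> x Ix; exists K0 => //; case: (svalP K0) => _ IK0 _; apply: IK0.
    - by case=> K AK K1; case: (svalP K).
  by exists (exist _ U UP) => K AK; apply/asboolP => x Kx; exists K.
have maxK : maximal_ideal K.
  split=> // J idJ KJ J1.
  have JP : [/\ is_ideal J, I `<=` J & ~ J 1] by split=> //; apply: subset_trans KJ.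
  by have /(congr1 sval) := Kmax (exist _ J JP) (introT (asboolP _) KJ).
by case: locQ => _ /(_ K maxK) <-.
Qed.

Lemma local_unit x : pi x != 0 -> exists y, y * x = 1.
Proof.
move=> pix; apply: contrapT => nx.
have idI : is_ideal (fun z => exists y, y * x = z).
  split; first by exists 0; rewrite mul0r.
    by move=> _ _ [y <-] [z <-]; exists (y + z); rewrite mulrDl.
  by move=> a _ [y <-]; exists (a * y); rewrite mulrA.
have /(_ x) := proper_ideal_max idI nx.
have [_ ker_pi] := resQ; rewrite -ker_pi => pix0.
by case/eqP: pix; apply: pix0; exists 1; rewrite mul1r.
Qed.

End Local.

Section Noetherian.
Variable Q : comNzRingType.
Hypothesis noethQ : noetherian Q.

Definition submodule b (P : 'rV[Q]_b -> Prop) :=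
  P 0 /\ forall a x y, P x -> P y -> P (a *: x + y).

(** Induction on [b]: the first coordinates form an ideal. Lifts of its generators are joined to
    generators of the elements with first coordinate zero. *)
Lemma noetherian_free b (P : 'rV[Q]_b -> Prop) : submodule P ->
  exists m (G : 'M[Q]_(m, b)), forall x, P x <-> exists a, x = a *m G.
Proof.
elim: b P => [|b IHb] P [P0 PD].
  exists 0%N, 0 => x; split=> [_|_]; first by exists 0; apply/rowP => -[].
  by rewrite [x](_ : _ = 0) //; apply/rowP => -[].
have PS x y : P x -> P y -> P (x + y) by move=> Px Py; rewrite -[x]scale1r; apply: PD.
have PZ a x : P x -> P (a *: x) by move=> Px; rewrite -[_ *: _]addr0; apply: PD.
have Psum m (a : 'I_m -> Q) (x : 'I_m -> 'rV_b.+1) :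
    (forall i, P (x i)) -> P (\sum_i a i *: x i).
  by move=> Px; elim/big_ind: _ => // i _; apply: PZ.
pose I : set Q := fun c => exists2 x, P x & x 0 ord0 = c.
have idI : is_ideal I.
  split; first by exists 0; rewrite ?mxE.
    by move=> _ _ [x Px <-] [y Py <-]; exists (x + y); rewrite ?mxE //; apply: PS.
  by move=> a _ [x Px <-]; exists (a *: x); rewrite ?mxE //; apply: PZ.
have [r [g gP]] := noethQ idI.
have /choice[x0 x0P] : forall i, exists x, P x /\ x 0 ord0 = g i.
  move=> i; suff : I (g i) by case=> x; exists x.
  by apply/gP; exists (fun j => (j == i)%:R); rewrite (bigD1 i) //= eqxx mul1r big1 ?addr0 // =>
    j /negbTE ->; rewrite mul0r.
pose P' (y : 'rV[Q]_b) := P (row_mx (0 : 'rV_1) y).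
have [|m [G GP]] := IHb P'.
  split; first by rewrite /P' row_mx0.
  move=> a x y; rewrite /P' => Px Py.
  have -> : row_mx (0 : 'rV_1) (a *: x + y) =
      a *: (row_mx (0 : 'rV_1) x : 'rV_(1 + b)) + row_mx (0 : 'rV_1) y.
    by rewrite scale_row_mx add_row_mx scaler0 addr0.
  exact: PD.
have mulG0 (c : 'rV_m) : c *m (row_mx (0 : 'cV_m) G : 'M_(m, b.+1)) = row_mx (0 : 'rV_1) (c *m G).
  by have := mul_mx_row c (0 : 'cV_m) G; rewrite mulmx0.
exists (r + m)%N, (col_mx (\matrix_i x0 i) (row_mx (0 : 'cV_m) G)) => x; split=> [Px|[a ->]].
  have [a aE] := (gP (x 0 ord0)).1 (ex_intro2 _ _ x Px erefl).
  pose y := x - \sum_i a i *: x0 i.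
  have Py : P y.
    by rewrite /y addrC -scaleN1r; apply: PD => //; apply: Psum => i; case: (x0P i).
  have y0 : y 0 ord0 = 0.
    rewrite !mxE aE summxE; apply/eqP; rewrite subr_eq0; apply/eqP/eq_bigr => i _.
    by rewrite mxE; case: (x0P i) => _ ->.
  have Ey : y = row_mx (0 : 'rV_1) (rsubmx (y : 'rV_(1 + b))).
    have <- : lsubmx (y : 'rV_(1 + b)) = 0; last by rewrite hsubmxK.
    by apply/rowP => j; rewrite [LHS]mxE [RHS]mxE ord1 -y0; congr (y 0 _); apply: val_inj.
  have [c cE] := (GP (rsubmx (y : 'rV_(1 + b)))).1 (eq_ind _ P Py _ Ey).
  exists (row_mx (\row_i a i) c); rewrite mul_row_col mulG0 -cE -Ey.
  rewrite mulmx_sum_row addrC [X in _ + X](_ : _ = \sum_i a i *: x0 i) ?subrK //.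
  by apply: eq_bigr => i _; rewrite mxE rowK.
rewrite -[a]hsubmxK mul_row_col; apply: PS.
  rewrite mulmx_sum_row; apply: Psum => i; rewrite rowK; by case: (x0P i).
by rewrite mulG0; apply/GP; exists (rsubmx a).
Qed.

Variables (k : fieldType) (pi : {rmorphism Q -> k}).
Hypothesis pi_unit : forall x, pi x != 0 -> exists y, y * x = 1.

(** Take as few generators as possible: a relation with an invertible coefficient would eliminate
    one of them. *)
Lemma minimal_generators b (P : 'rV[Q]_b -> Prop) : submodule P ->
  exists m (G : 'M[Q]_(m, b)), (forall x, P x <-> exists a, x = a *m G) /\
    forall a : 'rV_m, a *m G = 0 -> map_mx pi a = 0.
Proof.
move=> subP.
have ex : exists m, `[< exists G : 'M[Q]_(m, b), forall x, P x <-> exists a, x = a *m G >].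
  by have [m [G GP]] := noetherian_free subP; exists m; apply/asboolP; exists G.
have [m /asboolP[G GP] m_min] := ex_minnP ex.
exists m, G; split=> // a aG; apply/rowP => j; rewrite !mxE; apply/eqP; apply: contraT.
move=> /pi_unit[y ya]; exfalso.
case: m a G GP aG j y ya m_min => [|m] a G GP aG j y ya m_min; first by case: j ya.
have : (m.+1 <= m)%N; last by rewrite ltnn.
apply: m_min; apply/asboolP; exists (row' j G) => x.
have mulG (v : 'rV_m.+1) : v 0 j = 0 -> v *m G = col' j v *m row' j G.
  move=> vj; apply/rowP => l; rewrite !mxE (bigD1_ord j) //= vj mul0r add0r.
  by apply: eq_bigr => i _; rewrite !mxE.
split=> [/GP[c xE]|[c ->]].
  exists (col' j (c - (c 0 j * y) *: a)); rewrite -mulG.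
    by rewrite mulmxBl -scalemxAl aG scaler0 subr0.
  by rewrite !mxE -mulrA ya mulr1 subrr.
apply/GP; exists (\row_i if unlift j i is Some l then c 0 l else 0).
rewrite mulG; last by rewrite mxE unlift_none.
by congr (_ *m _); apply/rowP => l; rewrite !mxE liftK.
Qed.

(** The state of the recursion: a syzygy module, contained in the maximal ideal times its ambient
    free module. The next state is the module of relations among minimal generators of it. *)
Record minimal_state := MinimalState {
  ms_dim : nat;
  ms_pred : 'rV[Q]_ms_dim -> Prop;
  ms_sub : submodule ms_pred;
  ms_red : forall x, ms_pred x -> map_mx pi x = 0 }.

Lemma ms_genP (s : minimal_state) : exists mG : {m : nat & 'M[Q]_(m, ms_dim s)},
  (forall x, @ms_pred s x <-> exists a : 'rV[Q]_(projT1 mG), x = a *m projT2 mG) /\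
  (forall a : 'rV[Q]_(projT1 mG), a *m projT2 mG = 0 -> map_mx pi a = 0).
Proof.
by have [m [G GP]] := minimal_generators (@ms_sub s); exists (existT _ m G).
Qed.

Definition ms_gen s := sval (cid (ms_genP s)).

Lemma ms_next_sub s : submodule (fun a : 'rV[Q]_(projT1 (ms_gen s)) => a *m projT2 (ms_gen s) = 0).
Proof.
split; first by rewrite mul0mx.
by move=> c x y x0 y0; rewrite mulmxDl -scalemxAl x0 y0 scaler0 addr0.
Qed.

Definition ms_next s : minimal_state :=
  MinimalState (ms_next_sub s) (svalP (cid (ms_genP s))).2.

Lemma map_mx_gen s : map_mx pi (projT2 (ms_gen s)) = 0.
Proof.
apply/row_matrixP => i; rewrite -map_row row0; apply: (@ms_red s).
by apply/(svalP (cid (ms_genP s))).1; exists (delta_mx 0 i); rewrite -rowE.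
Qed.

Theorem minimal_resolution (M : lmodType Q) b0 (aug : {linear 'rV[Q]_b0 -> M}) :
  (forall y, exists x, aug x = y) -> (forall x, aug x = 0 -> map_mx pi x = 0) ->
  exists (b : nat -> nat) (d : forall i, 'M[Q]_(b i.+1, b i)) (aug' : {linear 'rV[Q]_(b 0) -> M}),
  [/\ b 0%N = b0, forall y, exists x, aug' x = y,
      forall x, aug' x = 0 <-> exists y, y *m d 0 = x,
      forall n (x : 'rV_(b n.+1)), x *m d n = 0 <-> exists y, y *m d n.+1 = x
    & forall i, map_mx pi (d i) = 0].
Proof.
move=> aug_surj aug_red.
have sub0 : submodule (fun x => aug x = 0).
  split; first exact: linear0.
  by move=> a x y x0 y0; rewrite linearP x0 y0 scaler0 addr0.
pose s0 := MinimalState sub0 aug_red.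
exists (fun i => ms_dim (iter i ms_next s0)), (fun i => projT2 (ms_gen (iter i ms_next s0))), aug.
split=> //.
- by move=> x; rewrite [aug x = 0](propext ((svalP (cid (ms_genP s0))).1 x)); split=> -[y yE];
  exists y.
- move=> i x; have := (svalP (cid (ms_genP (iter i.+1 ms_next s0)))).1 x => E.
  by rewrite [_ = 0](propext E); split=> -[y yE]; exists y.
- by move=> i; apply: map_mx_gen.
Qed.
End Noetherian.

(** The elimination of [minimal_generators], for generators of [M] itself. *)
Lemma minimal_augmentation (Q : comNzRingType) (k : fieldType) (pi : {rmorphism Q -> k})
    (pi_unit : forall x, pi x != 0 -> exists y, y * x = 1) (M : lmodType Q) :
  fin_gen M -> exists b (aug : {linear 'rV[Q]_b -> M}),
    (forall y, exists x, aug x = y) /\ (forall x, aug x = 0 -> map_mx pi x = 0).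
Proof.
move=> [m0 [g0 g0P]].
have ex : exists m, `[< exists aug : {linear 'rV[Q]_m -> M}, forall y, exists x, aug x = y >].
  exists m0; apply/asboolP; exists (row_comb g0) => y.
  have [a ->] := g0P y; exists (\row_i a i) => /=.
  by apply: eq_bigr => i _; rewrite mxE.
have [m /asboolP[aug aug_surj] m_min] := ex_minnP ex.
exists m, aug; split=> // a a0; apply/rowP => j; rewrite !mxE; apply/eqP; apply: contraT.
move=> /pi_unit[y ya]; exfalso.
case: m aug aug_surj a a0 j y ya m_min => [|m] aug aug_surj a a0 j y ya m_min; first by case: j ya.
have : (m.+1 <= m)%N; last by rewrite ltnn.
apply: m_min; apply/asboolP; exists (row_comb (fun i => aug (delta_mx 0 (lift j i)))) => z.
have [c <-] := aug_surj z; pose c' := c - (c 0 j * y) *: a.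
have -> : aug c = aug c' by rewrite linearB (linearZZ aug) a0 scaler0 subr0.
exists (col' j c'); rewrite (linear_rowE aug) (bigD1_ord j) //=.
rewrite [X in X *: _](_ : _ = 0) ?scale0r ?add0r; last first.
  by rewrite !mxE -mulrA ya mulr1 subrr.
by apply: eq_bigr => i _; rewrite !mxE.
Qed.

(** * Finite minimal resolutions as a single graded matrix *)

Section Vanishing.
Variables (S : comNzRingType) (M : lmodType S) (b : nat -> nat).
Variable d : forall i, 'M[S]_(b i.+1, b i).
Variable aug : {linear 'rV[S]_(b 0) -> M}.
Hypothesis aug_surj : forall y, exists x, aug x = y.
Hypothesis aug_ex : forall x, aug x = 0 <-> exists y, y *m d 0 = x.
Hypothesis d_ex : forall n (x : 'rV_(b n.+1)), x *m d n = 0 <-> exists y, y *m d n.+1 = x.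
Variables (k : fieldType) (pi : {rmorphism S -> k}).
Hypothesis d_red : forall i, map_mx pi (d i) = 0.

Lemma map_linear_red (m m' : nat) (h : {linear 'rV[S]_m -> 'rV[S]_m'}) x :
  map_mx pi x = 0 -> map_mx pi (h x) = 0.
Proof.
move=> x0; rewrite (linear_rowE h); apply/rowP => j.
rewrite !mxE summxE rmorph_sum big1 // => i _; rewrite mxE rmorphM.
by move/rowP/(_ i): x0; rewrite !mxE => ->; rewrite mul0r.
Qed.

(** The identity of the minimal resolution is homotopic to a map through [F], which is zero in
    degree [i]. There it is a sum of terms each containing a differential, so it vanishes modulo the
    maximal ideal. *)
Lemma minimal_vanishing p i : projdim_le M p -> (p < i)%N -> b i = 0%N.
Proof.
move=> [F F0] lt_pi; case: i lt_pi => // i lt_pi.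
have [al Lal] := comparison (mx_resolution aug_surj aug_ex d_ex) F.
have [be Lbe] := comparison F (mx_resolution aug_surj aug_ex d_ex).
have [h [_ hS]] := lifting_homotopy (lifting_comp Lal Lbe) (lifting_id _).
case E: (b i.+1) => [//|m]; exfalso.
have j : 'I_(b i.+1) by rewrite E; apply: ord0.
have := hS i (delta_mx 0 j).
rewrite [_ (delta_mx 0 j)](_ : _ = be i.+1 (al i.+1 (delta_mx 0 j))) //.
rewrite (F0 i.+1 lt_pi (al i.+1 _)) linear0 sub0r /= => /(congr1 (map_mx pi)).
rewrite map_mxN map_mxD map_mxM d_red mulmx0 add0r map_linear_red; last first.
  by rewrite map_mxM d_red mulmx0.
move/eqP; rewrite oppr_eq0 map_delta_mx => /eqP/rowP/(_ j)/eqP.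
by rewrite !mxE !eqxx oner_eq0.
Qed.
End Vanishing.

Lemma sum_delta_inj (S : pzRingType) b J (f : 'I_b -> 'I_J) (x : 'rV[S]_b) j :
  injective f -> (\sum_i x 0 i *: delta_mx 0 (f i) : 'rV_J) 0 (f j) = x 0 j.
Proof.
move=> f_inj; rewrite summxE (bigD1 j) //= !mxE !eqxx mulr1 big1 ?addr0 // => i ij.
by rewrite !mxE eqxx (inj_eq f_inj) eq_sym (negbTE ij) mulr0.
Qed.

(** The whole basis is finite and can be numbered, so that a resolution becomes one square matrix
    with a degree for each index, as in the bar construction. *)
Lemma graded_enum (b : nat -> nat) p : (forall i, (p < i)%N -> b i = 0%N) ->
  exists J (tj : 'I_J -> {n : nat & 'I_(b n)}), bijective tj.
Proof.
move=> b0; pose T := {n : 'I_p.+1 & 'I_(b n)}.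
pose f (t : T) : {n : nat & 'I_(b n)} := Tagged (fun n => 'I_(b n)) (tagged t).
have f_inj : injective f.
  move=> [[m lt_m] i] [[m' lt_m'] i'] /= E; have Em : m = m' := congr1 tag E.
  subst m'; rewrite (bool_irrelevance lt_m' lt_m) in i' E *.
  by move/eqP: E; rewrite /f /= eq_Tagged /= => /eqP ->.
exists #|{: T}|, (f \o enum_val).
have f_surj t : exists s, f s = t.
  case: t => m i; have [lt_m|le_m] := ltnP m p.+1.
    by exists (existT (fun n : 'I_p.+1 => 'I_(b n)) (Ordinal lt_m) i).
  by exfalso; move: i; rewrite b0 // => -[].
have [g gK] := choice f_surj.
exists (enum_rank \o g) => [j|t] /=; last by rewrite enum_rankK.
by rewrite (f_inj (g (f (enum_val j))) (enum_val j)) ?enum_valK.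
Qed.

Section Flatten.
Variables (S : comNzRingType) (M : lmodType S) (b : nat -> nat).
Variable d : forall i, 'M[S]_(b i.+1, b i).
Variable aug : {linear 'rV[S]_(b 0) -> M}.
Hypothesis aug_ex : forall x, aug x = 0 <-> exists y, y *m d 0 = x.
Hypothesis d_ex : forall n (x : 'rV_(b n.+1)), x *m d n = 0 <-> exists y, y *m d n.+1 = x.
Variables (J : nat) (tj : 'I_J -> {n : nat & 'I_(b n)}) (jt : {n : nat & 'I_(b n)} -> 'I_J).
Hypotheses (tjK : cancel tj jt) (jtK : cancel jt tj).

Let pos n (i : 'I_(b n)) : 'I_J := jt (Tagged (fun n => 'I_(b n)) i).

Definition fl_dg j := tag (tj j).

Let fl_dg_pos n (i : 'I_(b n)) : fl_dg (pos i) = n.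
Proof. by rewrite /fl_dg /pos jtK. Qed.

Let pos_inj n : injective (@pos n).
Proof.
move=> i i' /(can_inj jtK) E; apply/eqP.
have : Tagged (fun n => 'I_(b n)) i == Tagged (fun n => 'I_(b n)) i' by apply/eqP.
by rewrite eq_Tagged.
Qed.

Let fl_dgP n j : fl_dg j = n -> exists i : 'I_(b n), j = pos i.
Proof.
move=> <-; exists (tagged (tj j)); rewrite /pos -[LHS]tjK; congr jt.
by rewrite /fl_dg; case: (tj j).
Qed.

Definition fl_emb n (x : 'rV[S]_(b n)) : 'rV[S]_J := \sum_i x 0 i *: delta_mx 0 (pos i).

Let emb_inj n : injective (@fl_emb n).
Proof.
move=> x y E; apply/rowP => i.
by rewrite -(sum_delta_inj x i (@pos_inj n)) -(sum_delta_inj y i (@pos_inj n)) -/(fl_emb x) E.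
Qed.

Let emb_homog n (x : 'rV_(b n)) : homog_rV fl_dg n (fl_emb x).
Proof.
move=> j; rewrite /fl_emb summxE => /sum_neq0[i _]; rewrite !mxE /=.
by have [->|] := eqVneq j (pos i); rewrite ?fl_dg_pos // mulr0 eqxx.
Qed.

Let homog_emb n v : homog_rV fl_dg n v -> exists x : 'rV_(b n), v = fl_emb x.
Proof.
move=> hv; exists (\row_i v 0 (pos i)); apply/rowP => j.
have [/fl_dgP[i ->]|ne_jn] := eqVneq (fl_dg j) n.
  by rewrite (sum_delta_inj _ _ (@pos_inj n)) mxE.
have -> : v 0 j = 0 by apply/eqP; apply: contraNT ne_jn => /hv ->.
by apply/esym/eqP; apply: contraNT ne_jn => /emb_homog ->.
Qed.

Let row_d n : 'I_(b n) -> 'rV[S]_J :=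
  match n with 0 => fun _ => 0 | m.+1 => fun i => fl_emb (row i (d m)) end.

Definition fl_d : 'M[S]_J := \matrix_j row_d (tagged (tj j)).

Let row_fl_d n (i : 'I_(b n)) : row (pos i) fl_d = row_d i.
Proof. by rewrite rowK /pos jtK. Qed.

Let emb0 n : fl_emb (0 : 'rV_(b n)) = 0.
Proof. by rewrite /fl_emb big1 // => i _; rewrite mxE scale0r. Qed.

Let emb_d0 (x : 'rV_(b 0)) : fl_emb x *m fl_d = 0.
Proof.
rewrite /fl_emb mulmx_suml big1 // => i _.
by rewrite -scalemxAl -rowE row_fl_d scaler0.
Qed.

Let emb_d n (x : 'rV_(b n.+1)) : fl_emb x *m fl_d = fl_emb (x *m d n).
Proof.
rewrite {1}/fl_emb mulmx_suml.
under eq_bigr => i _ do rewrite -scalemxAl -rowE row_fl_d /= /fl_emb scaler_sumr.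
rewrite exchange_big; apply: eq_bigr => j _ /=; rewrite mxE scaler_suml.
by apply: eq_bigr => i _; rewrite mxE scalerA.
Qed.

Lemma fl_d_homog i j : fl_d i j != 0 -> fl_dg i = (fl_dg j).+1.
Proof.
have [n /fl_dgP[l ->]] : exists n, fl_dg i = n by exists (fl_dg i).
have -> : fl_d (pos l) j = row_d l 0 j by rewrite -row_fl_d [RHS]mxE.
rewrite fl_dg_pos; case: n l => [|n] l /=; first by rewrite mxE eqxx.
by move=> /emb_homog ->.
Qed.

Let d_d n : d n.+1 *m d n = 0.
Proof.
apply/row_matrixP => i; rewrite row_mul row0; apply/d_ex; exists (delta_mx 0 i).
by rewrite -rowE.
Qed.

Lemma fl_dd : fl_d *m fl_d = 0.
Proof.
apply/row_matrixP => i; rewrite row0 row_mul.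
have [n /fl_dgP[l ->]] : exists n, fl_dg i = n by exists (fl_dg i).
rewrite row_fl_d.
case: n l => [|[|n]] l /=; first exact: mul0mx.
  exact: emb_d0.
by rewrite emb_d -row_mul d_d row0 emb0.
Qed.

Lemma fl_acyclic : acyclic fl_dg fl_d.
Proof.
move=> [//|n] v _ /homog_emb[x ->]; rewrite emb_d -(emb0 n) => /emb_inj/d_ex[y <-].
by exists (fl_emb y); rewrite ?emb_d.
Qed.

Let gen n : 'I_(b n) -> M :=
  match n with 0 => fun i => aug (delta_mx 0 i) | m.+1 => fun=> 0 end.

Definition fl_gen j : M := gen (tagged (tj j)).

Let emb_gen (x : 'rV_(b 0)) : \sum_j fl_emb x 0 j *: fl_gen j = aug x.
Proof.
rewrite (linear_rowE aug) /fl_emb.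
under eq_bigr => j _ do rewrite summxE scaler_suml.
rewrite exchange_big; apply: eq_bigr => i _ /=.
rewrite (bigD1 (pos i)) //= !mxE !eqxx mulr1 /fl_gen /pos jtK big1 ?addr0 // => j.
by rewrite !mxE eqxx => /negbTE ->; rewrite mulr0 scale0r.
Qed.

Lemma fl_gen_ex v : homog_rV fl_dg 0 v ->
  (\sum_j v 0 j *: fl_gen j = 0 <-> exists2 w, homog_rV fl_dg 1 w & w *m fl_d = v).
Proof.
move=> /homog_emb[x ->]; rewrite emb_gen aug_ex; split=> [[y <-]|[w /homog_emb[y ->]]].
  by exists (fl_emb y); rewrite ?emb_d.
by rewrite emb_d => /emb_inj <-; exists y.
Qed.

Lemma fl_gen_surj : (forall y, exists x, aug x = y) ->
  forall y, exists2 v, homog_rV fl_dg 0 v & \sum_j v 0 j *: fl_gen j = y.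
Proof. by move=> + y => /(_ y)[x <-]; exists (fl_emb x); rewrite ?emb_gen. Qed.

Lemma card_fl_dg n : #|[pred j | fl_dg j == n]| = b n.
Proof.
rewrite -[RHS]card_ord -(card_codom (@pos_inj n)); apply: eq_card => j.
rewrite !inE; apply/eqP/codomP => [/fl_dgP //|[i ->]]; exact: fl_dg_pos.
Qed.

Lemma fl_d_red (k : fieldType) (pi : {rmorphism S -> k}) :
  (forall i, map_mx pi (d i) = 0) -> map_mx pi fl_d = 0.
Proof.
move=> d_red; apply/row_matrixP => i; rewrite row0 -map_row.
have [n /fl_dgP[l ->]] : exists n, fl_dg i = n by exists (fl_dg i).
rewrite row_fl_d.
case: n l => [|n] l /=; first exact: map_mx0.
apply/rowP => j; rewrite !mxE summxE rmorph_sum big1 // => i' _.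
have /matrixP/(_ l i') := d_red n; rewrite !mxE => E.
by rewrite rmorphM E mul0r.
Qed.
End Flatten.

Record flat_resolution (S : comNzRingType) (k : fieldType) (pi : {rmorphism S -> k})
    (M : lmodType S) := FlatResolution {
  fr_size : nat;
  fr_dg : 'I_fr_size -> nat;
  fr_d : 'M[S]_fr_size;
  fr_gen : 'I_fr_size -> M;
  fr_homog : forall i j, fr_d i j != 0 -> fr_dg i = (fr_dg j).+1;
  fr_dd : fr_d *m fr_d = 0;
  fr_acyclic : acyclic fr_dg fr_d;
  fr_gen_ex : forall v, homog_rV fr_dg 0 v ->
    (\sum_j v 0 j *: fr_gen j = 0 <-> exists2 w, homog_rV fr_dg 1 w & w *m fr_d = v);
  fr_gen_surj : forall y, exists2 v, homog_rV fr_dg 0 v & \sum_j v 0 j *: fr_gen j = y;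
  fr_red : map_mx pi fr_d = 0;
  fr_betti : forall n, betti pi M n = #|[pred j | fr_dg j == n]| }.

(** The rank in degree 0 is recorded because the resolution of [R] must have a single basis element
    there, the unit. *)
Theorem minimal_flat (Q : comNzRingType) (k : fieldType) (pi : {rmorphism Q -> k})
    (M : lmodType Q) p b0 (aug : {linear 'rV[Q]_b0 -> M}) :
  noetherian Q -> (forall x, pi x != 0 -> exists y, y * x = 1) ->
  (forall y, exists x, pi x = y) -> projdim_le M p ->
  (forall y, exists x, aug x = y) -> (forall x, aug x = 0 -> map_mx pi x = 0) ->
  exists F : flat_resolution pi M,
    (forall j, (fr_dg (f := F) j <= p)%N) /\ #|[pred j | fr_dg (f := F) j == 0%N]| = b0.
Proof.
move=> noethQ pi_unit pi_surj pdM aug_surj aug_red.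
have [b [d [aug' [bE surj' ex' d_ex d_red]]]] :=
  minimal_resolution noethQ pi_unit aug_surj aug_red.
have bz i := minimal_vanishing surj' ex' d_ex d_red (i := i) pdM.
have [J [tj [jt tjK jtK]]] := graded_enum bz.
have bettiE' n : betti pi M n = #|[pred j | fl_dg tj j == n]|.
  rewrite (card_fl_dg tjK jtK); apply: (mx_minimal_betti surj' ex' d_ex pi_surj) => i _ _.
  exact: d_red.
exists (FlatResolution (fl_d_homog tjK jtK (d := d)) (fl_dd d_ex tjK jtK)
  (fl_acyclic d_ex tjK jtK) (fl_gen_ex ex' tjK jtK) (fl_gen_surj jtK surj')
  (fl_d_red tjK jtK d_red) bettiE'); split=> [j|] /=.
  rewrite leqNgt; apply/negP => /bz; rewrite /fl_dg.
  by case: (tj j) => m i /= bm; move: i; rewrite bm => -[].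
by rewrite (card_fl_dg tjK jtK).
Qed.

(** * Counting words *)

Section PowerSeries.

(** Truncation transfers commutativity and associativity from polynomials. *)
Lemma fps_mul_coef (f g : fps) n m : (m <= n)%N ->
  fps_mul f g m = ((\poly_(i < n.+1) f i) * (\poly_(i < n.+1) g i))`_m.
Proof.
move=> le_mn; rewrite coefM; apply: eq_bigr => i _; rewrite !coef_poly.
rewrite (leq_ltn_trans (leq_subr _ _)) ?ltnS // (leq_trans _ le_mn) //.
by rewrite -ltnS.
Qed.

Lemma fps_mulC (f g : fps) : fps_mul f g =1 fps_mul g f.
Proof. by move=> n; rewrite !(fps_mul_coef _ _ (leqnn n)) mulrC. Qed.

Lemma fps_mulA (f g h : fps) : fps_mul f (fps_mul g h) =1 fps_mul (fps_mul f g) h.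
Proof.
move=> n; pose P (f : fps) := \poly_(i < n.+1) f i.
transitivity ((P f * P g * P h)`_n).
  rewrite -mulrA coefM; apply: eq_bigr => i _.
  by rewrite (fps_mul_coef _ _ (leq_subr i n)) coef_poly ltn_ord.
rewrite coefM; apply: eq_bigr => i _.
by rewrite (fps_mul_coef _ _ (leq_ord i)) coef_poly ltnS leq_subr.
Qed.

Lemma eq_fps_mul (f f' g g' : fps) : f =1 f' -> g =1 g' -> fps_mul f g =1 fps_mul f' g'.
Proof. by move=> ff' gg' n; apply: eq_bigr => i _; rewrite ff' gg'. Qed.

Lemma fps_mul1 (f : fps) : fps_mul f fps_one =1 f.
Proof.
move=> n; rewrite /fps_mul big_ord_recr /= subnn /fps_one mulr1 big1 ?add0r // => i _.
by rewrite subn_eq0 leqNgt ltn_ord mulr0.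
Qed.

Lemma fps_geom_uniq (f g b : fps) : f 0%N = 0 ->
  (forall n, b n = g n + fps_mul b f n) -> b =1 fps_mul g (fps_geom f).
Proof.
move=> f0 bE n.
have Eg : fps_mul b (fps_sub fps_one f) =1 g.
  move=> m; rewrite -[RHS](addrK (fps_mul b f m)) -bE -[in RHS](fps_mul1 b).
  by rewrite /fps_mul /fps_sub -sumrB; apply: eq_bigr => i _; rewrite mulrBr.
rewrite -(@eq_fps_mul _ _ _ _ Eg (frefl _)) -fps_mulA -[LHS]fps_mul1.
by apply: eq_fps_mul => // m; rewrite fps_mulC fps_geomK.
Qed.
End PowerSeries.

Section Words.
Variables (N : nat) (i0 : 'I_N) (dg : 'I_N -> nat).
Local Notation L := (letter i0).
Hypothesis dg0 : forall i, (dg i == 0%N) = (i == i0).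
Variables (J : nat) (dgG : 'I_J -> nat).
Local Notation wt := (@word_wt N i0 dg).
Local Notation gw := (gword i0 J).
Local Notation gwt := (@gword_wt N i0 dg J dgG).

Fixpoint short_words k : seq (seq L) :=
  if k is k'.+1 then [::] :: [seq a :: u | a <- enum {: L}, u <- short_words k'] else [::].

Lemma mem_short_words k u : (u \in short_words k) = (size u < k)%N.
Proof.
elim: k u => [|k IHk] [|a u] //=; rewrite in_cons ?ltnS -?IHk //=.
apply/allpairsP/idP => [[[b v] [_ vk [_ ->]]] //|uk].
by exists (a, u); rewrite mem_enum.
Qed.

Lemma short_words_uniq k : uniq (short_words k).
Proof.
elim: k => //= k IHk; apply/andP; split.
  by apply/negP => /allpairsP[[a u] [_ _]].
by apply: allpairs_uniq => //; [exact: enum_uniq | move=> [a u] [b v] _ _ [-> ->]].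
Qed.

Lemma size_wt (u : seq L) : (size u <= wt u)%N.
Proof. by elim: u => // a u IHu; rewrite wt_cons addSn ltnS (leq_trans IHu) ?leq_addl. Qed.

Definition words_le n : seq gw :=
  [seq w <- [seq (u, g) | u <- short_words n.+1, g <- enum 'I_J] | (gwt w <= n)%N].

Definition words n : seq gw := [seq w <- words_le n | gwt w == n].

Lemma words_le_uniq n : uniq (words_le n).
Proof.
apply/filter_uniq/allpairs_uniq; [exact: short_words_uniq|exact: enum_uniq|].
by move=> [u g] [v h] _ _ [-> ->].
Qed.

Lemma mem_words_le n w : (w \in words_le n) = (gwt w <= n)%N.
Proof.
rewrite mem_filter andbC; case: leqP => [le_wn|]; last by rewrite andbF.
rewrite andbT; apply/allpairsP; exists w; rewrite mem_short_words mem_enum ltnS.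
by rewrite -surjective_pairing; split=> //; apply: leq_trans (size_wt _) (leq_trans (leq_addr _
  _) le_wn).
Qed.

Lemma words_uniq n : uniq (words n).
Proof. exact/filter_uniq/words_le_uniq. Qed.

Lemma mem_words n w : (w \in words n) = (gwt w == n).
Proof. by rewrite mem_filter mem_words_le; case: eqP => // ->; rewrite leqnn. Qed.

Lemma sum_words (V : nmodType) n m (F : gw -> V) : (n <= m)%N ->
  \sum_(w <- words_le m | gwt w == n) F w = \sum_(w <- words n) F w.
Proof.
move=> le_nm; rewrite -big_filter; apply/perm_big/uniq_perm.
- exact/filter_uniq/words_le_uniq.
- exact: words_uniq.
by move=> w; rewrite mem_words mem_filter mem_words_le; case: eqP => // ->; rewrite le_nm.
Qed.

(** Split off the first letter. On generating series this reads [B = P_G + B t (P_A - 1)], which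
    characterizes the Golod bound. *)
Lemma size_words n :
  size (words n) = (#|[pred g | dgG g == n]| +
    \sum_(i < n) size (words i) * #|[pred j | (j != i0) && (dg j + i.+1 == n)]|)%N.
Proof.
rewrite -sum1_size -sum1_card.
rewrite -(sum_words (fun=> 1%N) (leqnn n)) big_mkcond.
rewrite (S_split (words_le_uniq n) (@mem_words_le n) (fun w => if gwt w == n then 1 else 0)%N) /=.
congr (_ + _)%N.
  rewrite -big_mkcondr; apply: eq_bigl => g; rewrite inE /gwt wt_nil add0n /=.
  by case: eqP => [->|]; rewrite ?leqnn ?andbF.
transitivity (\sum_(i < n) \sum_(w <- words i) \sum_(a : L | (dg (val a) + i.+1 == n)%N) 1)%N.
  under [RHS]eq_bigr => i _ do rewrite -(sum_words _ (ltnW (ltn_ord i))).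
  rewrite [RHS](exchange_big_dep xpredT) //=.
  under [LHS]eq_bigr => a _ do rewrite big_mkcond.
  rewrite [LHS]exchange_big; apply: eq_bigr => w _ /=.
  have gwt_cons a : gwt (a :: w.1, w.2) = (dg (val a) + (gwt w).+1)%N.
    by rewrite /gwt wt_cons addSn addnS addnA.
  have [lt_wn|le_nw] := ltnP (gwt w) n; last first.
    rewrite [RHS]big1 => [|i /eqP Ei]; last by move: le_nw; rewrite Ei leqNgt ltn_ord.
    rewrite big1 // => a _; case: ifP => // _; rewrite gwt_cons; case: eqP => // E.
    by move: le_nw; rewrite -E addnS ltnNge leq_addl.
  rewrite (big_pred1 (Ordinal lt_wn)) //= [RHS]big_mkcond /=; apply: eq_bigr => a _.
  rewrite gwt_cons; case: (_ =P n) => [<-|]; last by case: ifP.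
  by rewrite addnC addSnnS leqnn.
apply: eq_bigr => i _; rewrite -sum1_size big_distrl /=; apply: eq_bigr => w _.
rewrite mul1n -sum1_card big_mkcond /=.
rewrite (sum_letter i0 (fun j => if (dg j + i.+1 == n)%N then 1 else 0)%N) -big_mkcondr.
by apply: eq_bigl => j; rewrite inE.
Qed.
End Words.

(** * The bar resolution over the quotient *)

Section BarResolution.
Variables (Q : comNzRingType) (N : nat) (i0 : 'I_N) (dg : 'I_N -> nat) (dA : 'M[Q]_N).
Local Notation L := (letter i0).
Local Notation wt := (@word_wt N i0 dg).
Hypothesis dg0 : forall i, (dg i == 0%N) = (i == i0).
Hypothesis exA : acyclic dg dA.
Variables (J : nat) (dgG : 'I_J -> nat) (dG : 'M[Q]_J).
Hypothesis hdG : homog_dG dgG dG.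
Hypothesis dGdG : dG *m dG = 0.
Hypothesis exG : acyclic dgG dG.
Variable rho : seq L -> 'M[Q]_N.
Hypothesis hrho : homog_bar dg rho.
Hypothesis rho_unit : bar_unit rho.
Hypothesis rho0 : rho [::] = dA.
Hypothesis rho_mc : forall u, mc dg rho u = curv rho u.
Variable lam : seq L -> 'I_J -> 'M[Q]_(N, J).
Hypothesis hlam : homog_lam dg dgG lam.
Hypothesis lam_unit : mod_unit lam.
Hypothesis lam_mc : forall u g, mod_mc dg dG rho lam u g = 0.
Variables (R : comNzRingType) (phi : {rmorphism Q -> R}) (M : lmodType R).
Hypothesis phi_surj : forall y, exists x, phi x = y.
Hypothesis annA : forall c, in_ann i0 dg dA c <-> phi c = 0.
Variable gen : 'I_J -> M.
Hypothesis gen_ex : forall v : 'rV[Q]_J, homog_rV dgG 0 v ->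
  (\sum_j phi (v 0 j) *: gen j = 0 <-> exists2 w, homog_rV dgG 1 w & w *m dG = v).
Hypothesis gen_surj : forall y, exists2 v : 'rV[Q]_J, homog_rV dgG 0 v
  & \sum_j phi (v 0 j) *: gen j = y.

Local Notation gw := (gword i0 J).
Local Notation gwt := (@gword_wt N i0 dg J dgG).
Local Notation coef := (@bar_coef Q N i0 dg J dG rho lam).

Definition bar_rank n := size (words i0 dg dgG n).

Definition bar_word n (i : 'I_(bar_rank n)) : gw := tnth (in_tuple (words i0 dg dgG n)) i.

Lemma gwt_bar_word n (i : 'I_(bar_rank n)) : gwt (bar_word i) = n.
Proof. by apply/eqP; rewrite -mem_words mem_tnth. Qed.

Lemma bar_word_inj n : injective (@bar_word n).
Proof. by apply/tuple_uniqP; exact: words_uniq. Qed.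

Lemma bar_wordP n w : gwt w = n -> exists i : 'I_(bar_rank n), w = bar_word i.
Proof.
move=> Ew; have : w \in in_tuple (words i0 dg dgG n) by rewrite mem_words Ew.
by move/tnthP.
Qed.

Lemma sum_bar_word (V : nmodType) n m (F : gw -> V) : (n <= m)%N ->
  (forall w, F w != 0 -> gwt w = n) ->
  \sum_(w <- words_le i0 dg dgG m) F w = \sum_(i < bar_rank n) F (bar_word i).
Proof.
move=> le_nm F0; rewrite (bigID (fun w => gwt w == n)) /= [X in _ + X]big1 ?addr0.
  rewrite sum_words //; exact: big_tnth.
by move=> w wn; apply/eqP; apply: contraNT wn => /F0 ->.
Qed.

(** Letters weigh at least two, so these words have none. *)
Lemma sum_bar_word_low (V : nmodType) n (F : gw -> V) : (n <= 1)%N ->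
  \sum_(i < bar_rank n) F (bar_word i) = \sum_(g | dgG g == n) F ([::], g).
Proof.
move=> n1; rewrite -(big_tnth _ _ (words i0 dg dgG n) xpredT F).
rewrite -big_enum -[RHS](big_map (pair [::]) xpredT F); apply/perm_big/uniq_perm.
- exact: words_uniq.
- by rewrite map_inj_uniq ?enum_uniq // => g h [].
move=> [u g]; rewrite mem_words; apply/eqP/mapP => [|[h]]; last first.
  by rewrite mem_enum unfold_in => /eqP Eh [-> ->]; rewrite /gword_wt wt_nil.
case: u => [|a u]; last first.
  rewrite /gword_wt wt_cons => E; move: n1; rewrite -E leqNgt.
  by rewrite addSn addSn ltnS -addnA addn_gt0 (letter_dg dg0).
by rewrite /gword_wt wt_nil => E; exists g => //; rewrite mem_enum unfold_in; apply/eqP.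
Qed.

Definition bar_d n : 'M[R]_(bar_rank n.+1, bar_rank n) :=
  \matrix_(i, j) phi (coef (bar_word i) (bar_word j)).

Definition bar_aug : {linear 'rV[R]_(bar_rank 0) -> M} :=
  row_comb (fun i : 'I_(bar_rank 0) => gen (bar_word i).2).

Lemma bar_aug_surj y : exists x, bar_aug x = y.
Proof.
have [v hv <-] := gen_surj y; exists (\row_i phi (v 0 (bar_word i).2)) => /=.
under eq_bigr => i _ do rewrite mxE.
rewrite (sum_bar_word_low (fun w => phi (v 0 w.2) *: gen w.2)) //= big_mkcond.
apply: eq_bigr => g _; case: eqP => // /eqP; apply: contraNeq => /negP vg.
by apply/eqP/hv; apply/negP => /eqP v0; case: vg; rewrite v0 rmorph0 scale0r.
Qed.

Lemma coef_low g h : coef ([::], g) ([::], h) = - dG g h.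
Proof.
rewrite /bar_coef /= mxE; congr (- _); rewrite summxE (bigD1 h) //= big1 => [|l lh].
  by rewrite eqxx !mxE mulr1 addr0.
by rewrite xpair_eqE (negbTE lh) andbF mxE mxE mulr0.
Qed.

Lemma lift_chain n (x : 'rV[R]_(bar_rank n)) : exists X : gw -> Q,
  (forall w, X w != 0 -> gwt w = n) /\ forall i, phi (X (bar_word i)) = x 0 i.
Proof.
have [s sK] := choice phi_surj.
exists (fun w => \sum_(i | bar_word i == w) s (x 0 i)); split=> [w|i].
  have [/existsP[i /eqP <- _]|] := boolP [exists i : 'I_(bar_rank n), bar_word i == w].
    exact: gwt_bar_word.
  by rewrite negb_exists => /forallP N0; rewrite big1 ?eqxx // => i; rewrite (negbTE (N0 i)).
rewrite (big_pred1 i) ?sK // => j; exact: inj_eq (@bar_word_inj n) _ _.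
Qed.

Lemma coef_homog w w' : coef w w' != 0 -> gwt w = (gwt w').+1.
Proof. exact: (bar_coef_homog hdG hrho hlam). Qed.

(** The curvature left by [bar_square] lies in the annihilator of [H_0(A)], which is the kernel of
    [phi]. *)
Lemma bar_dd n : bar_d n.+1 *m bar_d n = 0.
Proof.
apply/matrixP => i j; rewrite !mxE.
have := bar_square dg0 hdG dGdG hrho rho_unit rho0 rho_mc hlam lam_unit lam_mc
  (words_le_uniq i0 dg dgG n.+2) (mem_words_le dg dgG n.+2) (bar_word j) (w := bar_word i).
rewrite gwt_bar_word => /(_ (leqnn _))/annA.
rewrite (@sum_bar_word _ n.+1) // => [|w].
  rewrite rmorph_sum => E; rewrite -[RHS]E; apply: eq_bigr => l _.
  by rewrite rmorphM !mxE.
have [->|/coef_homog] := eqVneq (coef (bar_word i) w) 0; first by rewrite mul0r eqxx.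
by rewrite gwt_bar_word => -[].
Qed.

Lemma bar_d_ex n (x : 'rV_(bar_rank n.+1)) :
  x *m bar_d n = 0 <-> exists y, y *m bar_d n.+1 = x.
Proof.
split=> [x0|[y <-]]; last by rewrite -mulmxA bar_dd mulmx0.
(* A lift to [Q] is a cycle only modulo the kernel of [phi], which is what [bar_exact] asks for. *)
have [X [hX XE]] := lift_chain x.
have [|||Y hY YE] := bar_exact dg0 exA hdG dGdG exG hrho rho_unit rho0 rho_mc hlam lam_unit lam_mc
  (words_le_uniq i0 dg dgG n.+2) (mem_words_le dg dgG n.+2) (n := n.+1) (x := X) _ _ hX => //.
  move=> w'; apply/annA; rewrite (@sum_bar_word _ n.+1) // => [|w]; last first.
    by have [->|/hX //] := eqVneq (X w) 0; rewrite mul0r eqxx.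
  have [Ew|nw] := eqVneq (gwt w') n; last first.
    rewrite big1 ?rmorph0 // => i _; suff -> : coef (bar_word i) w' = 0 by rewrite mulr0.
    apply/eqP; apply: contraNT nw => /coef_homog; rewrite gwt_bar_word => -[->] //.
  have [j ->] := bar_wordP Ew; move/rowP/(_ j): x0; rewrite !mxE => x0.
  by rewrite rmorph_sum -[RHS]x0; apply: eq_bigr => i _; rewrite rmorphM XE mxE.
exists (\row_i phi (Y (bar_word i))); apply/rowP => j.
rewrite -XE -YE ?gwt_bar_word // (@sum_bar_word _ n.+2) // => [|w]; last first.
  by have [->|/hY //] := eqVneq (Y w) 0; rewrite mul0r eqxx.
by rewrite !mxE rmorph_sum; apply: eq_bigr => i _; rewrite !mxE rmorphM.
Qed.

Lemma bar_word_low n (i : 'I_(bar_rank n)) : (n <= 1)%N ->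
  (bar_word i).1 = [::] /\ dgG (bar_word i).2 = n.
Proof.
move=> n1; have := gwt_bar_word i; rewrite /gword_wt.
case: (bar_word i) => -[|a u] g /=; first by rewrite wt_nil.
rewrite wt_cons => E; move: n1; rewrite -E leqNgt.
by rewrite addSn addSn ltnS -addnA addn_gt0 (letter_dg dg0).
Qed.

(** Without letters in weights 0 and 1, this is the presentation of [M] by [G], up to the sign of
    [bd]. *)
Lemma bar_aug_ex x : bar_aug x = 0 <-> exists y, y *m bar_d 0 = x.
Proof.
have dE (i : 'I_(bar_rank 1)) (j : 'I_(bar_rank 0)) :
    bar_d 0 i j = - phi (dG (bar_word i).2 (bar_word j).2).
  have [[Ei _] [Ej _]] := (bar_word_low i (leqnn 1), bar_word_low j (leq0n 1)).
  rewrite mxE [bar_word i]surjective_pairing [bar_word j]surjective_pairing Ei Ej.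
  by rewrite coef_low rmorphN.
split=> [x0|[y <-]]; last first.
  rewrite mulmx_sum_row linear_sum big1 // => i _; rewrite (linearZZ bar_aug).
  have [_ Eg] := bar_word_low i (leqnn 1).
  suff -> : bar_aug (row i (bar_d 0)) = 0 by rewrite scaler0.
  have h0 : homog_rV dgG 0 (row (bar_word i).2 dG).
    by move=> j; rewrite mxE => /hdG; rewrite Eg => -[].
  have E : \sum_j phi (dG (bar_word i).2 j) *: gen j = 0.
    have [_] := gen_ex h0; under eq_bigr => j _ do rewrite mxE.
    apply; exists (delta_mx 0 (bar_word i).2); last by rewrite -rowE.
    by move=> j; rewrite mxE /=; case: (j =P _) => [-> //|]; rewrite eqxx.
  rewrite /bar_aug /=; under eq_bigr => j _ do rewrite mxE dE.
  rewrite (sum_bar_word_low (fun w => - phi (dG (bar_word i).2 w.2) *: gen w.2)) //=.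
  rewrite big_mkcond -[RHS]oppr0 -[in RHS]E -sumrN; apply: eq_bigr => g _.
  rewrite scaleNr; case: (dgG g =P 0%N) => // /eqP g0.
  have [->|/hdG] := eqVneq (dG (bar_word i).2 g) 0; first by rewrite rmorph0 scale0r oppr0.
  by rewrite Eg => -[] /esym /eqP; rewrite (negbTE g0).
have [X [hX XE]] := lift_chain x; pose v : 'rV[Q]_J := \row_g X ([::], g).
have hv : homog_rV dgG 0 v by move=> g; rewrite mxE => /hX; rewrite /gword_wt wt_nil.
have XE' (i : 'I_(bar_rank 0)) : v 0 (bar_word i).2 = X (bar_word i).
  have [Ei _] := bar_word_low i (leq0n 1).
  by rewrite mxE [in RHS](surjective_pairing (bar_word i)) Ei.
have [] := (gen_ex hv).1.
  rewrite -[RHS]x0 /bar_aug /=.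
  transitivity (\sum_(i < bar_rank 0) phi (v 0 (bar_word i).2) *: gen (bar_word i).2).
    rewrite (sum_bar_word_low (fun w => phi (v 0 w.2) *: gen w.2)) //= [RHS]big_mkcond.
    apply: eq_bigr => g _; case: (dgG g =P 0%N) => // g0.
    have [->|/hv //] := eqVneq (v 0 g) 0; by rewrite rmorph0 scale0r.
  by apply: eq_bigr => i _; rewrite XE' XE.
move=> w hw wE; exists (\row_i - phi (w 0 (bar_word i).2)); apply/rowP => j.
rewrite -XE -XE' -wE !mxE rmorph_sum.
under eq_bigr => i _ do rewrite mxE dE mulrNN.
rewrite (sum_bar_word_low (fun w' => phi (w 0 w'.2) * phi (dG w'.2 (bar_word j).2))) //= big_mkcond.
apply: eq_bigr => g _; rewrite rmorphM; case: (dgG g =P 1%N) => // g1.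
by have [->|/hw //] := eqVneq (w 0 g) 0; rewrite rmorph0 mul0r.
Qed.

Variables (k : fieldType) (piQ : {rmorphism Q -> k}) (piR : {rmorphism R -> k}).
Hypothesis resR : forall x, piR (phi x) = piQ x.
Hypothesis dG_red : map_mx piQ dG = 0.

Lemma bar_dP n : map_mx piR (bar_d n) = 0 <->
  forall w w', gwt w = n.+1 -> piQ (coef w w') = 0.
Proof.
split=> [E w w' Ew|E]; last by apply/matrixP => i j; rewrite !mxE resR E ?gwt_bar_word.
have [->|/coef_homog] := eqVneq (coef w w') 0; first exact: rmorph0.
rewrite Ew => -[/esym Ew']; have [i ->] := bar_wordP Ew; have [j ->] := bar_wordP Ew'.
by move/matrixP/(_ i j): E; rewrite !mxE resR.
Qed.

(** A basis element of lowest degree is a cycle. In positive degree it would be a boundary, but [dG]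
    vanishes modulo the maximal ideal. *)
Lemma degree0_exists (g : 'I_J) : exists g0, dgG g0 = 0%N.
Proof.
pose h := [arg min_(h < g) dgG h]%N.
have h_min g' : (dgG h <= dgG g')%N by rewrite /h; case: arg_minnP => // ? _; apply.
exists h; apply/eqP; rewrite -leqn0 leqNgt; apply/negP => h0.
have hh : homog_rV dgG (dgG h) (delta_mx 0 h : 'rV[Q]_J).
  by move=> j; rewrite mxE /=; case: (j =P h) => [->|]; rewrite ?eqxx.
have [|w _ wE] := exG h0 hh.
  apply/rowP => j; rewrite -rowE !mxE; apply/eqP; apply: contraT => /hdG E.
  by have := h_min j; rewrite E ltnn.
have := congr1 (map_mx piQ) wE; rewrite map_mxM dG_red mulmx0 map_delta_mx.
by move/rowP/(_ h)/eqP; rewrite !mxE !eqxx eq_sym oner_eq0.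
Qed.

Lemma coef_action (a : L) u g h : coef (a :: u, g) ([::], h) = - lam u g (val a) h.
Proof.
rewrite /bar_coef [in LHS]/= mxE; congr (- _).
rewrite [X in X + _ + _]big1 => [|s _]; last first.
  by rewrite big1 // => i _; rewrite /consf; case: insub => [b|] /=; rewrite scaler0.
rewrite (@eq_bd _ _ _ _ _ _ _ _ _ _ (fun _ _ => 0)) // bd0 scaler0 !add0r.
rewrite (bigD1 h) //= eqxx big1 ?addr0 => [|l lh]; first by rewrite !mxE mulr1.
by rewrite xpair_eqE (negbTE lh) andbF scaler0.
Qed.

Lemma wt_neq1 u : wt u != 1%N.
Proof.
case: u => [|a u]; first by rewrite wt_nil.
by rewrite wt_cons gtn_eqF // addSn ltnS addn_gt0 (letter_dg dg0).
Qed.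

Lemma coef_product (a c : L) u g : coef (a :: u, g) ([:: c], g) = - rho u (val a) (val c).
Proof.
rewrite /bar_coef [in LHS]/= mxE; congr (- _).
rewrite [X in _ + X]big1 => [|h _]; last by rewrite scaler0.
(* The differential of [u | g] could only reach [g] if [u] weighed one. *)
rewrite (bd_local hrho hdG hlam (f' := fun _ _ => 0)) => [|v h Ev]; last first.
  case: eqP => // -[_ Ev0 Eh]; move: Ev; rewrite Ev0 Eh wt_nil add0n -add1n => /addIn/esym/eqP.
  by rewrite (negbTE (wt_neq1 u)).
rewrite bd0 scaler0 !addr0 big_splits_top => [|s lt_su Es].
  rewrite (bigD1 (val c)) //= /consf valK eqxx big1 ?addr0 => [|i ic]; first by rewrite !mxE mulr1.
  case: insubP => [b _ bi|_]; last by rewrite scaler0.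
  case: eqP => [[bc]|_]; last by rewrite scaler0.
  by case/eqP: ic; rewrite -bi bc.
rewrite big1 // => i _; rewrite /consf; case: insubP => [b _ bi|_]; last by rewrite scaler0.
case: eqP => [[_ s0]|_]; last by rewrite scaler0.
by move: lt_su; rewrite -Es s0 cats0 ltnn.
Qed.

Section Minimality.
Variables (p q c : nat).
Hypotheses (dg_le : forall i, (dg i <= p)%N) (dgG_le : forall g, (dgG g <= q)%N).
Hypotheses (le_pc : (p <= c)%N) (le_qc : (q <= c.+1)%N).
Hypothesis low : forall n, (n <= c.+1)%N -> map_mx piR (bar_d n) = 0.

Let coef_low0 w w' : (gwt w <= c.+2)%N -> piQ (coef w w') = 0.
Proof.
have [->|/coef_homog Ew] := eqVneq (coef w w') 0; first by rewrite rmorph0.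
by rewrite Ew ltnS => /low/bar_dP; apply.
Qed.

Lemma lam_red (a : L) u g h : piQ (lam u g (val a) h) = 0.
Proof.
have [->|/hlam Eh] := eqVneq (lam u g (val a) h) 0; first by rewrite rmorph0.
apply: oppr_inj; rewrite -rmorphN -coef_action oppr0 coef_low0 //.
(* The word [a | u | g] weighs [dgG h + 1], at most [q + 1], hence at most [c + 2]. *)
by rewrite /gword_wt wt_cons !addSn ltnS -Eh (leq_trans (dgG_le h)).
Qed.

(** The coefficient can be read with any final basis element. With [g0] of degree 0 the word
    [a | u | g0] weighs [dg b + 2], at most [p + 2], within the known range; with [g] it might
    exceed it. *)
Lemma rho_red (a b : L) u (g : 'I_J) : piQ (rho u (val a) (val b)) = 0.
Proof.
have [->|/hrho Eb] := eqVneq (rho u (val a) (val b)) 0; first by rewrite rmorph0.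
have [g0 Eg0] := degree0_exists g.
apply: oppr_inj; rewrite -rmorphN -(coef_product _ _ _ g0) oppr0 coef_low0 //.
by rewrite /gword_wt wt_cons Eg0 addn0 !addSn -Eb !ltnS (leq_trans (dg_le _)).
Qed.

(** By recursion on the word, every entry is a combination of entries of [dG], of [lam] on letters
    and of [rho] between letters. *)
Lemma bar_minimal n : map_mx piR (bar_d n) = 0.
Proof.
apply/bar_dP => -[u g] w' _; rewrite /bar_coef /=.
move: (fun v h => _) => f; elim: u f => [|a u IHu] f /=.
  rewrite mxE summxE rmorphN rmorph_sum big1 ?oppr0 // => h _.
  move/matrixP/(_ g h): dG_red; rewrite !mxE => E; by rewrite rmorphM E mul0r.
rewrite !mxE !summxE rmorphN !rmorphD rmorphM IHu mulr0 addr0.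
rewrite rmorph_sum big1 => [|s _]; last first.
  rewrite summxE rmorph_sum big1 // => i _; rewrite mxE rmorphM /consf.
  by case: insubP => [b _ <-|_]; rewrite ?mxE ?rmorph0 ?mulr0 // rho_red ?mul0r.
by rewrite add0r rmorph_sum big1 ?oppr0 // => h _; rewrite mxE rmorphM lam_red mul0r.
Qed.
End Minimality.
End BarResolution.

(** * The Golod bound and the conclusion *)

Lemma golod_bound_words (N : nat) (i0 : 'I_N) (dg : 'I_N -> nat) (J : nat) (dgG : 'I_J -> nat)
    (f g : fps) :
  (forall i, (dg i == 0%N) = (i == i0)) ->
  (forall n, f n = #|[pred i | dg i == n]|%:Z) ->
  (forall n, g n = #|[pred j | dgG j == n]|%:Z) ->
  forall n, (size (words i0 dg dgG n))%:Z =
    fps_mul g (fps_geom (fps_mulX (fps_sub f fps_one))) n.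
Proof.
move=> dg0 fE gE; apply: fps_geom_uniq => // n.
rewrite size_words PoszD -gE; congr (_ + _).
rewrite /fps_mul big_ord_recr /= subnn mulr0 addr0 -natz natr_sum; apply: eq_bigr => i _.
rewrite natrM !natz; congr (_ * _).
have -> : (n - i)%N = (n - i.+1).+1 by rewrite -subSn.
rewrite /fps_mulX /fps_sub /fps_one fE.
(* Removing the unit from the basis of [A] is the [- 1] in the bound; the suspension of the letters
   is the factor [t]. *)
rewrite (cardD1 i0 [pred i | dg i == _]) inE /=.
have /eqP -> : dg i0 == 0%N by rewrite dg0.
rewrite eq_sym PoszD natz addrC addKr; congr (Posz _).
by apply: eq_card => j; rewrite !inE; congr (_ && _); rewrite -[RHS](eqn_add2r i.+1) subnK.
Qed.

Lemma fin_gen_restrict (Q R : comNzRingType) (phi : {rmorphism Q -> R}) (M : lmodType R) :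
  (forall y, exists x, phi x = y) -> fin_gen M -> fin_gen (restrict phi M).
Proof.
move=> phi_surj [m [g gP]]; exists m, g => x; have [a ->] := gP x.
have [s sK] := choice phi_surj; exists (fun i => s (a i)).
by apply: eq_bigr => i _; rewrite -{1}[a i]sK.
Qed.

Section CyclicAlgebra.
Variables (Q R : comNzRingType) (phi : {rmorphism Q -> R}) (k : fieldType) (piQ : {rmorphism Q ->
  k}).
Hypothesis phi_surj : forall y, exists x, phi x = y.
Variables (F : flat_resolution piQ (restrict phi R^o)) (i0 : 'I_(fr_size F)).
Hypothesis dg0 : forall i, (fr_dg i == 0%N) = (i == i0).

Lemma homog0_delta (v : 'rV[Q]_(fr_size F)) :
  homog_rV (fr_dg (f := F)) 0 v -> v = v 0 i0 *: delta_mx 0 i0.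
Proof.
move=> hv; apply/rowP => j; rewrite !mxE /=; have [->|ne_j] := eqVneq j i0; first by rewrite mulr1.
rewrite mulr0; apply/eqP; apply: contraNT ne_j => /hv Ej.
by rewrite -dg0 Ej.
Qed.

Lemma in_annP c : in_ann i0 (fr_dg (f := F)) (fr_d F) c <-> phi c = 0.
Proof.
have sumE (v : 'rV[Q]_(fr_size F)) : homog_rV (fr_dg (f := F)) 0 v ->
    \sum_j v 0 j *: fr_gen j = phi (v 0 i0) * (fr_gen i0 : R) :> R.
  move=> hv; rewrite {1}(homog0_delta hv) (bigD1 i0) //= big1 ?addr0 => [|j ji].
    by rewrite !mxE !eqxx mulr1.
  by rewrite !mxE eqxx (negbTE ji) mulr0 scale0r.
(* The basis element of degree 0 maps to an invertible element of [R], not necessarily to 1; [e]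
   provides the inverse. *)
have [e he Ee] := fr_gen_surj F (1 : R).
rewrite sumE // in Ee.
have hc : homog_rV (fr_dg (f := F)) 0 (c *: delta_mx 0 i0 : 'rV_(fr_size F)).
  by move=> j; rewrite !mxE /=; case: (j =P i0) => [-> _|]; [apply/eqP;
    rewrite dg0|rewrite mulr0 eqxx].
have := fr_gen_ex hc; rewrite sumE // !mxE !eqxx mulr1 => E.
rewrite /in_ann -E; split=> [c0|->]; last exact: mul0r.
by rewrite -[phi c]mulr1 -[in RHS](mulr0 (phi (e 0 i0))) -c0 -[in LHS]Ee mulrCA.
Qed.
End CyclicAlgebra.

Theorem corollary6p10 (Q : comNzRingType) (n : set Q) (k : fieldType)
    (piQ : {rmorphism Q -> k})
    (locQ : local_ring n) (noethQ : noetherian Q)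
    (resQ : residue_map n piQ)
    (R : comNzRingType) (phi : {rmorphism Q -> R})
    (phi_surj : forall y : R, exists x : Q, phi x = y)
    (piR : {rmorphism R -> k}) (resR : forall x : Q, piR (phi x) = piQ x)
    (M : lmodType R) (fgM : fin_gen M)
    (p q c : nat)
    (pdR : projdim (restrict phi R^o) p)
    (pdM : projdim (restrict phi M) q)
    (cE : c = maxn p q.-1)
    (eq_low : forall i : nat, (i <= c.+1)%N ->
       poincare piR M i = golod_bound phi piQ M i) :
  golod_module phi piQ piR M.
Proof.
have piQ_unit := local_unit locQ resQ; have piQ_surj := resQ.1.
have piR_surj y : exists x, piR x = y.
  by have [x <-] := piQ_surj y; exists (phi x); rewrite resR.
(* [R] is generated by 1 over [Q], hence the rank one in degree 0. *)
have [||F [F_le F_0]] := @minimal_flat Q k piQ (restrict phi R^o) p 1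
    (row_comb (fun=> (1 : R) : restrict phi R^o)) noethQ piQ_unit piQ_surj pdR.1.
- move=> y; have [x xE] := phi_surj y; exists (const_mx x).
  by rewrite /= big_ord1 mxE -xE; apply: mulr1.
- move=> x; rewrite /= big_ord1 => x0; apply/rowP => j.
  by rewrite !mxE ord1 -resR -[phi _]mulr1 [_ * _]x0 rmorph0.
have [bM [aug [aug_surj aug_red]]] := minimal_augmentation piQ_unit (fin_gen_restrict phi_surj fgM).
have [G [G_le _]] := minimal_flat noethQ piQ_unit piQ_surj pdM.1 aug_surj aug_red.
have [i0 i0P] : exists i0, forall i, (fr_dg (f := F) i == 0%N) = (i == i0).
  have /mem_card1[i0 Ei0] := F_0; exists i0 => i; by have := Ei0 i; rewrite !inE.
have annA := in_annP i0P.
have hdA : forall i j, fr_d F i j != 0 -> fr_dg i = (fr_dg j).+1 := @fr_homog _ _ _ _ F.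
have [rho [hrho rho_unit rho0 rho_mc]] := bar_exists i0P hdA (fr_dd F) (@fr_acyclic _ _ _ _ F).
have genG_ex : forall v, homog_rV (fr_dg (f := G)) 0 v ->
    (\sum_j phi (v 0 j) *: (fr_gen j : M) = 0 <->
     exists2 w, homog_rV (fr_dg (f := G)) 1 w & w *m fr_d G = v) := @fr_gen_ex _ _ _ _ G.
have [|lam [hlam lam_unit lam_mc]] := mod_exists i0P hdA (fr_dd F) (@fr_homog _ _ _ _ G)
    (fr_dd G) (@fr_acyclic _ _ _ _ G) _ hrho rho_unit rho0 rho_mc.
  move=> i g Ei Eg; apply/genG_ex.
    by move=> j; rewrite !mxE /=; case: (j =P g) => [-> //|]; rewrite mulr0 eqxx.
  (* The boundary of a degree one element of [A] lies in the kernel of [phi], so it acts by zero on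
     the [R]-module [M]. *)
  rewrite big1 // => j _; rewrite !mxE rmorphM (annA _).1 ?mul0r ?scale0r //.
  exists (delta_mx 0 i).
    by move=> l; rewrite mxE /=; case: (l =P i) => [->|]; rewrite ?eqxx.
  rewrite -rowE; apply/rowP => l; rewrite !mxE /=; have [->|li] := eqVneq l i0;
    first by rewrite mulr1.
  rewrite mulr0; apply/eqP; apply: contraNT li => /hdA; rewrite Ei => -[] /esym/eqP.
  by rewrite i0P.
have genG_surj : forall y : M, exists2 v, homog_rV (fr_dg (f := G)) 0 v
  & \sum_j phi (v 0 j) *: (fr_gen j : M) = y := @fr_gen_surj _ _ _ _ G.
have aug'_surj := bar_aug_surj i0P genG_surj.
have aug'_ex := bar_aug_ex i0P (@fr_homog _ _ _ _ G) rho lam phi_surj genG_ex.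
have d_ex := bar_d_ex i0P (@fr_acyclic _ _ _ _ F) (@fr_homog _ _ _ _ G) (fr_dd G)
  (@fr_acyclic _ _ _ _ G) hrho rho_unit rho0 rho_mc hlam lam_unit lam_mc phi_surj annA.
have rankE i : (bar_rank i0 (fr_dg (f := F)) (fr_dg (f := G)) i)%:Z = golod_bound phi piQ M i.
  by apply: golod_bound_words => // m; congr Posz; apply: fr_betti.
have low i : (i <= c.+1)%N -> map_mx piR (bar_d (fr_dg (f := F)) (fr_dg (f := G)) (fr_d G) rho
  lam phi i) = 0.
  (* Rank and Betti number agree in degree [i], which makes the differential from weight [i.+1] to
     weight [i] minimal. *)
  move=> le_ic; have [] // := mx_betti_minimal aug'_surj aug'_ex d_ex piR_surj (n := i).
  by apply: (can_inj absz_nat); rewrite [LHS]eq_low // rankE.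
move=> i; rewrite -rankE; congr Posz.
apply: (mx_minimal_betti aug'_surj aug'_ex d_ex piR_surj) => j _ _.
apply: (bar_minimal i0P (@fr_homog _ _ _ _ G) (@fr_acyclic _ _ _ _ G) hrho hlam resR (fr_red G)
  F_le G_le _ _ low).
  by rewrite cE leq_maxl.
(* The bound [q <= c.+1] also holds for [q = 0], where [q.-1] is truncated. *)
by rewrite cE; lia.
Qed.
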